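(* Let $d\ge3$, $j\in\{1,\dots,d-2\}$ and $K\in\mathcal K^d_s$. Then $$\tilde\Psi_j(K,\cdot)=R_{d-j,1}\gamma_j^\perp(K,\cdot),$$ where $\tilde\Psi_j(K,\cdot)=\int_{G(d,j+1)}\Psi_j(K|L,\cdot)\,\nu_{j+1}(dL)$.
   Context: $\mathcal K^d_s$ is the set of convex bodies $K\subset\mathbb R^d$ with $K=-K$. $G(d,k)$ is the Grassmannian of $k$-dimensional linear subspaces with rotation invariant probability measure $\nu_k$; $K|L$ is orthogonal projection. $\Psi_j(M,\cdot)$ is the $j$th area measure of a convex body $M$ regarded in $\mathbb R^d$ (total mass the $j$th intrinsic volume), and $\Psi'_j(K|E,\cdot)$ the $j$th area measure of $K|E$ computed within $E$. With $F(d,j+1)=\{(u,E): E\in G(d,j+1),\ u\in S^{d-1}\cap E\}$, the flag measure is $\psi_j(K,\cdot)=\int_{G(d,j+1)}\int_{S^{d-1}\cap E}\mathbf 1\{(u,E)\in\cdot\}\,\Psi'_j(K|E,du)\,\nu_{j+1}(dE)$, and the Grassmann measure $\gamma_j(K,\cdot)$ is its image on $G(d,j)$ under $(u,L)\mapsto u^\perp\cap L$. $\gamma_j^\perp(K,\cdot)$ is the image of $\gamma_j(K,\cdot)$ on $G(d,d-j)$ under $L\mapsto L^\perp$. For $k\in\{2,\dots,d-1\}$ and $f\in C(S^{d-1})$, $(R_{1,k}f)(M)=\int_{S^{d-1}\cap M}f\,d\sigma_M$, $M\in G(d,k)$, where $\sigma_M$ is the rotation invariant probability measure on the unit sphere of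 $M$; for a finite measure $\rho$ on $G(d,k)$, $R_{k,1}\rho$ is the measure on $S^{d-1}$ defined by $\int_{S^{d-1}}f\,d(R_{k,1}\rho)=\int_{G(d,k)}(R_{1,k}f)(M)\,\rho(dM)$ for all $f\in C(S^{d-1})$. *)

(* Defs.v *)
From HB Require Import structures.
From mathcomp Require Import all_boot all_order all_algebra.
From mathcomp Require Import all_classical all_reals all_analysis.
Set Implicit Arguments.
Unset Strict Implicit.
Unset Printing Implicit Defensive.
Import Order.TTheory GRing.Theory Num.Theory.
Import numFieldNormedType.Exports.
Local Open Scope classical_set_scope.
Local Open Scope ring_scope.

Section Defs.
Variables (R : realType) (d : nat).

Local Notation V := 'rV[R]_d.
Local Notation M := 'M[R]_d.

Definition VB := g_sigma_algebraType (@open V).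
Definition MB := g_sigma_algebraType (@open M).

Definition enorm (v : V) : R := Num.sqrt (\sum_(i < d) v ord0 i ^+ 2).
Definition sphere : set V := [set v | enorm v = 1].

(* volume of the unit ball in R^n *)
Fixpoint kappa (n : nat) : R :=
  match n with
  | 0 => 1
  | 1 => 2
  | m.+2 => 2 * pi / (m.+2)%:R * kappa m
  end.

Definition diam (C : set V) : R :=
  sup ([set 0] `|` [set r | exists x y, C x /\ C y /\ r = enorm (x - y)]).

(* k-dimensional Hausdorff measure on R^d (normalized so that on a
   k-dimensional linear subspace it is k-dimensional Lebesgue measure) *)
Definition hausdorff_delta (k : nat) (delta : R) (A : set V) : \bar R :=
  ereal_inf [set (\sum_(0 <= i <oo) ((kappa k * (diam (C i) / 2) ^+ k)%:E))%E
            | C in [set C : nat -> set V |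
                     A `<=` \bigcup_i C i /\
                     forall i x y, C i x -> C i y -> enorm (x - y) <= delta]].
Definition hausdorff (k : nat) (A : set V) : \bar R :=
  ereal_sup [set hausdorff_delta k delta A | delta in [set delta : R | 0 < delta]].

Definition convex_body (K : set V) : Prop :=
  K !=set0 /\ compact K /\
  forall x y (t : R), K x -> K y -> 0 <= t <= 1 -> K (t *: x + (1 - t) *: y).
Definition origin_symmetric (K : set V) : Prop := [set - x | x in K] = K.

Definition dist (K : set V) (x : V) : R := inf [set enorm (x - y) | y in K].

(* local parallel set within the affine frame E (E = setT for R^d):
   points x of E with 0 < d(K,x) <= rho whose outer unit normal
   u(K,x) = (x - p(K,x)) / d(K,x) lies in B *)
Definition local_parallel (E K : set V) (rho : R) (B : set V) : set V :=
  [set x | E x /\ 0 < dist K x /\ dist K x <= rho /\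
           exists y, K y /\ enorm (x - y) = dist K x /\
                     B ((dist K x)^-1 *: (x - y))].

(* mu is the j-th area measure of the convex body K regarded in the
   n-dimensional linear subspace E: it is concentrated on S^{d-1} cap E and
   it is the coefficient of the local Steiner formula
   mu_rho(K,B) = sum_{i<n} rho^(n-i) kappa_(n-i) Psi_i(K,B). *)
Definition is_area_measure (n : nat) (E : set V) (K : set V) (j : nat)
    (mu : {measure set VB -> \bar R}) : Prop :=
  mu (~` (sphere `&` E) : set VB) = 0%E /\
  exists Phi : nat -> set V -> R,
    (forall B : set VB, measurable B -> (B : set V) `<=` sphere `&` E ->
       mu B = (Phi j B)%:E) /\
    (forall B : set VB, measurable B -> (B : set V) `<=` sphere `&` E ->
       forall rho : R, 0 < rho ->
       hausdorff n (local_parallel E K rho B) =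
         (\sum_(i < n) rho ^+ (n - i) * kappa (n - i) * Phi i B)%:E).

(* linear subspaces are represented by their orthogonal projection matrices;
   x |-> x *m P is the orthogonal projection onto the subspace *)
Definition Grass (k : nat) : set M :=
  [set P | P^T = P /\ P *m P = P /\ \rank P = k].
Definition subsp (P : M) : set V := [set x | x *m P = x].
Definition proj_body (K : set V) (P : M) : set V := [set x *m P | x in K].

(* rotations of R^d; x |-> x *m Q maps the subspace of P onto that of Q^T P Q *)
Definition rotation (Q : M) : Prop := Q^T *m Q = 1%:M /\ \det Q = 1.
Definition rot_sub (Q P : M) : M := Q^T *m P *m Q.

Definition grass_prob (k : nat) (nu : {measure set MB -> \bar R}) : Prop :=
  nu setT = 1%E /\ nu (~` Grass k : set MB) = 0%E /\
  forall Q : M, rotation Q -> forall A : set MB, measurable A ->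
    nu ((rot_sub Q) @^-1` A : set MB) = nu A.

Definition sphere_prob (P : M) (sigma : {measure set VB -> \bar R}) : Prop :=
  sigma setT = 1%E /\ sigma (~` (sphere `&` subsp P) : set VB) = 0%E /\
  forall Q : M, rotation Q -> rot_sub Q P = P ->
    forall A : set VB, measurable A ->
      sigma ((fun x : V => x *m Q) @^-1` A : set VB) = sigma A.

(* projection onto (u^perp cap E)^perp = E^perp + R u, for u in E *)
Definition perp_flag (P : M) (u : V) : M := 1%:M - P + u^T *m u.

End Defs.

(* Main.v *)
Require Import Defs.
From HB Require Import structures.
From mathcomp Require Import all_boot all_order all_algebra.
From mathcomp Require Import all_classical all_reals all_analysis.
From mathcomp Require Import measurable_realfun zify ring lra.
Set Implicit Arguments.
Unset Strict Implicit.
Unset Printing Implicit Defensive.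
Import Order.TTheory GRing.Theory Num.Theory.
Import numFieldNormedType.Exports.
Local Open Scope classical_set_scope.
Local Open Scope ring_scope.

(** The identity holds before integrating over L.  Let x = y + z with y in L and
    z orthogonal to L, t the distance of y to K|L and u the outer normal of K|L
    at y within L.  The nearest point of K|L to x is that to y, so the outer
    normal at x is (t u + z) / |t u + z| = (u + w) / |u + w| with w = z / t.
    By Tonelli, the volume of the part of a parallel body in R^d with u and w in
    prescribed sets is a polynomial whose coefficients come from those of the
    local Steiner polynomial within L, and comparing coefficients shows that
    Psi_j(K|L, .) is the image of the product of Psi'_j(K|L, .) and a fixed
    measure q on the orthogonal complement of L under (u, w) |-> (u + w) / |u + w|.
    For fixed u this image of q is twice the restriction of the uniform
    distribution on the sphere of R u + L^perp to the half sphere around u; since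
    Psi'_j(K|L, .) is even, the half spheres around u and - u can be averaged.

    The Steiner formulas are stated with Hausdorff measure, which is identified with
    Lebesgue measure through the isodiametric inequality; the rotation invariant
    probabilities are identified through the uniqueness of measures giving the
    same mass to all balls of the same radius. *)

(** * Euclidean norm and isometries *)

Section euclidean.
Variable R : realType.

(** The area measures are known only through their Steiner formulas, as coefficients of an
    existential family. So each property of them, including evenness and vanishing on normals
    orthogonal to L, is obtained by computing the volume of a local parallel set as a polynomial in
    the radius and reading off one coefficient. The index i is the same in L and in R^d, because the
    integration over w raises the degree j + 1 - i by m = d - j - 1. At i = j the factor is kappa_1
    = 2 within L and kappa_(m+1) in R^d; hence q is 2 / kappa_(m+1) times the central projection of
    the volume of a half ball, and averaging over u and - u leaves 1 / kappa_(m+1), the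
    normalization of the full ball. Normals orthogonal to L are missed by the map from (u, w); they
    contribute to the index j + 1 only. The measures sigma are invariant under rotations of
    determinant 1 alone. A reflection in a vector orthogonal to the subspace corrects the
    determinant; such a vector exists because d - j < d. The upper bound for Hausdorff measure comes
    from repeatedly filling a fixed proportion of an open set by small balls, whose weight equals
    their volume. *)

Definition dot n (x y : 'rV[R]_n) : R := \sum_(i < n) x ord0 i * y ord0 i.

Lemma dotE n (x y : 'rV[R]_n) : dot x y = (x *m y^T) ord0 ord0.
Proof. by rewrite mxE; apply: eq_bigr => i _; rewrite mxE. Qed.

Lemma dotC n (x y : 'rV[R]_n) : dot x y = dot y x.
Proof. by apply: eq_bigr => i _; rewrite mulrC. Qed.

Lemma dotDl n (x y z : 'rV[R]_n) : dot (x + y) z = dot x z + dot y z.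
Proof. by rewrite -big_split; apply: eq_bigr => i _; rewrite mxE mulrDl. Qed.

Lemma dotZl n a (x z : 'rV[R]_n) : dot (a *: x) z = a * dot x z.
Proof. by rewrite mulr_sumr; apply: eq_bigr => i _; rewrite mxE mulrA. Qed.

Lemma dotNl n (x z : 'rV[R]_n) : dot (- x) z = - dot x z.
Proof. by rewrite -scaleN1r dotZl mulN1r. Qed.

Lemma dotBl n (x y z : 'rV[R]_n) : dot (x - y) z = dot x z - dot y z.
Proof. by rewrite dotDl dotNl. Qed.

Lemma dotDr n (x y z : 'rV[R]_n) : dot z (x + y) = dot z x + dot z y.
Proof. by rewrite dotC dotDl !(dotC z). Qed.

Lemma dotZr n a (x z : 'rV[R]_n) : dot z (a *: x) = a * dot z x.
Proof. by rewrite dotC dotZl (dotC z). Qed.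

Lemma dotNr n (x z : 'rV[R]_n) : dot z (- x) = - dot z x.
Proof. by rewrite dotC dotNl (dotC z). Qed.

Lemma dotBr n (x y z : 'rV[R]_n) : dot z (x - y) = dot z x - dot z y.
Proof. by rewrite dotDr dotNr. Qed.

Lemma dot0l n (x : 'rV[R]_n) : dot 0 x = 0.
Proof. by rewrite -(scale0r x) dotZl mul0r. Qed.

Lemma dot0r n (x : 'rV[R]_n) : dot x 0 = 0.
Proof. by rewrite dotC dot0l. Qed.

Lemma dot_ge0 n (x : 'rV[R]_n) : 0 <= dot x x.
Proof. by apply: sumr_ge0 => i _; rewrite -expr2 sqr_ge0. Qed.

Lemma enormE n (x : 'rV[R]_n) : enorm x = Num.sqrt (dot x x).
Proof. by congr Num.sqrt; apply: eq_bigr => i _; rewrite expr2. Qed.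

Lemma enorm_ge0 n (x : 'rV[R]_n) : 0 <= enorm x.
Proof. exact: sqrtr_ge0. Qed.

Lemma enorm_sqr n (x : 'rV[R]_n) : enorm x ^+ 2 = dot x x.
Proof. by rewrite enormE sqr_sqrtr// dot_ge0. Qed.

Lemma coord_le_enorm n (x : 'rV[R]_n) i : `|x ord0 i| <= enorm x.
Proof.
rewrite -(ler_pXn2r (n := 2))// ?nnegrE ?enorm_ge0// enorm_sqr real_normK ?num_real//.
rewrite /dot (bigD1 i)//= expr2 lerDl; apply: sumr_ge0 => k _.
by rewrite -expr2 sqr_ge0.
Qed.

Lemma enorm_eq0 n (x : 'rV[R]_n) : (enorm x == 0) = (x == 0).
Proof.
apply/eqP/eqP => [x0|->]; last by rewrite enormE dot0l sqrtr0.
apply/rowP => i; apply/eqP; rewrite mxE -normr_le0 -x0; exact: coord_le_enorm.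
Qed.

Lemma enorm0 n : enorm (0 : 'rV[R]_n) = 0.
Proof. by apply/eqP; rewrite enorm_eq0. Qed.

Lemma enorm_gt0 n (x : 'rV[R]_n) : (0 < enorm x) = (x != 0).
Proof. by rewrite lt_def enorm_ge0 andbT enorm_eq0. Qed.

Lemma enormZ n a (x : 'rV[R]_n) : enorm (a *: x) = `|a| * enorm x.
Proof.
by rewrite !enormE dotZl dotZr mulrA -expr2 sqrtrM ?sqr_ge0// sqrtr_sqr.
Qed.

Lemma enormN n (x : 'rV[R]_n) : enorm (- x) = enorm x.
Proof. by rewrite -scaleN1r enormZ normrN1 mul1r. Qed.

Lemma enormBC n (x y : 'rV[R]_n) : enorm (x - y) = enorm (y - x).
Proof. by rewrite -enormN opprB. Qed.

(** Cauchy-Schwarz: with a, b the norms of x, y and c their product, the squared norm of b x - a y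
    is 2 a b (a b - c). *)
Lemma dot_le_enorm n (x y : 'rV[R]_n) : dot x y <= enorm x * enorm y.
Proof.
have [->|x0] := eqVneq x 0; first by rewrite dot0l enorm0 mul0r.
have [->|y0] := eqVneq y 0; first by rewrite dot0r enorm0 mulr0.
have := dot_ge0 (enorm y *: x - enorm x *: y).
rewrite dotBl !dotBr !dotZl !dotZr (dotC y x) -!enorm_sqr.
rewrite -!enorm_gt0 in x0 y0.
set a := enorm x in x0 *; set b := enorm y in y0 *; set c := dot x y.
move=> h; have : 0 <= a * b * (a * b - c) by nra.
by rewrite pmulr_rge0 ?mulr_gt0// subr_ge0.
Qed.

Lemma enormD n (x y : 'rV[R]_n) : enorm (x + y) <= enorm x + enorm y.
Proof.
rewrite -(ler_pXn2r (n := 2))// ?nnegrE ?addr_ge0 ?enorm_ge0//.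
rewrite enorm_sqr sqrrD !enorm_sqr dotDl !dotDr (dotC y x).
by have := dot_le_enorm x y; lra.
Qed.

Lemma enormB_triangle n (x y z : 'rV[R]_n) :
  enorm (x - z) <= enorm (x - y) + enorm (y - z).
Proof. by rewrite (le_trans _ (enormD _ _))// addrA subrK. Qed.

Lemma enorm_dist_le n (x y : 'rV[R]_n) : `|enorm x - enorm y| <= enorm (x - y).
Proof.
have := enormD (y - x) x; have := enormD (x - y) y.
rewrite !subrK (enormBC y) => h1 h2; rewrite ler_norml; apply/andP; split; lra.
Qed.

Lemma rV_normE n (x : 'rV[R]_n) : `|x| = \big[Num.max/0]_ij `|x ij.1 ij.2|.
Proof. exact: mx_normrE. Qed.

Lemma enorm_le_mxnorm n (x : 'rV[R]_n) : enorm x <= n%:R * `|x|.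
Proof.
rewrite -(ler_pXn2r (n := 2))// ?nnegrE ?enorm_ge0 ?mulr_ge0//.
rewrite enorm_sqr.
have h i : x ord0 i * x ord0 i <= `|x| ^+ 2.
  rewrite -expr2 -real_normK ?num_real// lerXn2r ?nnegrE//.
  by rewrite rV_normE; apply: (le_bigmax _ (fun ij => `|x ij.1 ij.2|) (ord0, i)).
apply: (@le_trans _ _ (\sum_(i < n) `|x| ^+ 2)).
  exact: ler_sum.
rewrite sumr_const card_ord exprMn -[leLHS]mulr_natl ler_wpM2r ?sqr_ge0//.
by rewrite -natrX ler_nat; case: n {x h} => // n; rewrite leq_pmulr.
Qed.

Lemma mxnorm_le_enorm n (x : 'rV[R]_n) : `|x| <= enorm x.
Proof.
rewrite rV_normE; apply/bigmax_leP; split; first exact: enorm_ge0.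
by move=> [i k] _ /=; rewrite ord1 coord_le_enorm.
Qed.

Lemma near_enorm n (x : 'rV[R]_n) e : 0 < e -> \forall y \near x, enorm (x - y) < e.
Proof.
move=> e0; apply/nbhs_ballP; exists (e / n.+1%:R); rewrite /= ?divr_gt0// => y.
rewrite -ball_normE /= ltr_pdivlMr// mulrC; apply: le_lt_trans.
by rewrite (le_trans (enorm_le_mxnorm _))// ler_wpM2r ?ler_nat.
Qed.

Lemma enorm_continuous n : continuous (@enorm R n).
Proof.
move=> x; apply/(@cvgrPdist_lt _ _ _ _ (nbhs_filter x)) => e e0.
apply: filterS (near_enorm x e0) => y; exact: le_lt_trans (enorm_dist_le _ _).
Qed.

Lemma enorm_row_mx n m (y : 'rV[R]_n) (z : 'rV[R]_m) :
  enorm (row_mx y z) ^+ 2 = enorm y ^+ 2 + enorm z ^+ 2.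
Proof. by rewrite !enorm_sqr !dotE tr_row_mx mul_row_col [LHS]mxE. Qed.

Definition isometric n d (U : 'M[R]_(n, d)) := U *m U^T = 1%:M.

Lemma dot_isometric n d (U : 'M[R]_(n, d)) x y :
  isometric U -> dot (x *m U) (y *m U) = dot x y.
Proof. by move=> hU; rewrite !dotE trmx_mul mulmxA -(mulmxA x) hU mulmx1. Qed.

Lemma enorm_isometric n d (U : 'M[R]_(n, d)) x :
  isometric U -> enorm (x *m U) = enorm x.
Proof. by move=> hU; rewrite !enormE dot_isometric. Qed.

Lemma dot_mulmx_trmx n d (U : 'M[R]_(n, d)) x y : dot (x *m U) y = dot x (y *m U^T).
Proof. by rewrite !dotE trmx_mul trmxK mulmxA. Qed.

Lemma dot_orth n m d (U : 'M[R]_(n, d)) (W : 'M[R]_(m, d)) x y :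
  U *m W^T = 0 -> dot (x *m U) (y *m W) = 0.
Proof.
by move=> UW; rewrite dotE trmx_mul mulmxA -(mulmxA x) UW mulmx0 mul0mx mxE.
Qed.

End euclidean.

(** * Borel sets of row vectors *)

Section borel_structure.
Variable R : realType.

Lemma open_measurable_VB n (U : set 'rV[R]_n) : open U -> measurable (U : set (VB R n)).
Proof. by move=> oU; apply: sub_gen_smallest. Qed.

Lemma closed_measurable_VB n (C : set 'rV[R]_n) : closed C -> measurable (C : set (VB R n)).
Proof.
move=> cC; rewrite -[X in measurable X]setCK; apply: measurableC.
by apply: open_measurable_VB; exact: closed_openC.
Qed.

Lemma continuous_measurable_VB n (g : 'rV[R]_n -> R) :
  continuous g -> measurable_fun setT (g : VB R n -> R).
Proof.
move=> /continuousP cg; apply: (measurability _ (RGenOpens.measurableE R)).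
move=> _ [_ [a [b ->] <-]]; rewrite setTI.
by apply: open_measurable_VB; apply: cg; exact: interval_open.
Qed.

Lemma measurable_coord n (i : 'I_n) :
  measurable_fun setT (fun x : VB R n => (x : 'rV[R]_n) ord0 i).
Proof. by apply: continuous_measurable_VB => x; apply: coord_continuous. Qed.

(** A countable base of boxes. It reduces measurability of maps into [VB], whose sigma-algebra is
    generated by open sets, to measurability of the coordinates. *)
Lemma open_rat_boxes n (U : set 'rV[R]_n) : open U ->
  U = \bigcup_(q in [set q : 'rV[rat]_n * rat |
         [set y : 'rV[R]_n | forall i, `|y ord0 i - ratr (q.1 ord0 i)| < ratr q.2] `<=` U])
        [set y : 'rV[R]_n | forall i, `|y ord0 i - ratr (q.1 ord0 i)| < ratr q.2].
Proof.
move=> oU; apply/seteqP; split; last by move=> x [q qU]; apply: qU.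
move=> x Ux.
have /nbhs_ballP[e /= e0 xeU] : nbhs x U by apply: open_nbhs_nbhs.
have /rat_in_itvoo[r /itvP rE] : 0 < e / 2 by rewrite divr_gt0.
have r0 : 0 < ratr r :> R by rewrite rE.
have hq i : exists q : rat, ratr q \in `](x ord0 i - ratr r), (x ord0 i + ratr r)[%R.
  by apply: rat_in_itvoo; rewrite ltrD2l; lra.
exists (\row_i projT1 (cid (hq i)), r) => /=.
  move=> y /= yq; apply: xeU; split => // i j; rewrite ord1 /ball/=.
  have := yq j; rewrite mxE; case: cid => q /= /itvP qE.
  rewrite !ltr_norml => /andP[h1 h2].
  have re : ratr r < e / 2 by rewrite rE.
  have q1 : x ord0 j - ratr r < ratr q by rewrite qE.
  have q2 : ratr q < x ord0 j + ratr r by rewrite qE.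
  by apply/andP; split; lra.
move=> i; rewrite mxE; case: cid => q /= /itvP qE.
have q1 : x ord0 i - ratr r < ratr q by rewrite qE.
have q2 : ratr q < x ord0 i + ratr r by rewrite qE.
by rewrite ltr_norml; apply/andP; split; lra.
Qed.

Lemma measurable_fun_VB d (T : measurableType d) n (g : T -> 'rV[R]_n) :
  (forall i, measurable_fun setT (fun t => g t ord0 i)) ->
  measurable_fun setT (g : T -> VB R n).
Proof.
move=> mg; apply: (@measurability _ _ T (VB R n) setT g (@open 'rV[R]_n)) => // _ [U oU <-].
rewrite setTI (open_rat_boxes oU) preimage_bigcup.
rewrite bigcup_mkcond; apply: countable_bigcupT_measurable.
  exact: countableP.
move=> q; case: ifP => // _.
rewrite [X in measurable X](_ : _ = \bigcap_(i : 'I_n)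
  ((fun t => g t ord0 i) @^-1` [set y | `|y - ratr (q.1 ord0 i)| < ratr q.2])).
  apply: fin_bigcap_measurable; first exact: finite_finset.
  move=> i _; rewrite -[X in measurable X]setTI; apply: mg => //.
  apply: open_measurable; have := @ball_open R R (ratr (q.1 ord0 i)) (ratr q.2).
  by rewrite -ball_normE /=; under eq_set do rewrite distrC.
by apply/seteqP; split => t /= h i; have := h i => //; exact.
Qed.

Lemma continuous_measurable_VBVB n m (g : 'rV[R]_n -> 'rV[R]_m) :
  continuous g -> measurable_fun setT (g : VB R n -> VB R m).
Proof.
move=> cg; apply: measurable_fun_VB => i.
apply: (@continuous_measurable_VB _ (fun x => g x ord0 i)) => x.
apply: (@continuous_comp _ _ _ g (fun y : 'rV[R]_m => y ord0 i) x); first exact: cg.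
exact: coord_continuous.
Qed.

Lemma measurable_fun_coord d (T : measurableType d) n (g : T -> VB R n) i :
  measurable_fun setT g ->
  measurable_fun setT (fun t => (g t : 'rV[R]_n) ord0 i).
Proof. exact: (measurableT_comp (measurable_coord i)). Qed.

Lemma measurable_funD_VB d (T : measurableType d) n (f g : T -> VB R n) :
  measurable_fun setT f -> measurable_fun setT g ->
  measurable_fun setT (fun t => (f t : 'rV[R]_n) + g t : VB R n).
Proof.
move=> mf mg; apply: measurable_fun_VB => i; under eq_fun do rewrite mxE.
by apply: measurable_funD; exact: measurable_fun_coord.
Qed.

Lemma measurable_fun_mulmx d (T : measurableType d) n m (f : T -> VB R n) (U : 'M[R]_(n, m)) :
  measurable_fun setT f -> measurable_fun setT (fun t => (f t : 'rV[R]_n) *m U : VB R m).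
Proof.
move=> mf; apply: measurable_fun_VB => i; under eq_fun do rewrite mxE.
apply: measurable_sum => k; apply: measurable_funM => //.
exact: measurable_fun_coord.
Qed.

Lemma measurable_funZ_VB d (T : measurableType d) n (a : T -> R) (f : T -> VB R n) :
  measurable_fun setT a -> measurable_fun setT f ->
  measurable_fun setT (fun t => a t *: (f t : 'rV[R]_n) : VB R n).
Proof.
move=> ma mf; apply: measurable_fun_VB => i; under eq_fun do rewrite mxE.
apply: measurable_funM => //; exact: measurable_fun_coord.
Qed.

Lemma measurable_funN_VB d (T : measurableType d) n (f : T -> VB R n) :
  measurable_fun setT f -> measurable_fun setT (fun t => - (f t : 'rV[R]_n) : VB R n).
Proof.
move=> mf; apply: measurable_fun_VB => i; under eq_fun do rewrite mxE.
apply: measurableT_comp => //; exact: measurable_fun_coord.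
Qed.

Lemma measurable_enorm n : measurable_fun setT (fun x : VB R n => enorm x).
Proof. by apply: continuous_measurable_VB; exact: enorm_continuous. Qed.

Lemma measurable_fun_enorm d (T : measurableType d) n (f : T -> VB R n) :
  measurable_fun setT f -> measurable_fun setT (fun t => enorm (f t : 'rV[R]_n)).
Proof. exact: (measurableT_comp (@measurable_enorm n)). Qed.

Lemma measurable_fun_row_mx d (T : measurableType d) n m (f : T -> VB R n) (g : T -> VB R m) :
  measurable_fun setT f -> measurable_fun setT g ->
  measurable_fun setT (fun t => row_mx (f t) (g t) : VB R (n + m)).
Proof.
move=> mf mg; apply: measurable_fun_VB => i; under eq_fun do rewrite mxE.
by case: (fintype.split i) => k; exact: measurable_fun_coord.
Qed.

Lemma measurable_fun_scalar_mx d (T : measurableType d) (f : T -> R) :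
  measurable_fun setT f -> measurable_fun setT (fun t => (f t)%:M : VB R 1).
Proof.
move=> mf; apply: measurable_fun_VB => i; rewrite ord1.
rewrite [X in measurable_fun _ X](_ : _ = f)//.
by apply/funext => t; rewrite mxE [i]ord1 eqxx.
Qed.
End borel_structure.

(** * Lebesgue measure *)

Section image_measure.
Context d1 d2 (T1 : measurableType d1) (T2 : measurableType d2) (R : realType).
Variables (f : T1 -> T2) (mf : measurable_fun setT f).

(* [pushforward] with the measurability proof made part of the term, so that the
   measure structure can be inferred *)
Definition image_measure of measurable_fun setT f := fun (mu : set T1 -> \bar R)
  (A : set T2) => mu (f @^-1` A).

HB.instance Definition _ (mu : {measure set T1 -> \bar R}) :=
  Measure.copy (image_measure mf mu)
    (measure_function_pushforward__canonical__measure_function_Measure mu mf).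

Lemma ge0_integral_image_measure (mu : {measure set T1 -> \bar R}) (g : T2 -> \bar R) D :
  measurable D -> measurable_fun D g -> (forall y, 0 <= g y)%E ->
  (\int[image_measure mf mu]_(y in D) g y = \int[mu]_(x in f @^-1` D) g (f x))%E.
Proof. by move=> mD mg g0; rewrite ge0_integral_pushforward. Qed.

Lemma sigma_finite_image_measure (mu : set T1 -> \bar R) (g : T2 -> T1) :
  measurable_fun setT g -> cancel f g -> sigma_finite setT mu ->
  sigma_finite setT (image_measure mf mu).
Proof.
move=> mg fK [F FT mF].
exists (fun i => g @^-1` F i); first by rewrite -preimage_bigcup -FT.
move=> i; have [mFi Foo] := mF i.
split; first by rewrite -[X in measurable X]setTI; exact: mg.
by rewrite /image_measure -comp_preimage (_ : g \o f = id)//; apply: funext => x /=; rewrite fK.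
Qed.

End image_measure.

Lemma sigma_finite_product d1 d2 (T1 : measurableType d1) (T2 : measurableType d2) (R : realType)
    (m1 : {sigma_finite_measure set T1 -> \bar R}) (m2 : {sigma_finite_measure set T2 -> \bar R}) :
  sigma_finite setT (m1 \x m2)%E.
Proof.
have /sigma_finiteP[F [TF ndF Foo]] := sigma_finiteT m1.
have /sigma_finiteP[G [TG ndG Goo]] := sigma_finiteT m2.
exists (fun n => F n `*` G n).
  rewrite -setXTT TF TG; apply/seteqP; split => -[x y] /=.
    move=> [[i _ Fx] [k _ Gy]]; exists (maxn i k) => //; split => /=.
      exact: (subsetPset _ _ (ndF _ _ (leq_maxl i k))).
    exact: (subsetPset _ _ (ndG _ _ (leq_maxr i k))).
  by move=> [i _ [? ?]]; split; exists i.
move=> k; have [? ?] := Foo k; have [? ?] := Goo k.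
split; first exact: measurableX.
by rewrite product_measure1E// lte_mul_pinfty// ge0_fin_numE.
Qed.

Lemma product_measure_swap d1 d2 (T1 : measurableType d1) (T2 : measurableType d2) (R : realType)
    (m1 : {sigma_finite_measure set T1 -> \bar R}) (m2 : {sigma_finite_measure set T2 -> \bar R})
    (E : set (T1 * T2)) : measurable E ->
  (\int[m1]_x m2 (xsection E x) = \int[m2]_y m1 (ysection E y))%E.
Proof.
move=> mE; have := indic_fubini_tonelli m1 m2 mE.
by rewrite indic_fubini_tonelli_FE// indic_fubini_tonelli_GE.
Qed.

(** * Lebesgue measure on row vectors and uniqueness of translation invariant measures *)

Section lebesgue.
Variable R : realType.
Local Notation RR := (measurableTypeR R).

Definition cons_rV n (p : RR * VB R n) : VB R n.+1 :=
  row_mx (p.1%:M : 'rV_1) (p.2 : 'rV[R]_n) : 'rV_(1 + n).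
Definition uncons_rV n (x : VB R n.+1) : RR * VB R n :=
  ((x : 'rV[R]_n.+1) ord0 ord0, rsubmx (x : 'rV[R]_(1 + n))).

Lemma cons_rVK n : cancel (@cons_rV n) (@uncons_rV n).
Proof.
move=> [a x]; rewrite /uncons_rV /cons_rV /= row_mxKr; congr (_, _).
transitivity (row_mx (a%:M : 'M[R]_1) (x : 'rV[R]_n) ord0 (lshift n ord0)).
  by congr (fun_of_matrix _ _ _); apply: val_inj.
by rewrite row_mxEl mxE.
Qed.

Lemma uncons_rVK n : cancel (@uncons_rV n) (@cons_rV n).
Proof.
move=> x; rewrite /uncons_rV /cons_rV /=.
have -> : ((x : 'rV[R]_n.+1) ord0 ord0)%:M = lsubmx (x : 'rV[R]_(1 + n)).
  by apply/rowP => i; rewrite [i]ord1 !mxE eqxx mulr1n; congr (fun_of_matrix _ _ _); apply: val_inj.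
exact: (@hsubmxK R 1 1 n x).
Qed.

Lemma cons_rV0 n p : (@cons_rV n p : 'rV_n.+1) ord0 ord0 = p.1.
Proof. by have := congr1 fst (cons_rVK p). Qed.

Lemma cons_rVS n p i : (@cons_rV n p : 'rV_n.+1) ord0 (lift ord0 i) = (p.2 : 'rV_n) ord0 i.
Proof.
have /(congr1 (fun q => (q.2 : 'rV[R]_n) ord0 i)) := cons_rVK p.
rewrite /= mxE => <-; congr (fun_of_matrix _ _ _); exact: val_inj.
Qed.

Lemma measurable_cons_rV n : measurable_fun setT (@cons_rV n).
Proof.
apply: (@measurable_fun_row_mx _ _ _ 1 n (fun p : RR * VB R n => p.1%:M) snd) => //.
exact: measurable_fun_scalar_mx.
Qed.

Lemma measurable_uncons_rV n : measurable_fun setT (@uncons_rV n).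
Proof.
apply: measurable_fun_pair; first exact: measurable_coord.
apply: measurable_fun_VB => i; under eq_fun do rewrite mxE.
exact: measurable_coord.
Qed.

Definition lebesgue_cons n (mu : {sigma_finite_measure set (VB R n) -> \bar R}) :=
  image_measure (@measurable_cons_rV n) (@lebesgue_measure R \x mu)%E.

HB.instance Definition _ n (mu : {sigma_finite_measure set (VB R n) -> \bar R}) :=
  Measure.on (lebesgue_cons mu).

Lemma sigma_finite_lebesgue_cons n (mu : {sigma_finite_measure set (VB R n) -> \bar R}) :
  sigma_finite setT (lebesgue_cons mu).
Proof.
apply: (sigma_finite_image_measure _ (@measurable_uncons_rV n) (@cons_rVK n)).
exact: sigma_finite_product.
Qed.

HB.instance Definition _ n (mu : {sigma_finite_measure set (VB R n) -> \bar R}) :=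
  Measure_isSigmaFinite.Build _ _ _ (lebesgue_cons mu) (sigma_finite_lebesgue_cons mu).

(** Sigma-finiteness is carried in the type because the product of the next stage asks for it.
    Dimension 0 is the unit mass at the only point. *)
Fixpoint leb n : {sigma_finite_measure set (VB R n) -> \bar R} :=
  match n with
  | 0 => dirac (0 : VB R 0)
  | n.+1 => lebesgue_cons (leb n)
  end.

Lemma lebS n (A : set (VB R n.+1)) :
  leb n.+1 A = (lebesgue_measure \x leb n)%E (@cons_rV n @^-1` A).
Proof. by []. Qed.

Lemma leb0 (A : set (VB R 0)) : A (0 : 'rV[R]_0) -> leb 0 A = 1%E.
Proof. by move=> A0; rewrite /= diracE mem_set. Qed.

Lemma lebesgue_measureD (a : R) (A : set RR) : measurable A ->
  lebesgue_measure [set x : RR | A (x + a)] = lebesgue_measure A.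
Proof.
move=> mA.
have ma : measurable_fun setT (fun x : RR => x + a : RR) by exact: measurable_funD.
rewrite [RHS](_ : _ = image_measure ma lebesgue_measure A) //.
apply: lebesgue_measure_unique => //= _ [[b c]] _ <-.
rewrite /image_measure (_ : _ @^-1` _ = [set` `]b - a, c - a]]).
  by rewrite !lebesgue_measure_itv/= !lte_fin ltrD2r -!EFinB (_ : c - a - (b - a) = c - b)//; ring.
by apply/seteqP; split=> x /=; rewrite !in_itv/= ltrBlDr lerBrDr.
Qed.

Lemma lebesgue_measure_segment (r : R) : 0 <= r ->
  lebesgue_measure (`[0, r]%classic : set RR) = r%:E.
Proof.
move=> r0; rewrite lebesgue_measure_itv/= lte_fin; case: ltP => h.
  by rewrite oppr0 adde0.
by congr EFin; apply/eqP; rewrite eq_le r0.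
Qed.

Lemma preimage_measurable d d' (T : measurableType d) (T' : measurableType d') (f : T -> T') A :
  measurable_fun setT f -> measurable A -> measurable (f @^-1` A).
Proof. by move=> mf mA; rewrite -[X in measurable X]setTI; exact: mf. Qed.

Lemma cons_rVD n (a : 'rV[R]_n.+1) (p : RR * VB R n) :
  (cons_rV p : 'rV[R]_n.+1) + a =
  cons_rV (p.1 + (uncons_rV a).1, (p.2 : 'rV[R]_n) + (uncons_rV a).2).
Proof.
rewrite -[in LHS](uncons_rVK a); case: (uncons_rV a) => b c.
by rewrite /cons_rV /= (@add_row_mx _ 1 1) -raddfD.
Qed.

Lemma lebD n (a : 'rV[R]_n) (A : set (VB R n)) : measurable A ->
  leb n [set x | A ((x : 'rV_n) + a)] = leb n A.
Proof.
elim: n a A => [|n IH] a A mA.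
  by congr (leb 0 _); apply/seteqP; split => x /=; rewrite (thinmx0 a) addr0.
rewrite !lebS.
pose T (p : RR * VB R n) : RR * VB R n :=
  (p.1 + (uncons_rV a).1, (p.2 : 'rV[R]_n) + (uncons_rV a).2).
have mT : measurable_fun setT T.
  apply: measurable_fun_pair; first exact: measurable_funD.
  exact: measurable_funD_VB.
rewrite [RHS](@product_measure_unique _ _ _ _ _ _ _
  (image_measure mT (lebesgue_measure \x leb n)%E)).
- rewrite /image_measure; congr (_ _); apply/seteqP.
  by split => p /=; rewrite cons_rVD.
- move=> X Y mX mY; transitivity ((lebesgue_measure \x leb n)%E
    ([set x : RR | X (x + (uncons_rV a).1)] `*`
     [set x : VB R n | Y ((x : 'rV[R]_n) + (uncons_rV a).2)])) => //.
  rewrite product_measure1E//.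
  + by congr (_ * _)%E; [exact: lebesgue_measureD|exact: IH].
  + by apply: (preimage_measurable (f := fun x : RR => x + (uncons_rV a).1 : RR)) mX => //; exact: measurable_funD.
  + apply: (preimage_measurable (f := fun x : VB R n => (x : 'rV[R]_n) + (uncons_rV a).2 : VB R n)) mY => //.
    exact: measurable_funD_VB.
- exact: preimage_measurable (@measurable_cons_rV n) mA.
Qed.

Definition cube n (r : R) : set (VB R n) :=
  [set x | forall i, 0 <= (x : 'rV[R]_n) ord0 i <= r].
Arguments cube n r : clear implicits.

Lemma measurable_cube n r : measurable (cube n r).
Proof.
rewrite [X in measurable X](_ : _ = \bigcap_(i : 'I_n)
  ((fun x : VB R n => (x : 'rV[R]_n) ord0 i) @^-1` `[0, r])).
  apply: fin_bigcap_measurable; first exact: finite_finset.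
  by move=> i _; apply: preimage_measurable => //; exact: measurable_coord.
by apply/seteqP; split => x /= h i; have := h i; rewrite /= in_itv//=; exact.
Qed.

Lemma leb_cube n r : 0 <= r -> leb n (cube n r) = (r ^+ n)%:E.
Proof.
move=> r0; elim: n => [|n IH].
  by rewrite /= diracE mem_set// => -[].
rewrite lebS (_ : _ @^-1` _ = `[0, r] `*` cube n r); last first.
  apply/seteqP; split => p /=.
    move=> h; split; first by have := h ord0; rewrite cons_rV0 in_itv.
    by move=> i; have := h (lift ord0 i); rewrite cons_rVS.
  rewrite in_itv/= => -[h1 h2] i; case: (unliftP ord0 i) => [k ->|->].
    by rewrite cons_rVS.
  by rewrite cons_rV0.
rewrite product_measure1E//; last exact: measurable_cube.
by rewrite exprS EFinM -IH; congr (_ * _)%E; exact: lebesgue_measure_segment.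
Qed.

Definition translation_invariant n (mu : set (VB R n) -> \bar R) :=
  forall (a : 'rV[R]_n) (A : set (VB R n)), measurable A ->
    mu [set x | A ((x : 'rV[R]_n) + a)] = mu A.

(** The uniqueness argument for Haar measure. The product measure of [E] is mu A times nu B.
    Invariance of nu allows y to be shifted by x in each fibre, which turns [E] into [F];
    integrating [F] over x first gives the right-hand side, where B is reflected because x enters as
    y - x. *)
Lemma translation_invariant_unique n (mu nu : {sigma_finite_measure set (VB R n) -> \bar R})
    (A B : set (VB R n)) :
  translation_invariant mu -> translation_invariant nu ->
  measurable A -> measurable B ->
  (mu A * nu B = nu A * mu [set x : VB R n | B (- (x : 'rV[R]_n))%R])%E.
Proof.
move=> muD nuD mA mB.
pose E := [set p : VB R n * VB R n | A ((p.1 : 'rV[R]_n) + p.2) /\ B p.2].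
pose F := [set p : VB R n * VB R n | A p.2 /\ B ((p.2 : 'rV[R]_n) - p.1)].
have m1 : measurable_fun setT (fst : VB R n * VB R n -> VB R n) by exact: measurable_fst.
have m2 : measurable_fun setT (snd : VB R n * VB R n -> VB R n) by exact: measurable_snd.
have mE : measurable E.
  rewrite (_ : E = (fun p : VB R n * VB R n => (p.1 : 'rV[R]_n) + p.2 : VB R n) @^-1` A `&`
                   snd @^-1` B)//.
  apply: measurableI; last exact: preimage_measurable mB.
  by apply: preimage_measurable mA; exact: measurable_funD_VB.
have mF : measurable F.
  rewrite (_ : F = snd @^-1` A `&`
    (fun p : VB R n * VB R n => (p.2 : 'rV[R]_n) - p.1 : VB R n) @^-1` B)//.
  apply: measurableI; first exact: preimage_measurable mA.
  apply: preimage_measurable mB; apply: measurable_funD_VB => //.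
  exact: measurable_funN_VB.
transitivity (\int[nu]_y mu (ysection E y))%E.
  transitivity (\int[nu]_(y in B) (cst (mu A) y))%E.
    by rewrite integral_cst.
  rewrite integral_mkcond; apply: eq_integral => y _; rewrite patchE; case: ifPn => yB.
    rewrite -(muD y)//; congr (mu _); apply/seteqP; split => x /=.
      by move=> Ax; rewrite /ysection/= inE; split => //; exact: set_mem.
    by rewrite /ysection/= inE => -[].
  rewrite (_ : ysection E y = set0) ?measure0//; apply/seteqP; split => // x.
  rewrite /ysection/= inE => -[_ /= By]; move/negP: yB; apply; exact: mem_set.
rewrite -product_measure_swap//.
transitivity (\int[mu]_x nu (xsection F x))%E.
  apply: eq_integral => x _; rewrite -(nuD x (xsection F x)); last exact: measurable_xsection.
  congr (nu _); apply/seteqP; split => y; rewrite /xsection/= !inE /E /F /= addrK (addrC x) //.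
rewrite product_measure_swap//.
transitivity (\int[nu]_(y in A) (cst (mu [set x : VB R n | B (- (x : 'rV[R]_n))%R]) y))%E; last first.
  by rewrite integral_cst// muleC.
rewrite [RHS]integral_mkcond; apply: eq_integral => y _; rewrite patchE; case: ifPn => yA.
  rewrite -(muD (- (y : 'rV[R]_n)) [set x : VB R n | B (- (x : 'rV[R]_n))%R]); last first.
    apply: (preimage_measurable (f := fun x : VB R n => - (x : 'rV[R]_n) : VB R n)) mB => //.
    exact: measurable_funN_VB.
  congr (mu _); apply/seteqP; split => x; rewrite /ysection/= inE /F /= opprD opprK addrC.
    by case.
  by move=> Bx; split => //; exact: set_mem.
rewrite (_ : ysection F y = set0) ?measure0//; apply/seteqP; split => // x.
rewrite /ysection/= inE => -[/= Ay]; move/negP: yA; case; exact: mem_set.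
Qed.

Lemma measurable_opp_VB n (B : set (VB R n)) : measurable B ->
  measurable [set x : VB R n | B (- (x : 'rV[R]_n))].
Proof.
apply: (preimage_measurable (f := fun x : VB R n => - (x : 'rV[R]_n) : VB R n)).
exact: measurable_funN_VB.
Qed.

Lemma leb_unit_cube n : leb n (cube n 1) = 1%E.
Proof. by rewrite leb_cube// expr1n. Qed.

(** The reflection in [translation_invariant_unique] disappears when both measures are Lebesgue
    measure and the first set is the unit cube. *)
Lemma lebN n (A : set (VB R n)) : measurable A ->
  leb n [set x : VB R n | A (- (x : 'rV[R]_n))] = leb n A.
Proof.
move=> mA; have h := @translation_invariant_unique n (leb n) (leb n).
by have := h _ _ (@lebD n) (@lebD n) (@measurable_cube n 1) mA; rewrite leb_unit_cube !mul1e.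
Qed.

Lemma translation_invariant_leb n (mu : {sigma_finite_measure set (VB R n) -> \bar R}) A B :
  translation_invariant mu -> measurable A -> measurable B ->
  (mu A * leb n B = leb n A * mu B)%E.
Proof.
move=> muD mA mB.
have := @translation_invariant_unique n mu (leb n) A [set x | B (- (x : 'rV[R]_n))] muD (@lebD n) mA (measurable_opp_VB mB).
rewrite lebN// => ->; congr (_ * mu _)%E.
by apply/seteqP; split => x /=; rewrite opprK.
Qed.

End lebesgue.
Arguments cube {R} n r.

(** * Lebesgue measure under dilations and orthogonal decompositions *)

Section lebesgue_linear.
Variable R : realType.
Local Notation RR := (measurableTypeR R).

(* [mu] itself, with a proof of sigma-finiteness attached *)
Definition with_sigma_finite d (T : measurableType d) (mu : {measure set T -> \bar R})
  of sigma_finite setT mu := (mu : set T -> \bar R).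

HB.instance Definition _ d (T : measurableType d) (mu : {measure set T -> \bar R})
  (h : sigma_finite setT mu) := Measure.copy (with_sigma_finite h) mu.

HB.instance Definition _ d (T : measurableType d) (mu : {measure set T -> \bar R})
  (h : sigma_finite setT mu) := Measure_isSigmaFinite.Build _ _ _ (with_sigma_finite h) h.

Lemma invariant_lebesgue n (mu : {measure set (VB R n) -> \bar R}) A B :
  sigma_finite setT mu -> translation_invariant mu -> measurable A -> measurable B ->
  (mu A * leb R n B = leb R n A * mu B)%E.
Proof. by move=> h; exact: (@translation_invariant_leb _ _ (with_sigma_finite h)). Qed.

(** The image of Lebesgue measure under a dilation is translation invariant, hence a multiple of it.
    The multiple is found on the cube of side c, whose preimage is the unit cube. *)
Lemma leb_scale n (c : R) (A : set (VB R n)) : 0 < c -> measurable A ->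
  leb R n A = ((c ^+ n)%:E * leb R n [set x : VB R n | A (c *: (x : 'rV[R]_n))%R])%E.
Proof.
move=> c0 mA.
have mc (b : R) : measurable_fun setT (fun x : VB R n => b *: (x : 'rV[R]_n) : VB R n).
  exact: measurable_funZ_VB.
have sf : sigma_finite setT (image_measure (mc c) (leb R n)).
  apply: (sigma_finite_image_measure _ (mc c^-1)) => //; last exact: sigma_finiteT.
  by move=> x /=; rewrite scalerA mulVf ?scale1r// gt_eqF.
have ti : translation_invariant (image_measure (mc c) (leb R n)).
  move=> a B mB; rewrite /image_measure.
  rewrite -[RHS](lebD (c^-1 *: a)); last exact: preimage_measurable (mc c) mB.
  congr (leb _ _ _); apply/seteqP; split => x /=;
    by rewrite scalerDr scalerA divff ?gt_eqF ?scale1r// gt_eqF.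
have : (image_measure (mc c) (leb R n) A * leb R n (cube n c) =
  leb R n A * image_measure (mc c) (leb R n) (cube n c))%E.
  exact: (invariant_lebesgue sf ti mA (@measurable_cube _ n c)).
rewrite leb_cube ?ltW// {2}/image_measure.
rewrite (_ : _ @^-1` cube n c = cube n 1); last first.
  apply/seteqP; split => x /= h i; have := h i; rewrite !mxE.
    by rewrite pmulr_rge0// -[leRHS in (_ * _ <= leRHS)%R]mulr1 ler_pM2l.
  by rewrite pmulr_rge0// -[leRHS in (_ * _ <= leRHS)%R]mulr1 ler_pM2l.
by rewrite leb_unit_cube mule1 muleC => <-.
Qed.

Lemma leb_product_translate n m (a : 'rV[R]_n) (b : 'rV[R]_m) (X : set (VB R n * VB R m)) :
  measurable X ->
  (leb R n \x leb R m)%E [set p | X ((p.1 : 'rV_n) + a, (p.2 : 'rV_m) + b)] =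
  (leb R n \x leb R m)%E X.
Proof.
move=> mX.
pose T (p : VB R n * VB R m) : VB R n * VB R m := ((p.1 : 'rV[R]_n) + a, (p.2 : 'rV[R]_m) + b).
have mT : measurable_fun setT T.
  by apply: measurable_fun_pair; exact: measurable_funD_VB.
rewrite [RHS](@product_measure_unique _ _ _ _ _ _ _
  (image_measure mT (leb R n \x leb R m)%E))//.
move=> Y Z mY mZ; transitivity ((leb R n \x leb R m)%E
  ([set x : VB R n | Y ((x : 'rV[R]_n) + a)] `*` [set x : VB R m | Z ((x : 'rV[R]_m) + b)])) => //.
rewrite product_measure1E//; first by congr (_ * _)%E; exact: lebD.
- apply: (preimage_measurable (f := fun x : VB R n => (x : 'rV[R]_n) + a : VB R n)) mY => //.
  exact: measurable_funD_VB.
- apply: (preimage_measurable (f := fun x : VB R m => (x : 'rV[R]_m) + b : VB R m)) mZ => //.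
  exact: measurable_funD_VB.
Qed.

Definition orth_sum n m d (U : 'M[R]_(n, d)) (W : 'M[R]_(m, d)) (p : VB R n * VB R m) : VB R d :=
  p.1 *m U + p.2 *m W.

Lemma measurable_orth_sum n m d (U : 'M[R]_(n, d)) (W : 'M[R]_(m, d)) :
  measurable_fun setT (orth_sum U W).
Proof.
apply: measurable_funD_VB; apply: measurable_fun_mulmx.
  exact: measurable_fst.
exact: measurable_snd.
Qed.

(** The hypothesis splits a translation by a into translations of the two factors by [a *m U^T] and
    [a *m W^T]. *)
Lemma orth_sum_translation_invariant n m d (U : 'M[R]_(n, d)) (W : 'M[R]_(m, d)) :
  U^T *m U + W^T *m W = 1%:M ->
  translation_invariant (image_measure (measurable_orth_sum U W) (leb R n \x leb R m)%E).
Proof.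
move=> UW a A mA; rewrite /image_measure.
rewrite -[RHS](leb_product_translate (a *m U^T) (a *m W^T)); last first.
  exact: preimage_measurable (measurable_orth_sum U W) mA.
have E p : (orth_sum U W p : 'rV[R]_d) + a =
    orth_sum U W ((p.1 : 'rV[R]_n) + a *m U^T, (p.2 : 'rV[R]_m) + a *m W^T).
  rewrite /orth_sum /= !mulmxDl addrACA -!mulmxA; congr (_ + _).
  by rewrite -mulmxDr UW mulmx1.
by congr (_ _); apply/seteqP; split => p /=; rewrite E.
Qed.

Lemma orth_sum_sigma_finite n m d (U : 'M[R]_(n, d)) (W : 'M[R]_(m, d)) :
  isometric U -> isometric W -> U *m W^T = 0 ->
  sigma_finite setT (image_measure (measurable_orth_sum U W) (leb R n \x leb R m)%E).
Proof.
move=> hU hW UW; have WU : W *m U^T = 0 by rewrite -[LHS]trmxK trmx_mul trmxK UW trmx0.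
pose g (x : VB R d) : VB R n * VB R m := (x *m U^T, x *m W^T).
apply: (@sigma_finite_image_measure _ _ _ _ _ _ _ _ g).
- by apply: measurable_fun_pair; exact: measurable_fun_mulmx.
- move=> [y z]; rewrite /g /orth_sum /= !mulmxDl -!mulmxA hU hW UW WU !mulmx1 !mulmx0.
  by rewrite addr0 add0r.
- exact: sigma_finite_product.
Qed.

Definition eball n (r : R) : set (VB R n) := [set x | enorm x <= r].
Arguments eball n r : clear implicits.

Lemma measurable_eball n r : measurable (eball n r).
Proof.
rewrite (_ : eball n r = (fun x : VB R n => enorm x) @^-1` `]-oo, r]).
  by apply: preimage_measurable => //; exact: measurable_enorm.
by apply/seteqP; split => x /=; rewrite in_itv.
Qed.

Lemma enorm_orth_sum n m d (U : 'M[R]_(n, d)) (W : 'M[R]_(m, d)) p :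
  isometric U -> isometric W -> U *m W^T = 0 ->
  enorm (orth_sum U W p : 'rV[R]_d) ^+ 2 = enorm p.1 ^+ 2 + enorm p.2 ^+ 2.
Proof.
move=> hU hW UW; rewrite !enorm_sqr dotDl !dotDr !dot_isometric// dot_orth//.
by rewrite (dotC (_ *m W)) dot_orth// addr0 add0r.
Qed.

Lemma leb_eball_lty n r : (leb R n (eball n r) < +oo)%E.
Proof.
pose s := `|r|.
apply: (@le_lt_trans _ _ (leb R n [set x : VB R n | cube n (2 * s) ((x : 'rV[R]_n) + const_mx s)])).
  apply: le_measure; rewrite ?inE.
  - exact: measurable_eball.
  - apply: (preimage_measurable (f := fun x : VB R n => (x : 'rV[R]_n) + const_mx s : VB R n)).
      exact: measurable_funD_VB.
    exact: measurable_cube.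
  - move=> x /= xr i; rewrite !mxE.
    have := le_trans (coord_le_enorm x i) (le_trans xr (ler_norm r)).
    by rewrite ler_norml -/s => /andP[? ?]; apply/andP; split; lra.
rewrite lebD; last exact: measurable_cube.
have s0 : 0 <= s by exact: normr_ge0.
by rewrite leb_cube ?ltry ?mulr_ge0.
Qed.

Lemma leb_eball_gt0 n r : 0 < r -> (0 < leb R n (eball n r))%E.
Proof.
move=> r0; apply: (@lt_le_trans _ _ (leb R n (cube n (r / n.+1%:R)))).
  by rewrite leb_cube ?lte_fin ?exprn_gt0 ?divr_ge0 ?divr_gt0// ltW.
apply: le_measure; rewrite ?inE; [exact: measurable_cube|exact: measurable_eball|].
move=> x xr; apply: (le_trans (enorm_le_mxnorm _)).
apply: (@le_trans _ _ (n%:R * (r / n.+1%:R))); last first.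
  by rewrite mulrCA ger_pMr// ler_pdivrMr// mul1r ler_nat.
rewrite ler_wpM2l// rV_normE; apply/bigmax_leP; split; first by rewrite divr_ge0// ltW.
by move=> [i k] _ /=; rewrite ord1; have /andP[h1 h2] := xr k; rewrite ger0_norm.
Qed.

(** For coordinate blocks the unit cube is a product of unit cubes, which fixes the constant.
    General orthonormal bases are then compared with this case on the unit ball. *)
Lemma leb_row_mx n m (A : set (VB R (n + m))) : measurable A ->
  leb R (n + m) A = (leb R n \x leb R m)%E
    [set p : VB R n * VB R m | A (row_mx (p.1 : 'rV_n) (p.2 : 'rV_m))].
Proof.
move=> mA.
pose U : 'M[R]_(n, n + m) := row_mx 1%:M 0.
pose W : 'M[R]_(m, n + m) := row_mx 0 1%:M.
have E (p : VB R n * VB R m) : orth_sum U W p = row_mx (p.1 : 'rV_n) (p.2 : 'rV_m).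
  by rewrite /orth_sum !mul_mx_row !mulmx1 !mulmx0 add_row_mx addr0 add0r.
have hU : isometric U by rewrite /isometric tr_row_mx mul_row_col trmx1 trmx0 mulmx1 mulmx0 addr0.
have hW : isometric W by rewrite /isometric tr_row_mx mul_row_col trmx1 trmx0 mulmx1 mulmx0 add0r.
have UW : U *m W^T = 0 by rewrite tr_row_mx mul_row_col trmx1 trmx0 mulmx1 mulmx0 addr0.
have UW1 : U^T *m U + W^T *m W = 1%:M.
  rewrite !tr_row_mx !trmx1 !trmx0 !mul_col_row !mulmx1 !mulmx0 add_block_mx.
  by rewrite !addr0 !add0r -scalar_mx_block.
pose mu := image_measure (measurable_orth_sum U W) (leb R n \x leb R m)%E.
have : (mu A * leb R (n + m) (cube (n + m) 1) = leb R (n + m) A * mu (cube (n + m) 1))%E.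
  exact: (invariant_lebesgue (orth_sum_sigma_finite hU hW UW)
    (orth_sum_translation_invariant UW1) mA (@measurable_cube _ _ _)).
rewrite leb_unit_cube mule1 {2}/mu {1}/image_measure.
rewrite (_ : _ @^-1` cube (n + m) 1 = cube n 1 `*` cube m 1).
  have -> : (leb R n \x leb R m)%E (cube n 1 `*` cube m 1) = 1%E.
    rewrite product_measure1E; [|exact: measurable_cube|exact: measurable_cube].
    by rewrite -[RHS]mule1; congr (_ * _)%E; exact: leb_unit_cube.
  rewrite mule1 => <-; rewrite /mu /image_measure; congr (_ _).
  by apply/seteqP; split => p /=; rewrite E.
apply/seteqP; split => p /=; rewrite E.
  move=> h; split => i; first by have := h (lshift m i); rewrite row_mxEl.
  by have := h (rshift n i); rewrite row_mxEr.
move=> [h1 h2] i; case: (splitP i) => k ik.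
  by rewrite (_ : i = lshift m k) ?row_mxEl//; apply: val_inj.
by rewrite (_ : i = rshift n k) ?row_mxEr//; apply: val_inj.
Qed.

(* Both sides are translation invariant, so it is enough to compare them on the
   unit ball, which the isometry maps to the unit ball. *)
Lemma leb_orth_sum n m d (U : 'M[R]_(n, d)) (W : 'M[R]_(m, d)) (A : set (VB R d)) :
  d = (n + m)%N -> isometric U -> isometric W -> U *m W^T = 0 -> measurable A ->
  leb R d A = (leb R n \x leb R m)%E (orth_sum U W @^-1` A).
Proof.
move=> dnm hU hW UW mA; subst d.
have UW1 : U^T *m U + W^T *m W = 1%:M.
  have WU : W *m U^T = 0 by rewrite -[LHS]trmxK trmx_mul trmxK UW trmx0.
  (* A square matrix with orthonormal rows has orthonormal columns. *)
  have := @mulmx1C _ _ (col_mx U W) (col_mx U W)^T.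
  rewrite tr_col_mx mul_col_row hU hW UW WU -scalar_mx_block => /(_ erefl).
  by rewrite mul_row_col.
pose mu := image_measure (measurable_orth_sum U W) (leb R n \x leb R m)%E.
have : (mu A * leb R (n + m) (eball (n + m) 1) = leb R (n + m) A * mu (eball (n + m) 1))%E.
  exact: (invariant_lebesgue (orth_sum_sigma_finite hU hW UW)
    (orth_sum_translation_invariant UW1) mA (@measurable_eball _ _)).
have -> : mu (eball (n + m) 1) = leb R (n + m) (eball (n + m) 1).
  rewrite leb_row_mx; last exact: measurable_eball.
  rewrite /mu /image_measure; congr (_ _).
  suff E p : enorm (orth_sum U W p : 'rV[R]_(n + m)) = enorm (row_mx (p.1 : 'rV[R]_n) (p.2 : 'rV[R]_m)).
    by apply/seteqP; split => p /=; rewrite /eball /= E.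
  apply/eqP; rewrite -(eqrXn2 (n := 2))// ?enorm_ge0// enorm_orth_sum//.
  by rewrite enorm_row_mx.
have b0 := @leb_eball_gt0 (n + m) 1 ltr01; have boo := @leb_eball_lty (n + m) 1.
have [r rE] : exists r, leb R (n + m) (eball (n + m) 1) = r%:E.
  by exists (fine (leb R (n + m) (eball (n + m) 1))); rewrite fineK// ge0_fin_numE.
rewrite rE; rewrite rE lte_fin in b0.
by move=> /(congr1 (fun x => x * r^-1%:E)%E); rewrite -!muleA -!EFinM divff ?gt_eqF// !mule1 => <-.
Qed.

Lemma leb_orth_sum_integral n m d (U : 'M[R]_(n, d)) (W : 'M[R]_(m, d)) (A : set (VB R d)) :
  d = (n + m)%N -> isometric U -> isometric W -> U *m W^T = 0 -> measurable A ->
  leb R d A = (\int[leb R m]_z leb R n (ysection (orth_sum U W @^-1` A) z))%E.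
Proof.
move=> e hU hW UW mA; rewrite (leb_orth_sum e hU hW UW mA).
exact: (product_measure_swap (leb R n) (leb R m) (preimage_measurable (measurable_orth_sum U W) mA)).
Qed.

End lebesgue_linear.
Arguments eball {R} n r.

(** * Volume of the unit ball *)

Section integrals.
Variable R : realType.
Local Notation RR := (measurableTypeR R).
Implicit Types (f F : R -> R).

(* a wrapper hiding the class [is_derive] from instance resolution *)
Definition has_deriv F (x l : R) := is_derive x 1 F l.

Lemma has_deriv_eq F x l l' : has_deriv F x l -> l = l' -> has_deriv F x l'.
Proof. by move=> h <-. Qed.

Lemma has_derivD f F x a b : has_deriv f x a -> has_deriv F x b ->
  has_deriv (fun y => f y + F y) x (a + b).
Proof. exact: is_deriveD. Qed.

Lemma has_derivM f F x a b : has_deriv f x a -> has_deriv F x b ->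
  has_deriv (fun y => f y * F y) x (f x * b + F x * a).
Proof. exact: is_deriveM. Qed.

Lemma has_deriv_cst a x : has_deriv (fun=> a) x 0.
Proof. exact: is_derive_cst. Qed.

Lemma has_deriv_id x : has_deriv id x 1.
Proof. exact: is_derive_id. Qed.

Lemma has_derivZ c F x a : has_deriv F x a -> has_deriv (fun y => c * F y) x (c * a).
Proof.
by move=> h; have := has_derivM (has_deriv_cst c x) h; rewrite mulr0 addr0.
Qed.

Lemma has_deriv_comp f F x a b : has_deriv f (F x) a -> has_deriv F x b ->
  has_deriv (fun y => f (F y)) x (a * b).
Proof. exact: is_derive1_comp. Qed.

Lemma has_deriv_exp n x : has_deriv (fun y => y ^+ n) x (n%:R * x ^+ n.-1).
Proof.
rewrite /has_deriv; apply: DeriveDef; first exact: exprn_derivable.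
by rewrite exp_derive /GRing.scale/= mulr1.
Qed.

Lemma has_deriv_sqrt x : 0 < x -> has_deriv (@Num.sqrt R) x (2 * Num.sqrt x)^-1.
Proof. exact: is_derive1_sqrt. Qed.

Lemma integral_is_derive f F (a b : R) : a < b ->
  {within `[a, b], continuous f} -> {within `[a, b], continuous F} ->
  (forall x, a < x < b -> has_deriv F x (f x)) ->
  (\int[lebesgue_measure]_(x in `[a, b]) (f x)%:E = (F b - F a)%:E)%E.
Proof.
move=> ab cf cF dF; rewrite (continuous_FTC2 (F := F))//.
  have [_ c1 c2] := (continuous_within_itvP F ab).1 cF.
  by split => // x; rewrite in_itv/= => /dF [].
by move=> x; rewrite in_itv/= => /dF [_ dE]; rewrite derive1E.
Qed.

(** The last integral in the recursion [vballSS], where s is the square of a radius. *)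
Lemma integral_powers_sqrt m :
  (\int[lebesgue_measure]_(s in `[0%R, 1%R]) (Num.sqrt s ^+ m)%:E = (2 / m.+2%:R)%:E :> \bar R)%E.
Proof.
have c k : continuous (fun s : R => Num.sqrt s ^+ k).
  move=> x; apply: (@continuous_comp _ _ _ (@Num.sqrt R) (@GRing.exp R ^~ k)).
    exact: sqrt_continuous.
  exact: exprn_continuous.
rewrite (@integral_is_derive _ (fun s => 2 / m.+2%:R * Num.sqrt s ^+ m.+2))//.
- by rewrite sqrtr1 sqrtr0 expr1n expr0n mulr1 mulr0 subr0.
- exact: continuous_subspaceT.
- by apply: continuous_subspaceT => x; apply: cvgM; [exact: cvg_cst|exact: c].
- move=> x /andP[x0 _].
  have s0 : Num.sqrt x != 0 by rewrite gt_eqF// sqrtr_gt0.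
  apply: has_deriv_eq.
    apply: has_derivZ; exact: has_deriv_comp (has_deriv_exp m.+2 _) (has_deriv_sqrt x0).
  by rewrite /= !exprS; field; rewrite s0 -natrD pnatr_eq0.
Qed.

Lemma integral_power k (r : R) : 0 <= r ->
  (\int[lebesgue_measure]_(s in `[0%R, r]) (s ^+ k)%:E = (r ^+ k.+1 / k.+1%:R)%:E)%E.
Proof.
rewrite le_eqVlt => /predU1P[<-|r0].
  by rewrite set_itv1 integral_set1 expr0n mul0r.
rewrite (@integral_is_derive _ (fun s => s ^+ k.+1 / k.+1%:R))//.
- by rewrite expr0n mul0r subr0.
- by apply: continuous_subspaceT; exact: exprn_continuous.
- by apply: continuous_subspaceT => x; apply: cvgM; [exact: exprn_continuous|exact: cvg_cst].
- move=> x _; rewrite [X in has_deriv X](_ : _ = fun s => k.+1%:R^-1 * s ^+ k.+1); last first.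
    by apply/funext => s; rewrite mulrC.
  apply: has_deriv_eq; first by apply: has_derivZ; exact: has_deriv_exp.
  by rewrite mulrA mulVf ?mul1r// pnatr_eq0.
Qed.

(** Half the area of the unit disc: this is where [pi] enters the ball volumes. The primitive is
    half of t sqrt(1 - t^2) + asin t. *)
Lemma integral_half_disc :
  (\int[lebesgue_measure]_(t in `[(- 1)%R, 1%R]) (Num.sqrt (1 - t ^+ 2))%:E = (pi / 2)%:E :> \bar R)%E.
Proof.
have pi0 : 0 < pi / 2 :> R by rewrite divr_gt0// pi_gt0.
have cs : continuous (fun t : R => Num.sqrt (1 - t ^+ 2)).
  move=> x; apply: (@continuous_comp _ _ _ (fun t : R => 1 - t ^+ 2) (@Num.sqrt R)).
    apply: cvgB; [exact: cvg_cst|exact: exprn_continuous].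
  exact: sqrt_continuous.
rewrite (@integral_is_derive _ (fun t => 2^-1 * (t * Num.sqrt (1 - t ^+ 2) + asin t)))//.
- have a1 : asin 1 = pi / 2 :> R.
    by rewrite -[in LHS](@sin_pihalf R) sinK// in_itv/= lexx andbT; lra.
  have a2 : asin (- 1) = - (pi / 2) :> R.
    by rewrite -[in LHS](@sin_pihalf R) -sinN sinK// in_itv/= lexx /=; lra.
  by rewrite a1 a2 sqrrN expr1n subrr sqrtr0; congr EFin; lra.
- exact: continuous_subspaceT.
- move=> x; apply: cvgM; first exact: cvg_cst.
  apply: cvgD.
    move: x; apply: continuous_subspaceT => x; apply: cvgM; [exact: cvg_id|exact: cs].
  (* Continuity of [asin] up to the endpoints, as the inverse of [sin] on a segment. *)
  move: x; have := @segment_can_le_continuous R (- (pi / 2)) (pi / 2) sin asin.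
  rewrite sinN sin_pihalf; apply; first by lra.
    by apply: continuous_subspaceT; exact: continuous_sin.
  exact: sinK.
- move=> x /andP[x1 x2].
  have x0 : 0 < 1 - x ^+ 2 by nra.
  have s0 : Num.sqrt (1 - x ^+ 2) != 0 by rewrite gt_eqF// sqrtr_gt0.
  have d2 : has_deriv asin x (Num.sqrt (1 - x ^+ 2))^-1 by apply: is_derive1_asin; rewrite x1 x2.
  have d3 : has_deriv (fun t => 1 - t ^+ 2) x (0 + -1 * (2 * x)).
    rewrite [X in has_deriv X](_ : _ = fun t => 1 + -1 * t ^+ 2); last first.
      by apply/funext => t; rewrite mulN1r.
    apply: has_derivD; first exact: has_deriv_cst.
    by apply: has_derivZ; exact: has_deriv_exp.
  apply: has_deriv_eq.
    apply: has_derivZ; apply: has_derivD d2; apply: has_derivM; first exact: has_deriv_id.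
    exact: (@has_deriv_comp _ (fun t => 1 - t ^+ 2) _ _ _ (has_deriv_sqrt x0) d3).
  have := sqr_sqrtr (ltW x0); move: s0; set s := Num.sqrt _ => s0 ss.
  rewrite (_ : x * _ + _ + _ = s + (1 - x ^+ 2) / s); last by field.
  by rewrite -ss; field.
Qed.

End integrals.

(** * The two-step recursion for the volume of the unit ball *)

Section ball_volume.
Variable R : realType.
Local Notation RR := (measurableTypeR R).

Definition vball n : R := fine (leb R n (eball n 1)).

Lemma leb_eball1 n : leb R n (eball n 1) = (vball n)%:E.
Proof. by rewrite fineK// ge0_fin_numE// leb_eball_lty. Qed.

Lemma vball_gt0 n : 0 < vball n.
Proof. by have := @leb_eball_gt0 R n 1 ltr01; rewrite leb_eball1 lte_fin. Qed.

Lemma leb_eball n r : 0 < r -> leb R n (eball n r) = (r ^+ n * vball n)%:E.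
Proof.
move=> r0; rewrite (leb_scale r0); last exact: measurable_eball.
rewrite (_ : [set x | _] = eball n 1) ?leb_eball1//.
apply/seteqP; split => x; rewrite /eball /= enormZ gtr0_norm//.
  by rewrite -[leRHS]mulr1 ler_pM2l.
by move=> h; rewrite -[leRHS]mulr1 ler_pM2l.
Qed.

Lemma vball0 : vball 0 = 1.
Proof. by rewrite /vball leb0//= /eball /= enorm0. Qed.

(** At radius 0 the dimension matters: in dimension 0 the volume is 1, in agreement with 0^0 = 1,
    while in positive dimension the ball lies in a degenerate cube. *)
Lemma leb_eball_ge0 n r : 0 <= r -> leb R n (eball n r) = (r ^+ n * vball n)%:E.
Proof.
rewrite le_eqVlt => /predU1P[<-|]; last exact: leb_eball.
case: n => [|n]; first by rewrite leb0 ?vball0 ?expr0 ?mulr1//= /eball /= enorm0.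
rewrite expr0n mul0r; apply/eqP; rewrite eq_le measure_ge0 andbT.
apply: (@le_trans _ _ (leb R n.+1 (cube n.+1 0))).
  apply: le_measure; rewrite ?inE; [exact: measurable_eball|exact: measurable_cube|].
  move=> x; rewrite /eball /= => x0 i.
  have /eqP : enorm x = 0 by apply/eqP; rewrite eq_le x0 enorm_ge0.
  by rewrite enorm_eq0 => /eqP ->; rewrite mxE lexx.
by rewrite leb_cube// expr0n.
Qed.

Lemma enorm_cons_rV n (p : RR * VB R n) :
  enorm (cons_rV p : 'rV[R]_n.+1) ^+ 2 = (p.1 : R) ^+ 2 + enorm p.2 ^+ 2.
Proof.
rewrite !enorm_sqr /dot big_ord_recl cons_rV0 expr2; congr (_ + _).
by apply: eq_bigr => i _; rewrite cons_rVS.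
Qed.

Lemma eball_sqr n r (x : VB R n) : 0 <= r -> eball n r x = (enorm x ^+ 2 <= r ^+ 2).
Proof. by move=> r0; rewrite /eball /= ler_pXn2r ?nnegrE ?enorm_ge0. Qed.

Lemma vball1 : vball 1 = 2.
Proof.
apply: EFin_inj; rewrite -leb_eball1 lebS.
rewrite (_ : _ @^-1` _ = `[(- 1)%R, 1%R]%classic `*` setT).
  rewrite product_measure1E// [X in (_ * X)%E](_ : _ = 1%E) ?mule1; last exact: leb0.
  rewrite [LHS](_ : _ = lebesgue_measure (`[(- 1)%R, 1%R]%classic : set RR))//.
  rewrite lebesgue_measure_itv/= lte_fin ifT; last by lra.
  by rewrite -EFinD; congr EFin; lra.
apply/seteqP; split => p /=; rewrite eball_sqr// enorm_cons_rV [p.2 : 'rV_0]thinmx0 enorm0.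
  rewrite expr0n addr0 in_itv/= => h; split => //.
  by rewrite -ler_norml -(ler_pXn2r (n := 2)) ?nnegrE// real_normK ?num_real// expr1n.
by rewrite in_itv/= => -[h _]; rewrite expr0n addr0; nra.
Qed.

Lemma vball2 : vball 2 = pi.
Proof.
apply: EFin_inj; rewrite -leb_eball1 lebS /product_measure1.
transitivity (\int[lebesgue_measure]_(t in `[(- 1)%R, 1%R]) (2 * Num.sqrt (1 - (t : R) ^+ 2))%:E)%E.
  rewrite [RHS]integral_mkcond; apply: eq_integral => t _.
  rewrite patchE; case: ifPn => [|].
    rewrite inE/= in_itv/= => tI.
    have t0 : 0 <= 1 - (t : R) ^+ 2 by nra.
    rewrite -[2 * _]mulrC -vball1 -[X in X * _]expr1 -leb_eball_ge0 ?sqrtr_ge0//.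
    congr (leb _ _ _); apply/seteqP; split => x; rewrite /xsection /= inE /= !eball_sqr ?sqrtr_ge0//;
      rewrite enorm_cons_rV /= (sqr_sqrtr t0) => h; lra.
  rewrite notin_setE/= in_itv/= => tI.
  rewrite (_ : xsection _ _ = set0) ?measure0//; apply/seteqP; split => // x.
  rewrite /xsection /= inE /= eball_sqr// enorm_cons_rV /= => h; apply: tI.
  by have := sqr_ge0 (enorm x); nra.
under eq_integral do rewrite EFinM.
rewrite ge0_integralZl_EFin//.
- by rewrite integral_half_disc -EFinM; congr EFin; lra.
- apply/measurable_EFinP; apply: measurable_funTS; apply: measurableT_comp.
    by apply: continuous_measurable_fun; exact: sqrt_continuous.
  by apply: measurable_funB => //; exact: measurable_funX.
Qed.

(** Over a fixed z in R^n the two remaining coordinates fill a disc of area pi (1 - |z|^2), which is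
    pi times the length of the interval [|z|^2, 1]. By Tonelli the volume becomes pi times the
    integral over s in [0, 1] of the volume of the n-ball of radius sqrt s. *)
Lemma vballSS n : vball n.+2 = 2 * pi / n.+2%:R * vball n.
Proof.
apply: EFin_inj; rewrite -leb_eball1.
rewrite (@leb_row_mx R 2 n (eball n.+2 1)); last exact: measurable_eball.
pose E := [set p : VB R n * RR | enorm p.1 ^+ 2 <= p.2 <= 1].
have mE : measurable E.
  rewrite (_ : E = (fun p : VB R n * RR => p.2 - enorm p.1 ^+ 2 : RR) @^-1` `[0, +oo[
     `&` (snd : VB R n * RR -> RR) @^-1` `]-oo, 1]).
    apply: measurableI; last by apply: preimage_measurable => //; exact: measurable_snd.
    apply: preimage_measurable => //; apply: measurable_funB; first exact: measurable_snd.
    apply: measurable_funX; apply: measurable_fun_enorm; exact: measurable_fst.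
  apply/seteqP; split => p; rewrite /E /= !in_itv/= andbT subr_ge0.
    by move=> /andP[].
  by move=> [-> ->].
transitivity (\int[leb R n]_z (pi%:E * lebesgue_measure (xsection E z)))%E.
  rewrite /product_measure1 product_measure_swap; last first.
    apply: (preimage_measurable (f := fun p : VB R 2 * VB R n => row_mx (p.1 : 'rV_2) (p.2 : 'rV_n) : VB R n.+2)).
      by apply: (@measurable_fun_row_mx _ _ _ 2 n); [exact: measurable_fst|exact: measurable_snd].
    exact: measurable_eball.
  apply: eq_integral => z _.
  have [z1|z1] := leP (enorm z ^+ 2) 1.
    have z0 : 0 <= 1 - enorm z ^+ 2 by rewrite subr_ge0.
    rewrite (_ : xsection E z = `[enorm z ^+ 2, 1]%classic); last first.
      by apply/seteqP; split => s; rewrite /xsection/= inE /E/= in_itv.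
    rewrite lebesgue_measure_itv/=.
    rewrite (_ : ysection _ _ = eball 2 (Num.sqrt (1 - enorm z ^+ 2))).
      rewrite leb_eball_ge0// ?sqrtr_ge0// (sqr_sqrtr z0) vball2 EFinM muleC.
      congr (_ * _)%E; case: ltP => //; rewrite lee_fin => h.
      by congr EFin; lra.
    apply/seteqP; split => x; rewrite /ysection/= inE/= !eball_sqr ?sqrtr_ge0//;
      rewrite (sqr_sqrtr z0) expr1n (@enorm_row_mx R 2 n) => h; lra.
  rewrite (_ : xsection E z = set0) ?measure0 ?mule0; last first.
    apply/seteqP; split => // s; rewrite /xsection/= inE /E/= => /andP[h1 h2].
    by move: z1; rewrite ltNge (le_trans h1 h2).
  rewrite (_ : ysection _ _ = set0) ?measure0//; apply/seteqP; split => // x.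
  rewrite /ysection/= inE/= eball_sqr// expr1n (@enorm_row_mx R 2 n) => h.
  by move: z1; rewrite ltNge (le_trans _ h)// lerDr sqr_ge0.
rewrite ge0_integralZl_EFin//; last 2 first.
- exact: measurable_fun_xsection.
- exact: pi_ge0.
rewrite product_measure_swap//.
transitivity (pi%:E * \int[lebesgue_measure]_(s in `[0%R, 1%R]) ((vball n)%:E * (Num.sqrt s ^+ n)%:E))%E.
  congr (_ * _)%E; rewrite [RHS]integral_mkcond.
  apply: eq_integral => s _; rewrite patchE; case: ifPn => [|].
    rewrite inE/= in_itv/= => /andP[s0 s1].
    rewrite -EFinM mulrC -leb_eball_ge0 ?sqrtr_ge0//; congr (leb _ _ _).
    apply/seteqP; split => x; rewrite /ysection/= inE/= eball_sqr ?sqrtr_ge0// (sqr_sqrtr s0) /E /=.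
      by case/andP.
    by move=> ->.
  rewrite notin_setE/= in_itv/= => sI.
  rewrite (_ : ysection _ _ = set0) ?measure0//; apply/seteqP; split => // x.
  rewrite /ysection/= inE /E /= => /andP[h1 h2]; apply: sI.
  by rewrite h2 (le_trans _ h1)// sqr_ge0.
rewrite ge0_integralZl_EFin//.
- by rewrite integral_powers_sqrt -!EFinM; congr EFin; ring.
- apply/measurable_EFinP; apply: measurable_funTS; apply: measurable_funX.
  by apply: continuous_measurable_fun; exact: sqrt_continuous.
- exact/ltW/vball_gt0.
Qed.

Lemma kappaE n : kappa R n = vball n.
Proof.
suff : kappa R n = vball n /\ kappa R n.+1 = vball n.+1 by case.
elim: n => [|n [IH1 IH2]]; first by rewrite vball0 vball1.
by split => //; rewrite vballSS -IH1.
Qed.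
End ball_volume.

(** * The isodiametric inequality *)

Section isodiametric.
Variable R : realType.

Definition diam_le n (D : R) (A : set (VB R n)) :=
  forall x y : 'rV[R]_n, A x -> A y -> enorm (x - y) <= D.

Lemma enorm_rV1 (x : 'rV[R]_1) : enorm x = `|x ord0 ord0|.
Proof. by rewrite enormE /dot big_ord1 -expr2 sqrtr_sqr. Qed.

Lemma leb1_slab (S : set (VB R 1)) a b : measurable S -> a <= b ->
  (forall x : 'rV[R]_1, S x -> a <= x ord0 ord0 <= b) -> (leb R 1 S <= (b - a)%:E)%E.
Proof.
move=> mS ab Sab.
rewrite -[b - a]expr1 -leb_cube ?subr_ge0// -(lebD (- const_mx a) (@measurable_cube R 1 (b - a))).
apply: le_measure; rewrite ?inE//.
  apply: (preimage_measurable (f := fun x : VB R 1 => (x : 'rV[R]_1) - const_mx a : VB R 1) _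
    (@measurable_cube R 1 (b - a))).
  exact: measurable_funD_VB.
by move=> x /Sab/andP[ax xb] i; rewrite [i]ord1 !mxE lerBrDr add0r ax lerB.
Qed.

(* The hulls [a, b] of S and [a', b'] of T satisfy b' - a <= r and b - a' <= r. *)
Lemma leb1_pair (S T : set (VB R 1)) r : measurable S -> measurable T -> S !=set0 -> T !=set0 ->
  (forall x y : 'rV[R]_1, S x -> T y -> enorm (x - y) <= r) ->
  (leb R 1 S + leb R 1 T <= (2 * r)%:E)%E.
Proof.
move=> mS mT [s0 Ss0] [t0 Tt0] ST.
have {}ST (x y : 'rV[R]_1) : S x -> T y -> `|x ord0 ord0 - y ord0 ord0| <= r.
  by move=> Sx Ty; have := ST x y Sx Ty; rewrite enorm_rV1 !mxE.
pose S1 := [set (x : 'rV[R]_1) ord0 ord0 | x in S].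
pose T1 := [set (x : 'rV[R]_1) ord0 ord0 | x in T].
have S10 : S1 !=set0 by exists ((s0 : 'rV[R]_1) ord0 ord0); exists s0.
have T10 : T1 !=set0 by exists ((t0 : 'rV[R]_1) ord0 ord0); exists t0.
have STl s t : S1 s -> T1 t -> s - t <= r.
  by move=> [x Sx <-] [y Ty <-]; apply: le_trans (ler_norm _) (ST _ _ Sx Ty).
have STr s t : S1 s -> T1 t -> t - s <= r.
  by move=> [x Sx <-] [y Ty <-]; apply: le_trans (ler_norm _) _; rewrite distrC; exact: ST.
have [s1 S1s1] := S10; have [t1 T1t1] := T10.
have ubS : has_ubound S1 by exists (t1 + r) => s Ss; rewrite -lerBlDl STl.
have lbS : has_lbound S1 by exists (t1 - r) => s Ss; rewrite lerBlDl -lerBlDr STr.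
have ubT : has_ubound T1 by exists (s1 + r) => t Tt; rewrite -lerBlDl STr.
have lbT : has_lbound T1 by exists (s1 - r) => t Tt; rewrite lerBlDl -lerBlDr STl.
have hS : (leb R 1 S <= (sup S1 - inf S1)%:E)%E.
  apply: leb1_slab => //.
    by apply: (@le_trans _ _ s1); [exact: ge_inf|exact: ub_le_sup].
  by move=> x Sx; apply/andP; split; [apply: ge_inf|apply: ub_le_sup] => //; exists x.
have hT : (leb R 1 T <= (sup T1 - inf T1)%:E)%E.
  apply: leb1_slab => //.
    by apply: (@le_trans _ _ t1); [exact: ge_inf|exact: ub_le_sup].
  by move=> x Sx; apply/andP; split; [apply: ge_inf|apply: ub_le_sup] => //; exists x.
apply: le_trans (leeD hS hT) _; rewrite -EFinD lee_fin.
have h1 : sup S1 <= inf T1 + r.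
  apply: ge_sup => // s Ss; rewrite -lerBlDr; apply: lb_le_inf => // t Tt.
  by rewrite lerBlDl -lerBlDr; exact: STl.
have h2 : sup T1 <= inf S1 + r.
  apply: ge_sup => // t Tt; rewrite -lerBlDr; apply: lb_le_inf => // s Ss.
  by rewrite lerBlDl -lerBlDr; exact: STr.
lra.
Qed.

Definition set_coord n (i : 'I_n) (t : R) (x : 'rV[R]_n) : 'rV[R]_n :=
  \row_j (if j == i then t else x ord0 j).

Definition reflect_coord n (i : 'I_n) (x : 'rV[R]_n) : 'rV[R]_n :=
  \row_j (if j == i then - x ord0 j else x ord0 j).

(** * Steiner symmetrization in one coordinate direction *)

Section steiner.
Variables (n : nat) (i : 'I_n.+1).

(** The i-th axis and the remaining coordinates as an orthogonal decomposition, so that lines in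
    direction i are the fibres of [orth_sum]. *)
Let U : 'M[R]_(1, n.+1) := delta_mx ord0 i.
Let W : 'M[R]_(n, n.+1) := row' i 1%:M.

Let hU : isometric U.
Proof. by rewrite /isometric trmx_delta mul_delta_mx; apply/rowP => k; rewrite !ord1 !mxE !eqxx. Qed.

Let hW : isometric W.
Proof.
rewrite /isometric /W; apply/matrixP => a b; rewrite !mxE (bigD1 (lift i a))//= big1.
  by rewrite addr0 !mxE eqxx mul1r (inj_eq (@lift_inj _ i)) eq_sym.
by move=> k kl; rewrite !mxE eq_sym (negbTE kl) mul0r.
Qed.

Let UW : U *m W^T = 0.
Proof.
apply/matrixP => a b; rewrite !mxE big1// => k _; rewrite !mxE.
rewrite [a]ord1 eqxx /=; have [->|ki] := eqVneq k i; last by rewrite mul0r.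
by rewrite eq_sym (negbTE (neq_lift i b)) mulr0.
Qed.

Let orth_sumE (y : VB R 1) (x : VB R n.+1) :
  orth_sum U W (y, (x : 'rV[R]_n.+1) *m W^T) = set_coord i ((y : 'rV[R]_1) ord0 ord0) x.
Proof.
apply/rowP => j; rewrite /orth_sum /= !mxE big_ord1 !mxE eqxx /=.
have [->|ji] := eqVneq j i.
  rewrite mulr1 big1 ?addr0// => k _; rewrite !mxE.
  by rewrite eq_sym (negbTE (neq_lift i k)) mulr0.
rewrite mulr0 add0r; have [k jk _] := unlift_some (n := n.+1) (h := i) (i := j) (ltac:(by rewrite eq_sym)).
rewrite (bigD1 k)//= big1 ?addr0; last first.
  by move=> l lk; rewrite !mxE jk (inj_eq (@lift_inj _ i)) (negbTE lk) mulr0.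
rewrite !mxE jk eqxx mulr1 (bigD1 (lift i k))//= big1 ?addr0.
  by rewrite !mxE eqxx mulr1.
by move=> l lk; rewrite !mxE eq_sym (negbTE lk) mulr0.
Qed.

Variables (D : R) (A : set (VB R n.+1)).
Hypotheses (mA : measurable A) (dA : diam_le D A).

(** The section of A by the line through x in direction i; it does not depend on the i-th coordinate
    of x. *)
Definition slice (x : 'rV[R]_n.+1) : set (VB R 1) :=
  [set y | A (set_coord i ((y : 'rV[R]_1) ord0 ord0) x)].

(** Each section is replaced by a centred interval of the same length. Lines with null section are
    dropped, so that every point of the result lies on a line that meets A. *)
Definition steiner : set (VB R n.+1) :=
  [set x | (0 < leb R 1 (slice x))%E /\
           ((2 * `|(x : 'rV[R]_n.+1) ord0 i|)%:E <= leb R 1 (slice x))%E].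

Let slice_ysection (x : VB R n.+1) :
  slice x = ysection (orth_sum U W @^-1` A) ((x : 'rV[R]_n.+1) *m W^T).
Proof.
by apply/seteqP; split => y; have E := orth_sumE y x;
  rewrite /ysection/= inE /slice/= -E.
Qed.

Let mOA : measurable (orth_sum U W @^-1` A).
Proof. exact: preimage_measurable (@measurable_orth_sum _ _ _ _ _ _) mA. Qed.

Let measurable_slice x : measurable (slice x).
Proof. by rewrite slice_ysection; apply: measurable_ysection. Qed.

Let set_coordE (y : 'rV[R]_1) (x : 'rV[R]_n.+1) :
  set_coord i (y ord0 ord0) x = y *m U + (x *m W^T) *m W.
Proof. exact/esym/(orth_sumE y x). Qed.

Lemma diam_slices x x' (y y' : 'rV[R]_1) : slice x y -> slice x' y' ->
  enorm (y - y') ^+ 2 + enorm ((x - x') *m W^T) ^+ 2 <= D ^+ 2.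
Proof.
rewrite /slice /= => Ay Ay'; have := dA Ay Ay'.
rewrite !set_coordE => h; rewrite mulmxBl.
rewrite -(@enorm_orth_sum R 1 n n.+1 U W (y - y', x *m W^T - x' *m W^T))//.
rewrite (_ : orth_sum _ _ _ = y *m U + x *m W^T *m W - (y' *m U + x' *m W^T *m W)).
  by rewrite ler_pXn2r ?nnegrE ?enorm_ge0// (le_trans _ h)// enorm_ge0.
by rewrite /orth_sum /= !mulmxBl opprD addrACA.
Qed.

(** By Pythagoras, points of A on two parallel lines at distance h differ by at most sqrt(D^2 - h^2)
    along the lines; [leb1_pair] turns this into a bound on the lengths of the sections. *)
Lemma leb_slices x x' : slice x !=set0 -> slice x' !=set0 ->
  (leb R 1 (slice x) + leb R 1 (slice x') <=
   (2 * Num.sqrt (D ^+ 2 - enorm ((x - x') *m W^T) ^+ 2))%:E)%E.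
Proof.
move=> S0 S0'; apply: leb1_pair => // y y' Sy Sy'.
have := diam_slices Sy Sy'; rewrite -lerBrDr => h.
rewrite -(ler_pXn2r (n := 2)) ?nnegrE ?enorm_ge0 ?sqrtr_ge0// [leRHS]sqr_sqrtr//.
exact: le_trans (sqr_ge0 _) h.
Qed.

Lemma leb_slice_fin x : leb R 1 (slice x) \is a fin_num.
Proof.
rewrite ge0_fin_numE ?measure_ge0//.
have [->|/set0P S0] := eqVneq (slice x) set0; first by rewrite measure0.
apply: le_lt_trans (ltry _); apply: le_trans (leb_slices S0 S0).
by rewrite leeDl.
Qed.

Let fmeas : measurable_fun setT (fun x : VB R n.+1 => leb R 1 (slice x)).
Proof.
under eq_fun do rewrite slice_ysection.
have h := measurable_fun_ysection (leb R 1) mOA.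
apply: (measurableT_comp h); exact: measurable_fun_mulmx.
Qed.

Lemma measurable_steiner : measurable steiner.
Proof.
rewrite /steiner; apply: measurableI.
  rewrite -[X in measurable X]setTI; apply: emeasurable_fun_o_infty => //.
rewrite -[X in measurable X]setTI; apply: emeasurable_fun_le => //.
apply/measurable_EFinP; apply: measurable_funM => //; apply: measurableT_comp => //.
exact: measurable_coord.
Qed.

Lemma leb_steiner : leb R n.+1 steiner = leb R n.+1 A.
Proof.
rewrite (@leb_orth_sum_integral R 1 n n.+1 U W _ erefl hU hW UW measurable_steiner).
rewrite (@leb_orth_sum_integral R 1 n n.+1 U W _ erefl hU hW UW mA).
apply: eq_integral => z _.
pose x : VB R n.+1 := (z : 'rV[R]_n) *m W.
have xW : (x : 'rV[R]_n.+1) *m W^T = z by rewrite /x -mulmxA hW mulmx1.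
rewrite -[in RHS]xW -slice_ysection.
have [f fE] : exists r, leb R 1 (slice x) = r%:E.
  by exists (fine (leb R 1 (slice x))); rewrite fineK// leb_slice_fin.
have sx (y : 'rV[R]_1) : slice (orth_sum U W (y, z)) = slice x.
  rewrite !slice_ysection xW; congr (ysection _ _).
  by rewrite /orth_sum /= mulmxDl -!mulmxA UW hW mulmx0 mulmx1 add0r.
have f0 : 0 <= f by rewrite -lee_fin -fE measure_ge0.
have [f00|fn0] := eqVneq f 0.
  rewrite fE f00 (_ : ysection _ _ = set0) ?measure0//; apply/seteqP; split => // y.
  by rewrite /ysection/= inE /steiner /= sx fE f00 ltxx => -[].
have fp : 0 < f by rewrite lt_def fn0.
rewrite (_ : ysection _ _ = eball 1 (f / 2)).
  by rewrite leb_eball ?divr_gt0// fE vball1; congr EFin; lra.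
have yi (y : 'rV[R]_1) : (orth_sum U W (y, z) : 'rV[R]_n.+1) ord0 i = y ord0 ord0.
  by rewrite -xW orth_sumE mxE eqxx.
apply/seteqP; split => y; rewrite /ysection/= inE /steiner /eball /= sx fE yi enorm_rV1 !lee_fin lte_fin.
  by move=> [_ h]; lra.
by move=> h; split => //; lra.
Qed.

(** The i-th coordinates of two points of the symmetrized set are at most half the lengths of their
    sections. By [leb_slices] their difference is at most sqrt(D^2 - h^2) for lines at distance
    h. *)
Lemma steiner_diam : 0 <= D -> diam_le D steiner.
Proof.
move=> D0 x x' [px hx] [px' hx'].
have S0 : slice x !=set0.
  by apply/set0P/eqP => E; move: px; rewrite E measure0 ltxx.
have S0' : slice x' !=set0.
  by apply/set0P/eqP => E; move: px'; rewrite E measure0 ltxx.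
have := le_trans (leeD hx hx') (leb_slices S0 S0'); rewrite -EFinD lee_fin.
have [y Sy] := S0; have [y' Sy'] := S0'.
have Dz : enorm ((x - x') *m W^T) ^+ 2 <= D ^+ 2.
  by apply: le_trans (diam_slices Sy Sy'); rewrite lerDr sqr_ge0.
move=> h.
rewrite -(ler_pXn2r (n := 2)) ?nnegrE ?enorm_ge0//.
have -> : x - x' = orth_sum U W (const_mx ((x - x') ord0 i), (x - x') *m W^T).
  by rewrite orth_sumE; apply/rowP => j; rewrite !mxE; case: eqP => [->|].
rewrite enorm_orth_sum//= -lerBrDr -[leRHS]sqr_sqrtr ?subr_ge0// lerXn2r ?nnegrE ?enorm_ge0 ?sqrtr_ge0//.
rewrite enorm_rV1 !mxE (le_trans (ler_normB _ _))//; lra.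
Qed.

Lemma steiner_reflect x : steiner x -> steiner (reflect_coord i x).
Proof.
move=> [h1 h2]; have E : slice (reflect_coord i x) = slice x.
  apply/seteqP; split => y; rewrite /slice /=; congr A;
    by apply/rowP => j; rewrite !mxE; case: eqP.
by split; rewrite E// mxE eqxx normrN.
Qed.

(** Symmetries obtained in earlier directions survive, so that successive symmetrizations accumulate
    them. *)
Lemma steiner_reflect_other k : k != i -> (forall x, A x -> A (reflect_coord k x)) ->
  forall x, steiner x -> steiner (reflect_coord k x).
Proof.
move=> ki Ak x [h1 h2].
have rr (z : 'rV[R]_n.+1) : reflect_coord k (reflect_coord k z) = z.
  by apply/rowP => j; rewrite !mxE; case: eqP => // _; rewrite opprK.
have sr t (z : 'rV[R]_n.+1) : set_coord i t (reflect_coord k z) = reflect_coord k (set_coord i t z).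
  apply/rowP => j; rewrite !mxE; case: (eqVneq j i) => // ->.
  by rewrite eq_sym (negbTE ki).
have E : slice (reflect_coord k x) = slice x.
  apply/seteqP; split => y; rewrite /slice /= sr; last exact: Ak.
  by move=> /Ak; rewrite rr.
by split; rewrite E// mxE eq_sym (negbTE ki).
Qed.

End steiner.

(* Symmetrizing in all coordinates makes the set symmetric about the origin, and a
   symmetric set of diameter D lies in the ball of radius D / 2. *)
Lemma isodiametric n (D : R) (A : set (VB R n)) : 0 <= D -> measurable A -> diam_le D A ->
  (leb R n A <= ((D / 2) ^+ n * vball R n)%:E)%E.
Proof.
move=> D0 mA dA.
rewrite -leb_eball_ge0 ?divr_ge0//.
case: n A mA dA => [|n] A mA dA.
  apply: le_measure; rewrite ?inE//; first exact: measurable_eball.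
  by move=> x _; rewrite /eball /= [x : 'rV_0]thinmx0 enorm0 divr_ge0.
have [B [mB dB AB Bsym]] : exists B : set (VB R n.+1), [/\ measurable B, diam_le D B,
    leb R n.+1 B = leb R n.+1 A & forall (k : 'I_n.+1), (k < n.+1)%N ->
    forall x, B x -> B (reflect_coord k x)].
  suff H m : (m <= n.+1)%N -> exists B : set (VB R n.+1), [/\ measurable B, diam_le D B,
    leb R n.+1 B = leb R n.+1 A & forall (k : 'I_n.+1), (k < m)%N ->
    forall x, B x -> B (reflect_coord k x)] by exact: H.
  elim: m => [|m IH] mn; first by exists A.
  have [B [mB dB AB Bsym]] := IH (ltnW mn).
  exists (steiner (Ordinal mn) B); split.
  - exact: measurable_steiner mB.
  - exact: steiner_diam.
  - by rewrite -AB; exact: leb_steiner dB.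
  - move=> k; rewrite ltnS leq_eqVlt => /predU1P[km|km] x Bx.
      by rewrite (_ : k = Ordinal mn); [exact: steiner_reflect|exact: val_inj].
    apply: steiner_reflect_other => //; last exact: Bsym.
    by apply: contraTneq km => ->; rewrite ltnn.
rewrite -AB; apply: le_measure; rewrite ?inE//; first exact: measurable_eball.
move=> x Bx.
(* The point reflection is the composite of the coordinate reflections, applied one at a time. *)
have BN : B (- (x : 'rV[R]_n.+1)).
  have : forall m, (m <= n.+1)%N -> B (\row_j (if (j < m)%N then - (x : 'rV[R]_n.+1) ord0 j
     else (x : 'rV[R]_n.+1) ord0 j)).
    elim=> [|k IH] kn.
      by rewrite (_ : (\row_j _) = x)//; apply/rowP => j; rewrite mxE.
    have := Bsym (Ordinal kn) kn _ (IH (ltnW kn)); congr B; apply/rowP => j; rewrite !mxE.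
    rewrite -val_eqE /= ltnS [in RHS]leq_eqVlt.
    by case: eqP => // ->; rewrite ltnn.
  move=> /(_ n.+1 (leqnn _)); congr B; apply/rowP => j; rewrite !mxE ltn_ord//.
have := dB _ _ Bx BN; rewrite opprK -mulr2n -scaler_nat enormZ ger0_norm// /eball /= => h.
lra.
Qed.

End isodiametric.

(** * Hausdorff measure and Lebesgue measure *)

Section regularity.
Variable R : realType.

Lemma open_enorm_ball n (U : set 'rV[R]_n) x : open U -> U x ->
  exists2 e, 0 < e & forall y, enorm (x - y) < e -> U y.
Proof.
move=> oU Ux; have /nbhs_ballP[e /= e0 xeU] : nbhs x U by apply: open_nbhs_nbhs.
exists e => // y xy; apply: xeU; rewrite -ball_normE /=.
exact: le_lt_trans (mxnorm_le_enorm _) xy.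
Qed.

Lemma closed_enorm_ge n (y : 'rV[R]_n) r : closed [set x : 'rV[R]_n | r <= enorm (x - y)].
Proof.
rewrite (_ : [set x | _] = (fun x : 'rV[R]_n => enorm (x - y)) @^-1` [set t | r <= t])//.
apply: closed_comp; last exact: closed_ge.
move=> x _; apply/(@cvgrPdist_lt _ _ _ _ (nbhs_filter x)) => e e0.
apply: filterS (near_enorm x e0) => z; apply: le_lt_trans.
by rewrite (le_trans (enorm_dist_le _ _))// opprB addrA subrK.
Qed.

Lemma measure_bigcap_lt d (T : measurableType d) (mu : {measure set T -> \bar R})
    (F : (set T)^nat) (e : R) : (mu setT < +oo)%E -> 0 < e ->
  (forall i, measurable (F i)) -> (forall i, F i.+1 `<=` F i) -> \bigcap_i F i = set0 ->
  exists N, (mu (F N) <= e%:E)%E.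
Proof.
move=> muT e0 mF ndF F0; apply: contrapT => /forallNP h.
have : mu \o F @ \oo --> mu (\bigcap_n F n).
  apply: nonincreasing_cvg_mu => //.
  - by apply: le_lt_trans muT; apply: le_measure; rewrite ?inE.
  - by apply: bigcapT_measurable.
  - by apply/nonincreasing_seqP => i; apply/subsetPset.
rewrite F0 measure0 => c; have : (e%:E <= 0 :> \bar R)%E.
  have cc : cvgn (mu \o F) by apply/cvg_ex; exists 0%E.
  rewrite -(cvg_lim _ c)//; apply: (lime_ge cc).
  by apply: nearW => i /=; apply: ltW; rewrite ltNge; apply/negP.
by rewrite lee_fin leNgt e0.
Qed.

(** Approximation from inside and outside together is a condition stable under complements; it
    propagates from open sets to all Borel sets. *)
Definition approximable n (mu : set (VB R n) -> \bar R) (A : set (VB R n)) :=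
  measurable A /\ forall e : R, 0 < e -> exists F U : set (VB R n),
    [/\ closed (F : set 'rV[R]_n), open (U : set 'rV[R]_n), F `<=` A, A `<=` U &
        (mu (U `\` F) <= e%:E)%E].

(** The points at distance at least 1 / (k + 1) from the complement form closed sets that exhaust
    U. *)
Lemma approximable_open n (mu : {measure set (VB R n) -> \bar R}) (U : set 'rV[R]_n) :
  (mu setT < +oo)%E -> open U -> approximable mu U.
Proof.
move=> muT oU; split => [|e e0]; first exact: open_measurable_VB.
pose F (k : nat) : set 'rV[R]_n := [set x | forall y, ~ U y -> k.+1%:R^-1 <= enorm (x - y)].
have cF k : closed (F k).
  rewrite (_ : F k = \bigcap_(y in ~` U) [set x | k.+1%:R^-1 <= enorm (x - y)]); last first.
    by apply/seteqP; split => x.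
  by apply: closed_bigI => y _; exact: closed_enorm_ge.
have FU k : F k `<=` U.
  by move=> x Fx; apply: contrapT => /Fx; rewrite subrr enorm0 leNgt invr_gt0 ltr0n.
have [N hN] := @measure_bigcap_lt _ _ mu (fun k => (U : set (VB R n)) `\` F k) e muT e0
  (fun k => measurableD (open_measurable_VB oU) (closed_measurable_VB (cF k)))
  ltac:(move=> k x [Ux nFx]; split => // Fx; apply: nFx => y /Fx; apply: le_trans;
        by rewrite lef_pV2 ?posrE// ler_nat)
  ltac:(apply/seteqP; split => // x h; have [Ux _] := h 0%N I;
    have [r r0 xr] := open_enorm_ball oU Ux;
    have [_ []] := h (Num.truncn r^-1) I; move=> y nUy; rewrite leNgt; apply/negP => xy;
    apply: nUy; apply: xr; apply: lt_trans xy _; rewrite invf_plt ?posrE//; exact: truncnS_gt).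
by exists (F N), U; split.
Qed.

(** Complements exchange the two approximating sets. For a countable union, half of e is spread
    geometrically over the pieces, and the other half pays for cutting the union of the closed sets
    down to a finite one, which is closed. *)
Lemma approximable_sigma_algebra n (mu : {measure set (VB R n) -> \bar R}) :
  (mu setT < +oo)%E -> sigma_algebra setT (approximable mu).
Proof.
move=> muT; split.
- split => // e e0; exists set0, set0; split => //; try exact: closed0; try exact: open0.
  by rewrite setD0 measure0 lee_fin ltW.
- move=> A [mA hA]; split; first exact: measurableD.
  move=> e e0; have [F [U [cF oU FA AU h]]] := hA e e0.
  exists (~` U), (~` F); split.
  + exact: open_closedC.
  + exact: closed_openC.
  + by rewrite setTD; exact: subsetC.
  + by rewrite setTD; exact: subsetC.
  + by rewrite setDE setCK setIC -setDE.
- move=> A hA; split; first by apply: bigcupT_measurable => k; have [] := hA k.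
  move=> e e0.
  have e20 k : 0 < e / 2 / (2 ^ k.+1)%:R :> R by rewrite !divr_gt0// ltr0n expn_gt0.
  have /choice[F /choice[U FU]] k : exists F U : set (VB R n),
    [/\ closed (F : set 'rV[R]_n), open (U : set 'rV[R]_n), F `<=` A k, A k `<=` U &
        (mu (U `\` F) <= (e / 2 / (2 ^ k.+1)%:R)%:E)%E].
    by have [_ /(_ _ (e20 k))] := hA k.
  have cF k : closed (F k : set 'rV[R]_n) by have [] := FU k.
  have oU k : open (U k : set 'rV[R]_n) by have [] := FU k.
  have mF k : measurable (F k) := closed_measurable_VB (cF k).
  have mU k : measurable (U k) := open_measurable_VB (oU k).
  pose V := \bigcup_k U k; have oV : open (V : set 'rV[R]_n) by apply: bigcup_open.
  pose G N := \bigcup_(k in `I_N) F k.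
  have cG N : closed (G N : set 'rV[R]_n).
    by apply: closed_bigcup => //; exact: finite_II.
  have mV : measurable V := open_measurable_VB oV.
  have mG N : measurable (G N) := closed_measurable_VB (cG N).
  pose H := \bigcup_k F k; have mH : measurable H by apply: bigcupT_measurable.
  have [N hN] := @measure_bigcap_lt _ _ mu (fun N => H `\` G N) (e / 2) muT
    ltac:(by rewrite divr_gt0) (fun N => measurableD mH (mG N))
    ltac:(by move=> N x [Hx nG]; split => // -[k /= kN Fx]; apply: nG; exists k => //=; rewrite ltnS ltnW)
    ltac:(apply/seteqP; split => // x h; have [[k _ Fx] _] := h 0%N I;
          by have [_] := h k.+1 I; apply; exists k => /=).
  exists (G N), V; split => //.
  + by move=> x [k _ Fx]; exists k => //; have [_ _ FA _ _] := FU k; exact: FA.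
  + by move=> x [k _ Ax]; exists k => //; have [_ _ _ AU _] := FU k; exact: AU.
  + apply: (@le_trans _ _ (mu ((V `\` H) `|` (H `\` G N)))).
      apply: le_measure; rewrite ?inE//; first exact: measurableD.
        by apply: measurableU; exact: measurableD.
      by move=> x [Vx nG]; have [Hx|nH] := pselect (H x); [right|left].
    apply: (le_trans (measureU2 _ (measurableD mV mH) (measurableD mH (mG N)))).
    rewrite [e]splitr EFinD; apply: leeD => //.
    apply: (@le_trans _ _ (\sum_(0 <= k <oo) mu (U k `\` F k))%E).
      apply: measure_sigma_subadditive => //; [|exact: measurableD|].
        by move=> k; exact: measurableD.
      move=> x [[k _ Ux] nH]; exists k => //; split => // Fx; apply: nH; by exists k.
    apply: le_trans (epsilon_trick0 (eps := e / 2) xpredT _); last by rewrite divr_ge0// ltW.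
    by apply: lee_nneseries => // k _; have [] := FU k.
Qed.

Lemma borel_outer_regular n (mu : {measure set (VB R n) -> \bar R}) (A : set (VB R n)) (e : R) :
  (mu setT < +oo)%E -> measurable A -> 0 < e ->
  exists U : set 'rV[R]_n, [/\ open U, A `<=` U & (mu U <= mu A + e%:E)%E].
Proof.
move=> muT mA e0.
have [_ /(_ e e0) [F [U [cF oU FA AU h]]]] : approximable mu A.
  apply: smallest_sub mA; first exact: approximable_sigma_algebra.
  by move=> U; exact: approximable_open.
have mF := closed_measurable_VB cF; have mU := open_measurable_VB oU.
exists U; split => //.
apply: (@le_trans _ _ (mu (A `|` (U `\` F)))).
  apply: le_measure; rewrite ?inE//; first by apply: measurableU => //; exact: measurableD.
  by move=> x Ux; have [Fx|nF] := pselect (F x); [left; exact: FA|right].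
apply: (le_trans (measureU2 _ mA (measurableD mU mF))).
by rewrite leeD2l.
Qed.

End regularity.

(** * Dyadic cubes *)

Section dyadic.
Variable R : realType.

Definition dyadic_index n (k : nat) (x : 'rV[R]_n) : 'rV[int]_n :=
  \row_i Num.floor (2 ^+ k * x ord0 i).

Definition dyadic_cube n (k : nat) (z : 'rV[int]_n) : set (VB R n) :=
  [set x | dyadic_index k x = z].

Lemma dyadic_cubeP n k z (x : 'rV[R]_n) : dyadic_cube k z x <->
  forall i, (z ord0 i)%:~R <= 2 ^+ k * x ord0 i < (z ord0 i + 1)%:~R.
Proof.
split=> [<- i|h]; first by rewrite mxE; exact: real_floor_itv (num_real _).
by apply/rowP => i; rewrite mxE; apply: floor_def.
Qed.

Lemma measurable_dyadic_cube n k z : measurable (@dyadic_cube n k z).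
Proof.
rewrite (_ : dyadic_cube k z = \bigcap_(i : 'I_n)
  ((fun x : VB R n => 2 ^+ k * (x : 'rV[R]_n) ord0 i) @^-1`
    [set` `[(z ord0 i)%:~R, (z ord0 i + 1)%:~R[])).
  apply: fin_bigcap_measurable; first exact: finite_finset.
  move=> i _; apply: preimage_measurable => //; apply: measurable_funM => //.
  exact: measurable_coord.
apply/seteqP; split => x /=; first by move=> /dyadic_cubeP h i _ /=; rewrite in_itv/=.
by move=> h; apply/dyadic_cubeP => i; have := h i I; rewrite /= in_itv.
Qed.

(** [Num.floor s] is determined by [Num.floor (2 * s)]: an integer z is at most s exactly when 2 z
    is at most [Num.floor (2 * s)]. *)
Lemma dyadic_index_coarser n k l (x y : 'rV[R]_n) : (l <= k)%N ->
  dyadic_index k x = dyadic_index k y -> dyadic_index l x = dyadic_index l y.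
Proof.
move=> /subnK <-; elim: (k - l)%N => [//|m IH]; rewrite addSn => h; apply: IH.
move: h; move: (m + l)%N => {}k /rowP h; apply/rowP => i; have := h i; rewrite !mxE.
rewrite exprS -!mulrA; set s := _ * x _ _; set t := _ * y _ _ => e.
have [/andP[s1 s2] /andP[t1 t2]] :=
  (real_floor_itv (num_real s), real_floor_itv (num_real t)).
apply/eqP; rewrite eq_le; apply/andP; split.
  rewrite real_floor_ge_int ?num_real//.
  have : (Num.floor s * 2 <= Num.floor (2 * s))%R.
    by rewrite real_floor_ge_int ?num_real// intrM mulrC ler_pM2l.
  by rewrite e real_floor_ge_int ?num_real// intrM mulrC ler_pM2l.
rewrite real_floor_ge_int ?num_real//.
have : (Num.floor t * 2 <= Num.floor (2 * t))%R.
  by rewrite real_floor_ge_int ?num_real// intrM mulrC ler_pM2l.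
by rewrite -e real_floor_ge_int ?num_real// intrM mulrC ler_pM2l.
Qed.

Lemma dyadic_index_close n k (x y : 'rV[R]_n) : dyadic_index k x = dyadic_index k y ->
  enorm (x - y) <= n%:R / 2 ^+ k.
Proof.
move=> /rowP h; apply: le_trans (enorm_le_mxnorm _) _; rewrite ler_wpM2l//.
rewrite rV_normE; apply/bigmax_leP; split => [|[a i] _ /=]; first by rewrite invr_ge0 exprn_ge0.
have := h i; rewrite [a]ord1 !mxE => e.
have [/andP[s1 s2] /andP[t1 t2]] := (real_floor_itv (num_real (2 ^+ k * x ord0 i)),
  real_floor_itv (num_real (2 ^+ k * y ord0 i))).
rewrite e in s1 s2; rewrite intrD in s2 t2.
have k0 : 0 < 2 ^+ k :> R by rewrite exprn_gt0.
rewrite -[_^-1]mul1r ler_pdivlMr// -[X in _ * X]gtr0_norm// -normrM mulrBl !(mulrC _ (2 ^+ k)).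
by rewrite ler_norml; apply/andP; split; lra.
Qed.

Definition dyadic_center n (k : nat) (z : 'rV[int]_n) : 'rV[R]_n :=
  \row_i (((z ord0 i)%:~R + 2^-1) / 2 ^+ k).

Lemma dyadic_cube_ball n k (z : 'rV[int]_n) (x : 'rV[R]_n) :
  enorm (x - dyadic_center k z) <= 4^-1 / 2 ^+ k -> dyadic_cube k z x.
Proof.
move=> h; apply/dyadic_cubeP => i; have := le_trans (coord_le_enorm _ i) h.
have k0 : 0 < 2 ^+ k :> R by rewrite exprn_gt0.
rewrite !mxE ler_pdivlMr// -[X in _ * X]gtr0_norm// -normrM mulrBl divfK ?gt_eqF//.
by rewrite mulrC intrD ler_norml => /andP[? ?]; apply/andP; split; lra.
Qed.

End dyadic.

(** * Covers and the comparison of Lebesgue measure with Hausdorff measure from below *)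

Section hausdorff.
Variable R : realType.

(** The summand in [hausdorff_delta]. As [diam] is a supremum of reals, facts about it come with a
    bound [diam_le], which keeps the supremum away from its default value. *)
Definition weight n d (C : set 'rV[R]_d) : \bar R := (kappa R n * (diam C / 2) ^+ n)%:E.

Lemma diam_ub d (C : set 'rV[R]_d) D x y : diam_le D C -> C x -> C y -> enorm (x - y) <= diam C.
Proof.
move=> CD Cx Cy; apply: ub_le_sup; last by right; exists x, y.
exists (Num.max 0 D) => _ [->|[a [b [Ca [Cb ->]]]]]; first by rewrite le_max lexx.
by rewrite le_max CD ?orbT.
Qed.

Lemma diam_lub d (C : set 'rV[R]_d) D : 0 <= D -> diam_le D C -> diam C <= D.
Proof.
move=> D0 CD; apply: ge_sup; first by exists 0; left.
by move=> _ [->//|[a [b [Ca [Cb ->]]]]]; exact: CD.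
Qed.

Lemma diam_ge0 d (C : set 'rV[R]_d) D : diam_le D C -> 0 <= diam C.
Proof.
move=> CD; apply: ub_le_sup; last by left.
exists (Num.max 0 D) => _ [->|[a [b [Ca [Cb ->]]]]]; first by rewrite le_max lexx.
by rewrite le_max CD ?orbT.
Qed.

Lemma kappa_gt0 n : 0 < kappa R n.
Proof. by rewrite kappaE vball_gt0. Qed.

Lemma weight_ge0 n d (C : set 'rV[R]_d) D : diam_le D C -> (0 <= weight n C)%E.
Proof.
move=> CD; rewrite lee_fin mulr_ge0 ?exprn_ge0 ?divr_ge0 ?(diam_ge0 CD)//.
exact/ltW/kappa_gt0.
Qed.

Lemma weight_le n d (C : set 'rV[R]_d) D : 0 <= D -> diam_le D C ->
  (weight n C <= (kappa R n * (D / 2) ^+ n)%:E)%E.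
Proof.
move=> D0 CD; rewrite lee_fin ler_wpM2l//; first exact/ltW/kappa_gt0.
apply: lerXn2r; rewrite ?nnegrE ?divr_ge0 ?(diam_ge0 CD)//.
by rewrite ler_wpM2r ?invr_ge0// diam_lub.
Qed.

Lemma weight_set0 n d : (0 < n)%N -> weight n (set0 : set 'rV[R]_d) = 0%E.
Proof.
move=> n0; have d0 : diam_le 0 (set0 : set 'rV[R]_d) by [].
apply/eqP; rewrite eq_le (weight_ge0 _ d0) andbT.
by apply: le_trans (weight_le _ _ d0) _; rewrite // mul0r expr0n gtn_eqF// mulr0.
Qed.

Definition cover d (delta : R) (A : set 'rV[R]_d) (C : (set 'rV[R]_d)^nat) :=
  A `<=` \bigcup_i C i /\ forall i, diam_le delta (C i).

Lemma hausdorff_delta_le n d delta (A : set 'rV[R]_d) C : cover delta A C ->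
  (hausdorff_delta n delta A <= \sum_(0 <= i <oo) weight n (C i))%E.
Proof. by move=> [AC Cd]; apply: ereal_inf_lbound; exists C. Qed.

Lemma hausdorff_delta_ge n d delta (A : set 'rV[R]_d) (m : \bar R) :
  (forall C, cover delta A C -> (m <= \sum_(0 <= i <oo) weight n (C i))%E) ->
  (m <= hausdorff_delta n delta A)%E.
Proof. by move=> h; apply: le_ereal_inf_tmp => _ [C [AC Cd] <-]; exact: h. Qed.

Lemma hausdorff_delta_ge0 n d delta (A : set 'rV[R]_d) : (0 <= hausdorff_delta n delta A)%E.
Proof.
by apply: hausdorff_delta_ge => C [_ Cd]; apply: nneseries_ge0 => i _ _; exact: weight_ge0 (Cd i).
Qed.

Lemma hausdorff_delta_mono n d delta (A B : set 'rV[R]_d) : A `<=` B ->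
  (hausdorff_delta n delta A <= hausdorff_delta n delta B)%E.
Proof.
move=> AB; apply: hausdorff_delta_ge => C [BC Cd]; apply: hausdorff_delta_le.
by split => //; exact: subset_trans BC.
Qed.

Definition interleave (T : Type) (f g : nat -> T) (i : nat) : T :=
  if odd i then g i./2 else f i./2.

Lemma nneseries_interleave (f g : nat -> \bar R) :
  (forall i, 0 <= f i)%E -> (forall i, 0 <= g i)%E ->
  (\sum_(0 <= i <oo) interleave f g i <= \sum_(0 <= i <oo) f i + \sum_(0 <= i <oo) g i)%E.
Proof.
move=> f0 g0; have h0 i : (0 <= interleave f g i)%E by rewrite /interleave; case: ifP.
apply: lime_le; first by apply: is_cvg_nneseries => i _ _.
apply: nearW => N; apply: (@le_trans _ _ (\sum_(0 <= i < N.*2) interleave f g i)%E).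
  by apply: lee_sum_nneg_natr => //; rewrite -addnn leq_addr.
have -> : (\sum_(0 <= i < N.*2) interleave f g i =
   \sum_(0 <= i < N) f i + \sum_(0 <= i < N) g i)%E.
  elim: N => [|N IH]; first by rewrite !big_geq ?adde0.
  rewrite doubleS !big_nat_recr//= IH /interleave /= odd_double /= uphalf_double doubleK.
  by rewrite -!addeA; congr (_ + _)%E; rewrite addeCA.
by apply: leeD; apply: nneseries_lim_ge => i _ _.
Qed.

(** The given cover of X is interleaved with an arbitrary cover of Y. If the sum over C is infinite
    the bound is trivial; otherwise the sum can be moved to the other side. *)
Lemma hausdorff_deltaU n d delta (X Y : set 'rV[R]_d) C : cover delta X C ->
  (hausdorff_delta n delta (X `|` Y) <=
   \sum_(0 <= i <oo) weight n (C i) + hausdorff_delta n delta Y)%E.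
Proof.
move=> [XC Cd]; have s0 : (0 <= \sum_(0 <= i <oo) weight n (C i))%E.
  by apply: nneseries_ge0 => i _ _; exact: weight_ge0 (Cd i).
have [->|sfin] := eqVneq (\sum_(0 <= i <oo) weight n (C i))%E +oo%E.
  by rewrite addye ?leey// gt_eqF// (lt_le_trans _ (hausdorff_delta_ge0 _ _ _))// ltNyr.
rewrite -leeBlDl; last by rewrite ge0_fin_numE// lt_neqAle sfin leey.
apply: hausdorff_delta_ge => E [YE Ed]; rewrite leeBlDl; last first.
  by rewrite ge0_fin_numE// lt_neqAle sfin leey.
apply: le_trans (nneseries_interleave _ _); [|move=> i; exact: weight_ge0 (Cd i)|
  move=> i; exact: weight_ge0 (Ed i)].
rewrite (_ : (\sum_(0 <= i <oo) _)%E = \sum_(0 <= i <oo) weight n (interleave C E i))%E; last first.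
  by apply: eq_eseriesr => i _; rewrite /interleave; case: ifP.
apply: hausdorff_delta_le; split; last by move=> i; rewrite /interleave; case: ifP.
move=> x [/XC [i _ Cx]|/YE [i _ Ex]].
  by exists i.*2 => //; rewrite /interleave odd_double doubleK.
by exists i.*2.+1 => //; rewrite /interleave /= odd_double /= uphalf_double.
Qed.

Lemma diam_le_closure d D (C : set 'rV[R]_d) : diam_le D C -> diam_le D (closure C).
Proof.
move=> CD x y clx cly; apply/ler_addgt0Pr => e e0.
have e20 : 0 < e / 2 by rewrite divr_gt0.
have [x' [Cx' xx']] := clx _ (near_enorm x e20).
have [y' [Cy' yy']] := cly _ (near_enorm y e20).
have := CD _ _ Cx' Cy'; have := enormB_triangle x x' y; have := enormB_triangle x' y' y.
by rewrite /= (enormBC y') in xx' yy' *; lra.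
Qed.

(** Closures of covering sets are measurable and obey the same diameter bounds, so the isodiametric
    inequality bounds the volume of each by the weight of the set. The scale 1 is an arbitrary
    choice of delta. *)
Lemma leb_le_hausdorff n (A : set (VB R n)) : measurable A ->
  (leb R n A <= hausdorff n (A : set 'rV[R]_n))%E.
Proof.
move=> mA; apply: (@le_trans _ _ (hausdorff_delta n 1 (A : set 'rV[R]_n))); last first.
  by apply: ereal_sup_ubound; exists 1 => //=.
apply: hausdorff_delta_ge => C [AC Cd].
have mC i : measurable (closure (C i) : set (VB R n)).
  by apply: closed_measurable_VB; exact: closed_closure.
apply: (@le_trans _ _ (\sum_(0 <= i <oo) leb R n (closure (C i)))%E).
  apply: measure_sigma_subadditive => // x /AC [i _ Cx]; exists i => //.
  exact: subset_closure.
apply: lee_nneseries => // i _; rewrite /weight kappaE mulrC.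
apply: isodiametric => //; first exact: diam_ge0 (Cd i).
by apply: diam_le_closure => x y; exact: diam_ub (Cd i).
Qed.

End hausdorff.

(** * Decomposition of open sets into dyadic cubes *)

Section dyadic_decomposition.
Variable R : realType.

(** The radius is a quarter of the side of the cube, which keeps the closed ball inside the
    half-open cube. *)
Definition shrunk_ball n (k : nat) (z : 'rV[int]_n) : set (VB R n) :=
  [set x | eball n (4^-1 / 2 ^+ k) ((x : 'rV[R]_n) - dyadic_center R k z)].

Lemma measurable_shrunk_ball n k z : measurable (@shrunk_ball n k z).
Proof.
apply: (preimage_measurable (f := fun x : VB R n => (x : 'rV[R]_n) - dyadic_center R k z : VB R n)
  _ (@measurable_eball R n (4^-1 / 2 ^+ k))).
exact: measurable_funD_VB.
Qed.

Lemma leb_shrunk_ball n k z :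
  leb R n (@shrunk_ball n k z) = ((4^-1 / 2 ^+ k) ^+ n * vball R n)%:E.
Proof.
rewrite -leb_eball ?divr_gt0 ?exprn_gt0// -[RHS](lebD (- dyadic_center R k z))//.
exact: measurable_eball.
Qed.

Lemma exists_small_dyadic n (e : R) : 0 < e -> exists k, forall l, (k <= l)%N -> n%:R / 2 ^+ l < e.
Proof.
move=> e0; exists (Num.truncn (n%:R / e)).+1 => l kl.
rewrite ltr_pdivrMr ?exprn_gt0// mulrC -ltr_pdivrMr//.
apply: lt_trans (truncnS_gt _) _; rewrite -natrX ltr_nat.
by apply: leq_ltn_trans kl _; exact: ltn_expl.
Qed.

(** The sets Q are the maximal dyadic cubes of level at least k0 inside U. A cube of side s has
    diameter at most n s, so weight at most kappa_n (n s / 2)^n, while the ball in it has volume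
    kappa_n (s / 4)^n; the ratio is (2 n)^n. *)
Lemma dyadic_decomposition n (U : set 'rV[R]_n) eta : (0 < n)%N -> open U -> 0 < eta ->
  exists Q B : nat -> set (VB R n), [/\ forall i, measurable (Q i) /\ measurable (B i),
    trivIset setT Q, (U : set (VB R n)) = \bigcup_i Q i, forall i, B i `<=` Q i &
    forall i, [/\ diam_le eta (Q i), (weight n (Q i : set 'rV[R]_n) <= ((2 * n%:R) ^+ n)%:E * leb R n (B i))%E &
      (weight n (B i : set 'rV[R]_n) <= leb R n (B i))%E]].
Proof.
move=> n0 oU eta0; have [k0 hk0] := exists_small_dyadic n eta0.
pose good k (x : 'rV[R]_n) := dyadic_cube k (dyadic_index k x) `<=` U.
pose sel (p : nat * 'rV[int]_n) := [/\ (k0 <= p.1)%N, dyadic_cube p.1 p.2 `<=` U &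
  forall x l, dyadic_cube p.1 p.2 x -> (k0 <= l < p.1)%N -> ~ good l x].
pose F (G : nat -> 'rV[int]_n -> set (VB R n)) (i : nat) : set (VB R n) :=
  if @pickle_inv (nat * 'rV[int]_n)%type i is Some p then if `[< sel p >] then G p.1 p.2 else set0 else set0.
have FP G (P : set (VB R n) -> Prop) i : P set0 -> (forall p, sel p -> P (G p.1 p.2)) -> P (F G i).
  by move=> P0 h; rewrite /F; case: pickle_inv => // p; case: asboolP => // /h.
exists (F (@dyadic_cube R n)), (F (@shrunk_ball n)); split.
- move=> i; split; apply: FP => // p _.
    exact: measurable_dyadic_cube.
  exact: measurable_shrunk_ball.
- apply/trivIsetP => i j _ _; rewrite /F.
  case ei : (pickle_inv i) => [p|]; last by rewrite set0I.
  case ej : (pickle_inv j) => [q|]; last by rewrite setI0.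
  case: asboolP => sp; last by rewrite set0I.
  case: asboolP => sq; last by rewrite setI0.
  move=> ij; apply/seteqP; split => // x [/= xp xq].
  move: sp sq => [kp pU hp] [kq qU hq].
  have [pq|qp|pq] := ltngtP p.1 q.1.
  + apply: (hq x p.1 xq); first by rewrite kp.
    by rewrite /good xp.
  + apply: (hp x q.1 xp); first by rewrite kq.
    by rewrite /good xq.
  + move/eqP: ij; apply; have epq : p = q.
      by case: p q pq xp xq {ei ej kp pU hp kq qU hq} => [k z] [l w] /= -> <- <-.
    have := @pickle_invK (nat * 'rV[int]_n)%type i; have := @pickle_invK (nat * 'rV[int]_n)%type j.
    by rewrite ei ej /= epq => <- <-.
- apply/seteqP; split => x; last first.
    by move=> [i _]; apply: (@FP _ (fun A => A x -> U x)) => // p [_ h _]; exact: h.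
  move=> Ux; have [e e0 xe] := open_enorm_ball oU Ux.
  have [k1 hk1] := exists_small_dyadic n e0.
  have ex : exists k, (k0 <= k)%N && `[< good k x >].
    exists (maxn k0 k1); rewrite leq_maxl; apply/asboolP => y xy; apply: xe.
    by apply: le_lt_trans (hk1 _ (leq_maxr k0 k1)); apply: dyadic_index_close.
  (* The coarsest admissible level at x gives the selected cube that contains x. *)
  case: (ex_minnP ex) => k /andP[k0k /asboolP gk] kmin.
  have sk : sel (k, dyadic_index k x).
    split => // y l /= yk /andP[k0l lk] gl.
    have : (k <= l)%N.
      apply: kmin; rewrite k0l; apply/asboolP; rewrite /good.
      by rewrite -(dyadic_index_coarser (ltnW lk) yk).
    by rewrite leqNgt lk.
  exists (pickle (k, dyadic_index k x)) => //.
  by rewrite /F pickleK_inv; case: asboolP.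
- move=> i x; rewrite /F; case: pickle_inv => // p; case: asboolP => // _.
  exact: dyadic_cube_ball.
- move=> i; rewrite /F; case: pickle_inv => [p|]; last first.
    by rewrite !weight_set0// measure0 mule0; split.
  case: asboolP => [[kp _ _]|_]; last by rewrite !weight_set0// measure0 mule0; split.
  have dQ : diam_le (n%:R / 2 ^+ p.1) (@dyadic_cube R n p.1 p.2).
    by move=> x y xp yp; apply: dyadic_index_close; rewrite xp yp.
  have dB : diam_le (2 * (4^-1 / 2 ^+ p.1)) (@shrunk_ball n p.1 p.2).
    move=> x y; rewrite /shrunk_ball /eball /= => xp yp.
    apply: (le_trans (enormB_triangle _ (dyadic_center R p.1 p.2) _)).
    by rewrite (enormBC _ y) mulr2n mulrDl mul1r lerD.
  have p0 : 0 < 2 ^+ p.1 :> R by rewrite exprn_gt0.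
  split.
  + by move=> x y xp yp; apply: le_trans (dQ _ _ xp yp) (ltW (hk0 _ kp)).
  + apply: le_trans (weight_le _ _ dQ) _; first by rewrite divr_ge0// ltW.
    rewrite leb_shrunk_ball -EFinM lee_fin kappaE mulrC mulrA -exprMn.
    rewrite (_ : 2 * n%:R * (4^-1 / 2 ^+ p.1) = n%:R / 2 ^+ p.1 / 2)//.
    by field; rewrite gt_eqF.
  + apply: le_trans (weight_le _ _ dB) _; first by rewrite mulr_ge0// divr_ge0// ltW.
    rewrite leb_shrunk_ball lee_fin kappaE mulrC.
    by rewrite (_ : 2 * (4^-1 / 2 ^+ p.1) / 2 = 4^-1 / 2 ^+ p.1)//; field; rewrite gt_eqF.
Qed.

End dyadic_decomposition.

(** * Equality of Hausdorff and Lebesgue measure on bounded Borel sets *)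

Section hausdorff_lebesgue.
Variable R : realType.

Lemma measure_bigcupT d (T : measurableType d) (mu : {measure set T -> \bar R}) (B : (set T)^nat) :
  (forall i, measurable (B i)) -> trivIset setT B ->
  mu (\bigcup_i B i) = (\sum_(0 <= i <oo) mu (B i))%E.
Proof. by move=> mB tB; rewrite measure_bigcup//; apply: eq_eseriesl => i; rewrite in_setT. Qed.

Lemma subset_trivIset T (Q B : (set T)^nat) :
  (forall i, B i `<=` Q i) -> trivIset setT Q -> trivIset setT B.
Proof. by move=> BQ tQ i j _ _ [x [Bi Bj]]; apply: tQ => //; exists x; split; exact: BQ. Qed.

Definition oball n (r : R) : set 'rV[R]_n := [set x | enorm x < r].

Lemma open_oball n r : open (@oball n r).
Proof.
rewrite (_ : @oball n r = ~` [set x | r <= enorm (x - 0)]).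
  by apply: closed_openC; exact: closed_enorm_ge.
by apply/seteqP; split => x /=; rewrite /oball /= subr0 ltNge => /negP.
Qed.

Lemma leb_oball_lty n r : (leb R n (@oball n r) < +oo)%E.
Proof.
apply: le_lt_trans (leb_eball_lty n r); apply: le_measure; rewrite ?inE.
- by apply: open_measurable_VB; exact: open_oball.
- exact: measurable_eball.
- by move=> x /ltW.
Qed.

Section upper_bound.
Variables (n : nat) (r delta : R).
Hypotheses (n0 : (0 < n)%N) (d0 : 0 < delta).

Let hd (A : set (VB R n)) := hausdorff_delta n delta (A : set 'rV[R]_n).
Let O : set (VB R n) := @oball n r.
Let mO : measurable O.
Proof. by apply: open_measurable_VB; exact: open_oball. Qed.

Definition hausdorff_ratio_le (c : R) := forall A : set (VB R n), measurable A -> A `<=` O ->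
  (hd A <= c%:E * leb R n A)%E.

Let leb_fin (A : set (VB R n)) : measurable A -> A `<=` O -> exists2 a, 0 <= a & leb R n A = a%:E.
Proof.
move=> mA AO; have Afin : leb R n A \is a fin_num.
  rewrite ge0_fin_numE ?measure_ge0//; apply: le_lt_trans (leb_oball_lty n r).
  by apply: le_measure; rewrite ?inE.
exists (fine (leb R n A)); last by rewrite fineK.
by rewrite fine_ge0// measure_ge0.
Qed.

(** Outer regularity, applied to the restriction of Lebesgue measure to the ball [O], which is
    finite. The slack e / (1 + c) stays below e after multiplication by c. *)
Lemma hausdorff_ratio_open c : 0 <= c ->
  (forall U : set 'rV[R]_n, open U -> U `<=` O -> (hd U <= c%:E * leb R n U)%E) ->
  hausdorff_ratio_le c.
Proof.
move=> c0 hU A mA AO; have [a a0 aE] := leb_fin mA AO; rewrite aE.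
apply/lee_addgt0Pr => e e0.
have muT : (mrestr (leb R n) mO setT < +oo)%E by rewrite /mrestr setTI leb_oball_lty.
have [U [oU AU mUA]] := borel_outer_regular muT mA (divr_gt0 e0 (ltr_pwDl ltr01 c0)).
have oUO : open (U `&` O : set 'rV[R]_n) by apply: openI => //; exact: open_oball.
have UO : U `&` O `<=` O by move=> x [].
apply: (@le_trans _ _ (hd (U `&` O))).
  by apply: hausdorff_delta_mono => x Ax; split; [exact: AU|exact: AO].
apply: (le_trans (hU _ oUO UO)).
have -> : leb R n (U `&` O) = mrestr (leb R n) mO U by [].
apply: (@le_trans _ _ (c%:E * (a + e / (1 + c))%:E)%E).
  apply: lee_wpmul2l; first by rewrite lee_fin.
  by rewrite EFinD -aE (_ : leb R n A = mrestr (leb R n) mO A)// /mrestr setIidl.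
rewrite -EFinM -EFinM -EFinD lee_fin mulrDr lerD2l mulrCA ger_pMr// ler_pdivrMr ?mul1r ?ltr_pwDl//.
by rewrite lerDr.
Qed.

Let C0 : R := (2 * n%:R) ^+ n.

Let C0_ge1 : 1 <= C0.
Proof. by rewrite exprn_ege1// -natrM ler1n muln_gt0. Qed.

Lemma hausdorff_ratio_base : hausdorff_ratio_le C0.
Proof.
apply: hausdorff_ratio_open => [|U oU UO]; first exact: le_trans C0_ge1.
have [Q [B [mQB tQ UQ BQ QB]]] := dyadic_decomposition n0 oU d0.
have BU : \bigcup_i B i `<=` U by move=> x [i _ Bx]; rewrite UQ; exists i => //; exact: BQ.
have mB : measurable (\bigcup_i B i) by apply: bigcupT_measurable => i; have [] := mQB i.
apply: (@le_trans _ _ (\sum_(0 <= i <oo) weight n (Q i : set 'rV[R]_n))%E).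
  by apply: hausdorff_delta_le; split; [rewrite UQ|move=> i; have [] := QB i].
apply: (@le_trans _ _ (\sum_(0 <= i <oo) (C0%:E * leb R n (B i)))%E).
  apply: lee_nneseries => i _; last by have [_ h _] := QB i.
  by move=> _; have [h _ _] := QB i; exact: weight_ge0 h.
rewrite nneseriesZl//.
apply: lee_wpmul2l; first by rewrite lee_fin (le_trans _ C0_ge1).
rewrite -measure_bigcupT//; first by apply: le_measure; rewrite ?inE//; exact: open_measurable_VB.
- by move=> i; have [] := mQB i.
- exact: subset_trivIset BQ tQ.
Qed.

(* Filling a fixed proportion of an open set by small disjoint balls, whose weight
   is their volume, improves the ratio on that proportion. *)
Lemma hausdorff_ratio_step c : 1 <= c -> hausdorff_ratio_le c ->
  hausdorff_ratio_le (1 + (c - 1) * (1 - C0^-1)).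
Proof.
move=> c1 Pc; have C0p : 0 < C0 := lt_le_trans ltr01 C0_ge1.
apply: hausdorff_ratio_open => [|U oU UO].
  by rewrite addr_ge0// mulr_ge0 ?subr_ge0// invf_le1.
have mU : measurable (U : set (VB R n)) := open_measurable_VB oU.
have [Q [B [mQB tQ UQ BQ QB]]] := dyadic_decomposition n0 oU d0.
have BU : \bigcup_i B i `<=` U by move=> x [i _ Bx]; rewrite UQ; exists i => //; exact: BQ.
have mB : measurable (\bigcup_i B i) by apply: bigcupT_measurable => i; have [] := mQB i.
have tB := subset_trivIset BQ tQ.
have [u u0 uE] := leb_fin mU UO.
have [s s0 sE] := leb_fin mB (subset_trans BU UO).
have sumB : (\sum_(0 <= i <oo) leb R n (B i) = s%:E)%E.
  by rewrite -sE -measure_bigcupT// => i; have [] := mQB i.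
(* The balls fill at least the proportion 1 / C0 of U: by the isodiametric inequality each cube has
   volume at most its weight, hence at most C0 times the volume of its ball. *)
have us : u <= C0 * s.
  rewrite -lee_fin -uE EFinM -sumB -nneseriesZl//.
  apply: (@le_trans _ _ (\sum_(0 <= i <oo) leb R n (Q i))%E).
    by apply: measure_sigma_subadditive; rewrite -?UQ// => i; have [] := mQB i.
  apply: lee_nneseries => // i _; have [dQ h _] := QB i; apply: le_trans h.
  rewrite /weight kappaE mulrC; apply: isodiametric; first exact: diam_ge0 dQ.
    by have [] := mQB i.
  by move=> x y; exact: diam_ub dQ.
rewrite -(setDUK BU).
apply: (@le_trans _ _ (s%:E + c%:E * leb R n ((U : set (VB R n)) `\` \bigcup_i B i))%E).
  apply: (@le_trans _ _ (\sum_(0 <= i <oo) weight n (B i : set 'rV[R]_n) +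
      hd ((U : set (VB R n)) `\` \bigcup_i B i))%E).
    apply: hausdorff_deltaU; split => // i; have [dQ _ _] := QB i.
    by move=> x y /BQ Qx /BQ Qy; exact: dQ.
  apply: leeD.
    rewrite -sumB; apply: lee_nneseries => i _; last by have [] := QB i.
    by move=> _; have [h _ _] := QB i; apply: (@weight_ge0 _ _ _ _ delta) => x y /BQ Qx /BQ Qy; exact: h.
  by apply: Pc; [exact: measurableD|move=> x [/UO]].
have UB : leb R n ((U : set (VB R n)) `\` \bigcup_i B i) = (u - s)%:E.
  rewrite measureD//; last by rewrite [X in (X < _)%E]uE ltry.
  rewrite EFinB; congr (_ - _)%E; first exact: uE.
  rewrite -[RHS]sE; congr (leb R n _).
  by apply/seteqP; split => [x []//|x Bx]; split => //; exact: BU.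
rewrite setDUK// UB uE -!EFinM -EFinD lee_fin.
(* The bound reached is s + c (u - s) = c u - (c - 1) s, and s is at least u / C0. *)
have h : (c - 1) * (u / C0) <= (c - 1) * s.
  by rewrite ler_wpM2l ?subr_ge0// ler_pdivrMr// mulrC.
set q := C0^-1 in h *; nra.
Qed.

(** Iterating the improvement from the ratio C0 gives the ratios 1 + (C0 - 1) q^k with q < 1, which
    tend to 1. *)
Lemma hausdorff_delta_le_leb (A : set (VB R n)) : measurable A -> A `<=` O ->
  (hd A <= leb R n A)%E.
Proof.
move=> mA AO; have [a a0 aE] := leb_fin mA AO.
have C0p : 0 < C0 := lt_le_trans ltr01 C0_ge1.
pose q := 1 - C0^-1.
have q0 : 0 <= q by rewrite subr_ge0 invf_le1.
have q1 : q < 1 by rewrite ltrBlDr ltrDl invr_gt0.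
have Pk k : hausdorff_ratio_le (1 + (C0 - 1) * q ^+ k).
  elim: k => [|k IH]; first by rewrite expr0 mulr1 addrC subrK; exact: hausdorff_ratio_base.
  have := hausdorff_ratio_step _ IH; rewrite addrAC subrr add0r exprSr mulrA; apply.
  by rewrite lerDl mulr_ge0 ?subr_ge0// exprn_ge0.
apply/lee_addgt0Pr => e e0; rewrite aE -EFinD.
have : (fun k => ((C0 - 1) * a) * q ^+ k) @ \oo --> ((C0 - 1) * a) * 0.
  by apply: cvgM; [exact: cvg_cst|apply: cvg_expr; rewrite ger0_norm].
rewrite mulr0 => /cvgrPdist_lt /(_ _ e0) [k _ /(_ k (leqnn k))] /=.
rewrite sub0r normrN => h; apply: le_trans (Pk k A mA AO) _.
rewrite aE -EFinM lee_fin mulrDl mul1r lerD2l mulrAC.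
by apply: le_trans (ltW h); exact: ler_norm.
Qed.

End upper_bound.

Lemma hausdorff_leb n r (A : set (VB R n)) : (0 < n)%N -> measurable A -> A `<=` @oball n r ->
  hausdorff n (A : set 'rV[R]_n) = leb R n A.
Proof.
move=> n0 mA AO; apply/eqP; rewrite eq_le leb_le_hausdorff// andbT.
by apply: ge_ereal_sup => _ [delta /= d0 <-]; exact: hausdorff_delta_le_leb AO.
Qed.

(** Covers of A are pushed forward with equal diameters. Covers of the image are pulled back, where
    diameters can only decrease. *)
Lemma hausdorff_isometric k n d (U : 'M[R]_(n, d)) (A : set 'rV[R]_n) : isometric U ->
  hausdorff k [set x *m U | x in A] = hausdorff k A.
Proof.
move=> hU; rewrite /hausdorff; congr ereal_sup; apply: eq_imagel => delta /= d0.
apply/eqP; rewrite eq_le; apply/andP; split; apply: hausdorff_delta_ge => C [AC Cd].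
  rewrite (_ : (\sum_(0 <= i <oo) _)%E = \sum_(0 <= i <oo) weight k [set x *m U | x in C i])%E.
    apply: hausdorff_delta_le; split.
      by move=> _ [x /AC [i _ Cx] <-]; exists i => //; exists x.
    by move=> i _ _ [x Cx <-] [y Cy <-]; rewrite -mulmxBl enorm_isometric//; exact: Cd Cx Cy.
  apply: eq_eseriesr => i _; rewrite /weight /diam; do 6 f_equal.
  apply/seteqP; split => _ [x [y [Cx [Cy ->]]]].
    exists (x *m U), (y *m U); split; first by exists x.
    by split; [exists y|rewrite -mulmxBl enorm_isometric].
  move: Cx Cy => [x' Cx' <-] [y' Cy' <-]; exists x', y'; split => //; split => //.
  by rewrite -mulmxBl enorm_isometric.
have dC i : diam_le (diam (C i)) ((fun x => x *m U) @^-1` C i).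
  by move=> x y Cx Cy; rewrite -(enorm_isometric _ hU) mulmxBl; exact: (diam_ub (Cd i) Cx Cy).
apply: (@le_trans _ _ (\sum_(0 <= i <oo) weight k ((fun x => x *m U) @^-1` C i))%E).
  apply: hausdorff_delta_le; split; first by move=> x Ax; apply: AC; exists x.
  by move=> i x y Cx Cy; rewrite -(enorm_isometric _ hU) mulmxBl; exact: (Cd i _ _ Cx Cy).
apply: lee_nneseries => i _; first by move=> _; exact: weight_ge0 (dC i).
by apply: weight_le (dC i); exact: diam_ge0 (Cd i).
Qed.

End hausdorff_lebesgue.

(** * Nearest points of a convex body *)

Section nearest_point.
Variable R : realType.

Lemma nonexpansive_continuous n m (f : 'rV[R]_n -> 'rV[R]_m) :
  (forall x y, enorm (f x - f y) <= enorm (x - y)) -> continuous f.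
Proof.
move=> fl x; apply/(@cvgrPdist_lt _ _ _ _ (nbhs_filter x)) => e e0.
apply: filterS (near_enorm x e0) => y; apply: le_lt_trans.
exact: le_trans (mxnorm_le_enorm _) (fl _ _).
Qed.

(** |x U^T|^2 is the product of x with x U^T U, a vector of norm |x U^T|; Cauchy-Schwarz
    concludes. *)
Lemma enorm_trmx_isometric n d (U : 'M[R]_(n, d)) x : isometric U -> enorm (x *m U^T) <= enorm x.
Proof.
move=> hU; have [->|h0] := eqVneq (enorm (x *m U^T)) 0; first exact: enorm_ge0.
rewrite -(ler_pM2l (x := enorm (x *m U^T))); last by rewrite lt_def h0 enorm_ge0.
rewrite -expr2 enorm_sqr -dot_mulmx_trmx -(enorm_isometric (x *m U^T) hU).
exact: dot_le_enorm.
Qed.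

Lemma convex_body_trmx n d (U : 'M[R]_(n, d)) (K : set 'rV[R]_d) : isometric U ->
  convex_body K -> convex_body [set x *m U^T | x in K].
Proof.
move=> hU [[x Kx] [cK vK]]; split; first by exists (x *m U^T), x.
split.
  apply: continuous_compact => //; apply: continuous_subspaceT.
  by apply: nonexpansive_continuous => y z; rewrite -mulmxBl enorm_trmx_isometric.
move=> _ _ t [y Ky <-] [z Kz <-] t01; exists (t *: y + (1 - t) *: z); first exact: vK.
by rewrite mulmxDl -!scalemxAl.
Qed.

Lemma dot_subZ n (a b : 'rV[R]_n) t :
  dot (a - t *: b) (a - t *: b) = dot a a - 2 * t * dot a b + t ^+ 2 * dot b b.
Proof. by rewrite dotBl !dotBr !dotZl !dotZr (dotC b a); ring. Qed.

Section convex_body.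
Variables (n : nat) (K : set 'rV[R]_n).
Hypothesis hK : convex_body K.

Lemma dist_le x y : K y -> dist K x <= enorm (x - y).
Proof.
move=> Ky; apply: ge_inf; last by exists y.
by exists 0 => _ [z _ <-]; exact: enorm_ge0.
Qed.

Lemma dist_ge0 x : 0 <= dist K x.
Proof.
have [[y Ky] _] := hK; apply: lb_le_inf; first by exists (enorm (x - y)), y.
by move=> _ [z _ <-]; exact: enorm_ge0.
Qed.

Lemma exists_nearest x : exists p, K p /\ enorm (x - p) = dist K x.
Proof.
have [K0 [cK _]] := hK.
have cf : {within K, continuous (fun y => enorm (x - y))}.
  apply: continuous_subspaceT => y; apply/(@cvgrPdist_lt _ _ _ _ (nbhs_filter y)) => e e0.
  apply: filterS (near_enorm y e0) => z; apply: le_lt_trans.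
  apply: le_trans (enorm_dist_le _ _) _; rewrite opprB addrC addrA subrK enormBC.
  by rewrite addrC.
have [p Kp pmin] := EVT_min_rV K0 cK cf; exists p; split; first exact: set_mem.
apply/eqP; rewrite eq_le dist_le ?andbT; last exact: set_mem.
have [y Ky] := K0; apply: lb_le_inf; first by exists (enorm (x - y)), y.
by move=> _ [z Kz <-]; apply: pmin; exact: mem_set.
Qed.

Definition nearest x : 'rV[R]_n := projT1 (cid (exists_nearest x)).

Lemma nearest_in x : K (nearest x).
Proof. by rewrite /nearest; case: cid => p []. Qed.

Lemma enorm_nearest x : enorm (x - nearest x) = dist K x.
Proof. by rewrite /nearest; case: cid => p []. Qed.

(** The variational inequality for nearest points: if the angle at p were acute, moving from p
    towards q inside K would come closer to x. *)
Lemma dot_nearest_le0 x p q : K p -> enorm (x - p) = dist K x -> K q -> dot (x - p) (q - p) <= 0.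
Proof.
move=> Kp px Kq; have [_ [_ vK]] := hK; rewrite leNgt; apply/negP => h.
set a := x - p in h px; set b := q - p in h.
have b0 : 0 < dot b b.
  rewrite -enorm_sqr exprn_gt0// enorm_gt0; apply: contraTneq h => ->.
  by rewrite dot0r ltxx.
(* The minimizer of |a - t b| over real t, cut off at 1 to stay on the segment; the squared distance
   then drops by at least t times [dot a b]. *)
pose t := Num.min 1 (dot a b / dot b b).
have t0 : 0 < t by rewrite lt_min ltr01 divr_gt0.
have tb : t * dot b b <= dot a b by rewrite -ler_pdivlMr// ge_min lexx orbT.
have Kt : K (t *: q + (1 - t) *: p).
  by apply: vK => //; rewrite (ltW t0) ge_min lexx.
have := dist_le x Kt; rewrite -px.
rewrite (_ : x - _ = a - t *: b); last first.
  by rewrite /a /b; apply/rowP => i; rewrite !mxE; ring.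
rewrite -(ler_pXn2r (n := 2)) ?nnegrE ?enorm_ge0// !enorm_sqr dot_subZ.
by nra.
Qed.

Lemma nearest_unique x p : K p -> enorm (x - p) = dist K x -> p = nearest x.
Proof.
move=> Kp px; have h1 := dot_nearest_le0 Kp px (nearest_in x).
have h2 := dot_nearest_le0 (nearest_in x) (enorm_nearest x) Kp.
apply/eqP; rewrite -subr_eq0 -enorm_eq0 -sqrf_eq0 enorm_sqr eq_le dot_ge0 andbT.
set q := nearest x in h1 h2 *.
have -> : dot (p - q) (p - q) = dot (x - p) (q - p) + dot (x - q) (p - q).
  rewrite -[q - p]opprB dotNr -dotNl -dotDl; congr dot.
  by apply/rowP => i; rewrite !mxE; ring.
by lra.
Qed.

(** The sum of the two variational inequalities bounds |p - q|^2 by the product of x - y and p - q.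
    The measurability of [nearest], [dist] and outer normals rests on this. *)
Lemma nearest_nonexpansive x y : enorm (nearest x - nearest y) <= enorm (x - y).
Proof.
have h1 := dot_nearest_le0 (nearest_in x) (enorm_nearest x) (nearest_in y).
have h2 := dot_nearest_le0 (nearest_in y) (enorm_nearest y) (nearest_in x).
set p := nearest x in h1 h2 *; set q := nearest y in h1 h2 *.
have h : dot (p - q) (p - q) <= dot (x - y) (p - q).
  have E : dot (x - y) (p - q) - dot (p - q) (p - q) = - dot (x - p) (q - p) - dot (y - q) (p - q).
    rewrite -[q - p]opprB dotNr opprK -!dotBl; congr dot.
    by apply/rowP => i; rewrite !mxE; ring.
  by rewrite -subr_ge0 E; lra.
have [->|pq0] := eqVneq (enorm (p - q)) 0; first exact: enorm_ge0.
rewrite -(ler_pM2r (x := enorm (p - q))); last by rewrite lt_def pq0 enorm_ge0.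
by rewrite -expr2 enorm_sqr (le_trans h)// dot_le_enorm.
Qed.

Lemma measurable_nearest : measurable_fun setT (nearest : VB R n -> VB R n).
Proof.
apply: continuous_measurable_VBVB; apply: nonexpansive_continuous.
exact: nearest_nonexpansive.
Qed.

Lemma measurable_dist : measurable_fun setT (dist K : VB R n -> R).
Proof.
rewrite (_ : dist K = fun x => enorm (x - nearest x)); last first.
  by apply/funext => x; rewrite enorm_nearest.
apply: measurable_fun_enorm; apply: measurable_funD_VB => //.
by apply: measurable_funN_VB; exact: measurable_nearest.
Qed.

End convex_body.

Lemma origin_symmetric_dist n (K : set 'rV[R]_n) x : origin_symmetric K -> dist K (- x) = dist K x.
Proof.
move=> sK; have KN y : K y -> K (- y) by move=> Ky; rewrite -sK; exists y.
congr inf; apply/seteqP; split => _ [y Ky <-]; exists (- y); try exact: KN.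
  by rewrite -enormN !opprD !opprK.
by rewrite -enormN !opprD !opprK.
Qed.

(** Parallel bodies are bounded, which gives access to [hausdorff_leb]. *)
Lemma bounded_dist_le n (K : set 'rV[R]_n) (r : R) : convex_body K ->
  exists s, forall x, dist K x <= r -> enorm x < s.
Proof.
move=> hK; have [[x0 Kx0] [cK _]] := hK.
have [M [_ hM]] := compact_bounded cK.
exists (r + n.+1%:R * (`|M| + 1) + 1) => x xr.
have := enormD (x - nearest hK x) (nearest hK x); rewrite subrK enorm_nearest => h.
have pM : `|nearest hK x| <= `|M| + 1.
  by apply: (hM (`|M| + 1)); [rewrite (le_lt_trans (ler_norm M))// ltrDl|exact: nearest_in].
have := enorm_le_mxnorm (nearest hK x).
have : n%:R * `|nearest hK x| <= n.+1%:R * (`|M| + 1).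
  by rewrite ler_pM// ler_nat.
lra.
Qed.

End nearest_point.

(** * Volumes of cones *)

Section polynomials.
Variable R : realType.
Local Notation RR := (measurableTypeR R).

(** The difference of the two sides, as a polynomial p, vanishes at 1, ..., [size p], which are more
    roots than a nonzero p can have. *)
Lemma polynomial_coef_unique (N : nat) (a b : nat -> R) :
  (forall r : R, 0 < r -> \sum_(i < N) r ^+ (N - i) * a i = \sum_(i < N) r ^+ (N - i) * b i) ->
  forall i, (i < N)%N -> a i = b i.
Proof.
move=> ab i iN; apply/eqP; rewrite -subr_eq0; apply/eqP.
pose p : {poly R} := \sum_(i < N) (a i - b i) *: 'X^(N - i).
have pi : p`_(N - i) = a i - b i.
  rewrite coef_sum (bigD1 (Ordinal iN))//= big1 => [|k ki].
    by rewrite addr0 coefZ coefXn eqxx mulr1.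
  rewrite coefZ coefXn; case: eqP => [e|]; last by rewrite mulr0.
  case/eqP: ki; apply: val_inj => /=; have := ltn_ord k; lia.
suff p0 : p = 0 by rewrite -pi p0 coef0.
apply/eqP/negPn/negP => pn0.
have := @max_poly_roots R p [seq (k.+1)%:R | k <- iota 0 (size p)] pn0.
rewrite size_map size_iota ltnn => h; apply: notF; apply: h.
  apply/allP => _ /mapP[k _ ->]; apply/rootP; rewrite horner_sum.
  transitivity (\sum_(i < N) (k.+1)%:R ^+ (N - i) * a i - \sum_(i < N) (k.+1)%:R ^+ (N - i) * b i : R).
    by rewrite -sumrB; apply: eq_bigr => l _; rewrite hornerZ hornerXn; ring.
  by rewrite ab ?subrr.
by rewrite map_inj_uniq ?iota_uniq// => x y /eqP; rewrite eqr_nat eqSS => /eqP.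
Qed.

Lemma has_deriv_sum (I : Type) (s : seq I) (f : I -> R -> R) (f' : I -> R) x :
  (forall i, has_deriv (f i) x (f' i)) ->
  has_deriv (fun y => \sum_(i <- s) f i y) x (\sum_(i <- s) f' i).
Proof.
move=> h; elim: s => [|i s IH].
  rewrite big_nil [X in has_deriv X](_ : _ = fun=> 0); first exact: has_deriv_cst.
  by apply/funext => y; rewrite big_nil.
rewrite big_cons [X in has_deriv X](_ : _ = fun y => f i y + \sum_(i <- s) f i y).
  exact: has_derivD (h i) IH.
by apply/funext => y; rewrite big_cons.
Qed.

Lemma has_deriv_continuous (F : R -> R) x l : has_deriv F x l -> {for x, continuous F}.
Proof. by move=> [dF _]; apply: differentiable_continuous; apply/derivable1_diffP. Qed.

(** The integral to which Tonelli leads in [integral_moment]. The coefficient of g_i is r^(N+m-i)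
    times 1 - m / (N+m-i), whence the factor (N-i) / (N+m-i). *)
Lemma integral_power_poly (m N : nat) (g : nat -> R) (r : R) : (0 < m)%N -> 0 < r ->
  (\int[lebesgue_measure]_(s in `[0%R, r])
     (m%:R * s ^+ m.-1 * (\sum_(i < N) r ^+ (N - i) * g i - \sum_(i < N) s ^+ (N - i) * g i))%:E =
   (\sum_(i < N) r ^+ (N + m - i) * ((N - i)%:R / (N + m - i)%:R * g i))%:E)%E.
Proof.
move=> m0 r0; set G := \sum_(i < N) r ^+ (N - i) * g i.
pose F s := G * s ^+ m + \sum_(i < N) (- (m%:R / (N + m - i)%:R * g i)) * s ^+ (N + m - i).
have dF s : has_deriv F s (m%:R * s ^+ m.-1 * (G - \sum_(i < N) s ^+ (N - i) * g i)).
  apply: has_deriv_eq.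
    apply: has_derivD; first by apply: has_derivZ; exact: has_deriv_exp.
    by apply: has_deriv_sum => i; apply: has_derivZ; exact: has_deriv_exp.
  rewrite mulrBr [G * _]mulrC [in X in _ - X]mulr_sumr -sumrN; congr (_ + _).
  apply: eq_bigr => i _; have iN := ltn_ord i.
  have k0 : (N + m - i)%:R != 0 :> R by rewrite pnatr_eq0; lia.
  have -> : (N + m - i).-1 = (m.-1 + (N - i))%N by lia.
  by rewrite exprD; field.
have cont (h : R -> R) : (forall s, {for s, continuous h}) -> continuous h by [].
rewrite (@integral_is_derive _ _ F)//.
- rewrite /F [in X in _ - X]expr0n gtn_eqF//= mulr0 add0r.
  rewrite [X in _ - X]big1 => [|i _]; last first.
    have iN := ltn_ord i; rewrite expr0n (_ : _ == _ = false) ?mulr0//; apply/eqP; lia.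
  rewrite subr0 /G mulr_suml -big_split /=; congr EFin; apply: eq_bigr => i _.
  have iN := ltn_ord i.
  have k0 : (N + m - i)%:R != 0 :> R by rewrite pnatr_eq0; lia.
  have -> : r ^+ (N + m - i) = r ^+ (N - i) * r ^+ m by rewrite -exprD; congr (_ ^+ _); lia.
  have e : (N + m - i)%:R = (N - i)%:R + m%:R :> R by rewrite -natrD; congr (_%:R); lia.
  by rewrite e in k0 *; field.
- apply: continuous_subspaceT; apply: cont => s.
  have [l h] : exists l, has_deriv (fun s => m%:R * s ^+ m.-1 * (G + -1 * \sum_(i < N) g i * s ^+ (N - i))) s l.
    eexists; apply: has_derivM; first by apply: has_derivZ; exact: has_deriv_exp.
    apply: has_derivD; first exact: has_deriv_cst.
    by apply: has_derivZ; apply: has_deriv_sum => i; apply: has_derivZ; exact: has_deriv_exp.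
  have e : (fun s => m%:R * s ^+ m.-1 * (G - \sum_(i < N) s ^+ (N - i) * g i)) =
      (fun s => m%:R * s ^+ m.-1 * (G + -1 * \sum_(i < N) g i * s ^+ (N - i))).
    apply/funext => x; rewrite mulN1r; congr (_ * (_ - _)).
    by apply: eq_bigr => i _; rewrite mulrC.
  by rewrite e; exact: has_deriv_continuous h.
- by apply: continuous_subspaceT => s; exact: has_deriv_continuous (dF s).
Qed.

(* t^m = int_0^t m s^(m-1) ds, then Tonelli *)
Lemma integral_moment d (T : measurableType d) (mu : {sigma_finite_measure set T -> \bar R})
    (t : T -> R) (A : set T) (m N : nat) (g : nat -> R) (r : R) :
  measurable_fun setT t -> measurable A -> (forall y, A y -> 0 < t y) -> (0 < m)%N -> 0 < r ->
  (forall s, 0 < s -> mu (A `&` [set y | t y <= s]) = (\sum_(i < N) s ^+ (N - i) * g i)%:E) ->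
  (\int[mu]_(y in A `&` [set y | (t y <= r)%R]) (t y ^+ m)%:E =
   (\sum_(i < N) r ^+ (N + m - i) * ((N - i)%:R / (N + m - i)%:R * g i))%:E)%E.
Proof.
move=> mt mA A0 m0 r0 hG; rewrite -integral_power_poly//.
have mle s : measurable [set y | t y <= s].
  rewrite (_ : [set y | t y <= s] = t @^-1` `]-oo, s]).
    exact: preimage_measurable.
  by apply/seteqP; split => y /=; rewrite in_itv.
set Ar := A `&` [set y | t y <= r]; have mAr : measurable Ar by apply: measurableI.
pose E : set (T * RR) := [set p | Ar p.1 /\ 0 <= p.2 < t p.1].
have mE : measurable E.
  rewrite (_ : E = fst @^-1` Ar `&` ((snd @^-1` `[0, +oo[) `&`
     ((fun p : T * RR => t p.1 - p.2 : RR) @^-1` `]0, +oo[))).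
    apply: measurableI; first by apply: preimage_measurable mAr; exact: measurable_fst.
    apply: measurableI; first by apply: preimage_measurable => //; exact: measurable_snd.
    apply: preimage_measurable => //; apply: measurable_funB; last exact: measurable_snd.
    exact: measurableT_comp mt measurable_fst.
  apply/seteqP; split => p; rewrite /E /= !in_itv/= !andbT subr_gt0.
    by move=> [Ap /andP[h1 h2]].
  by move=> [Ap [h1 h2]]; split => //; apply/andP.
pose h (p : T * RR) : \bar R := ((m%:R * p.2 ^+ m.-1) * \1_E p)%:E.
have mh : measurable_fun setT h.
  apply/measurable_EFinP; apply: measurable_funM; last exact: measurable_indic.
  by apply: measurable_funM => //; apply: measurable_funX; exact: measurable_snd.
have h0 p : (0 <= h p)%E.
  rewrite lee_fin /h indicE; case: (boolP (p \in E)) => [|_]; last by rewrite mulr0.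
  by rewrite inE /E /= => -[_ /andP[p0 _]]; rewrite mulr1 mulr_ge0// exprn_ge0.
have := fubini_tonelli (m1 := mu) (m2 := @lebesgue_measure R) h mh h0; rewrite /fubini_F /fubini_G /= => e.
transitivity (\int[mu]_y \int[lebesgue_measure]_s h (y, s))%E.
  rewrite integral_mkcond; apply: eq_integral => y _; rewrite patchE; case: ifPn => [|].
    rewrite inE => Ay; have ty0 : 0 < t y by apply: A0; case: Ay.
    transitivity (\int[lebesgue_measure]_(s in `[0%R, t y[) (m%:R * s ^+ m.-1)%:E)%E.
      rewrite integral_itv_bndo_bndc; last first.
        by apply/measurable_EFinP; apply: measurable_funM => //; exact: measurable_funX.
      under eq_integral do rewrite EFinM.
      rewrite ge0_integralZl_EFin//.
      - rewrite integral_power ?ltW// prednK// -EFinM; congr EFin.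
        by rewrite mulrCA mulfV ?mulr1// pnatr_eq0 -lt0n.
      - by move=> s /=; rewrite in_itv/= lee_fin => /andP[s0 _]; exact: exprn_ge0.
      - by apply/measurable_EFinP; exact: measurable_funX.
    rewrite integral_mkcond; apply: eq_integral => s _.
    rewrite patchE /h indicE; case: ifPn => [|].
      by rewrite inE/= in_itv/= => sy; rewrite mem_set ?mulr1.
    rewrite notin_setE/= in_itv/= => sy; rewrite memNset ?mulr0//.
    by move=> [].
  rewrite notin_setE => nAy; rewrite integral0_eq// => s _.
  by rewrite /h indicE memNset ?mulr0// => -[].
rewrite e [RHS]integral_mkcond; apply: eq_integral => s _; rewrite patchE; case: ifPn => [|].
  rewrite inE/= in_itv/= => /andP[s0 sr].
  (* At s = 0, outside the range of the hypothesis, both sides are 0 because t is positive on A. *)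
  have Gs : mu (A `&` [set y | t y <= s]) = (\sum_(i < N) s ^+ (N - i) * g i)%:E.
    move: s0; rewrite le_eqVlt => /predU1P[<-|]; last exact: hG.
    rewrite (_ : _ `&` _ = set0) ?measure0 ?big1//.
      by move=> i _; rewrite expr0n subn_eq0 leqNgt ltn_ord mul0r.
    by apply/seteqP; split => // y [/A0 + /=]; rewrite ltNge => /negP.
  transitivity (\int[mu]_(y in Ar `\` [set y | (t y <= s)%R]) (m%:R * s ^+ m.-1)%:E)%E.
    rewrite [RHS]integral_mkcond; apply: eq_integral => y _; rewrite patchE /h indicE; case: ifPn => [|].
      rewrite inE => -[Ay /negP]; rewrite -ltNge => sty.
      by rewrite mem_set ?mulr1// /E /= s0.
    rewrite notin_setE => nE; rewrite memNset ?mulr0// /E /= => -[Ay /andP[_ sty]].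
    by apply: nE; split => //=; apply/negP; rewrite -ltNge.
  rewrite integral_cst; last by apply: measurableD.
  rewrite measureD//; last by rewrite [X in (X < _)%E](hG _ r0) ltry.
  rewrite (_ : Ar `&` _ = A `&` [set y | t y <= s]); last first.
    apply/seteqP; split => y /=; first by move=> [[]].
    by move=> [Ay ts]; split => //; split => //=; exact: le_trans sr.
  by rewrite [X in (X - _)%E](hG _ r0) [X in (_ - X)%E]Gs -EFinB -EFinM.
rewrite notin_setE/= in_itv/= => sI; rewrite integral0_eq// => y _.
rewrite /h indicE memNset ?mulr0// => -[[_ /= ty] /andP[s0 sty]]; apply: sI.
by rewrite s0 (ltW (lt_le_trans sty ty)).
Qed.

End polynomials.

(** Inversion is continuous off 0, and on the single point 0, where it takes its default value,
    every function is measurable. *)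
Lemma measurable_inv (R : realType) : measurable_fun setT (@GRing.inv R).
Proof.
have oU : open [set x : R | x != 0] by exact: open_neq.
have U1 : [set x : R | x != 0] `|` [set 0] = setT.
  by apply/seteqP; split => x //= _; have [->|] := eqVneq x 0; [right|left].
rewrite -U1 measurable_funU//; last exact: open_measurable.
split; last exact: measurable_fun_set1.
by apply: open_continuous_measurable_fun => // x; rewrite inE /= => x0; exact: inv_continuous.
Qed.

(** * Cones over sets with a Steiner polynomial, and the central projection of a half ball *)

Section cones.
Variables (R : realType) (m : nat).
Local Notation RR := (measurableTypeR R).

(** The length 1 / |u + w| of the component along u of the unit vector in direction u + w, for a
    unit vector u orthogonal to w. *)
Definition slope (w : 'rV[R]_m) : R := (Num.sqrt (1 + enorm w ^+ 2))^-1.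

Lemma sqrt_slope_gt0 (w : 'rV[R]_m) : 0 < Num.sqrt (1 + enorm w ^+ 2).
Proof. by rewrite sqrtr_gt0 ltr_pwDl// sqr_ge0. Qed.

Lemma sqrt_slope_sqr (w : 'rV[R]_m) : Num.sqrt (1 + enorm w ^+ 2) ^+ 2 = 1 + enorm w ^+ 2.
Proof. by rewrite sqr_sqrtr// addr_ge0// sqr_ge0. Qed.

Lemma slope_gt0 w : 0 < slope w.
Proof. by rewrite invr_gt0 sqrt_slope_gt0. Qed.

Lemma slope_le1 w : slope w <= 1.
Proof.
rewrite invf_le1 ?sqrt_slope_gt0// -[leLHS]sqrtr1 ler_sqrt ?lerDl ?sqr_ge0//.
by rewrite addr_ge0// sqr_ge0.
Qed.

Lemma measurable_slope : measurable_fun setT (slope : VB R m -> R).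
Proof.
have h : measurable_fun setT (fun w : VB R m => 1 + enorm w ^+ 2).
  by apply: measurable_funD => //; apply: measurable_funX; exact: measurable_enorm.
have ms : measurable_fun setT (@Num.sqrt R).
  by apply: continuous_measurable_fun; exact: sqrt_continuous.
exact: (measurableT_comp (@measurable_inv R) (measurableT_comp ms h)).
Qed.

Lemma le_slope (a r : R) (v : 'rV[R]_m) : 0 < a -> 0 < r ->
  (a ^+ 2 + enorm (a *: v) ^+ 2 <= r ^+ 2) = (a <= r * slope v).
Proof.
move=> a0 r0; rewrite enormZ exprMn real_normK ?num_real//.
rewrite [RHS]ler_pdivlMr ?sqrt_slope_gt0//.
rewrite -[RHS](ler_pXn2r (n := 2)) ?nnegrE ?(ltW r0) ?mulr_ge0 ?(ltW a0) ?(ltW (sqrt_slope_gt0 _))//.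
by rewrite [in RHS]exprMn sqrt_slope_sqr mulrDr mulr1.
Qed.

Section cone.
Context d (T : measurableType d) (mu : {sigma_finite_measure set T -> \bar R}).
Variables (t : T -> R) (A : set T) (C : set (VB R m)) (N : nat) (g : nat -> R).
Hypotheses (mt : measurable_fun setT t) (mA : measurable A) (A0 : forall y, A y -> 0 < t y)
  (m0 : (0 < m)%N) (mC : measurable C)
  (hG : forall s, 0 < s -> mu (A `&` [set y | t y <= s]) = (\sum_(i < N) s ^+ (N - i) * g i)%:E).

(** In the application t is the distance to the projected body within L, A prescribes the normal
    within L, and C prescribes w = z / t. The last condition says that the distance in R^d is at
    most r. *)
Definition cone (r : R) : set (T * VB R m) :=
  [set p | [/\ A p.1, C ((t p.1)^-1 *: (p.2 : 'rV[R]_m)) &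
               t p.1 ^+ 2 + enorm p.2 ^+ 2 <= r ^+ 2]].

Lemma measurable_cone r : measurable (cone r).
Proof.
have mt1 : measurable_fun setT (fun p : T * VB R m => t p.1).
  exact: measurableT_comp mt measurable_fst.
rewrite (_ : cone r = fst @^-1` A `&`
   (((fun p : T * VB R m => (t p.1)^-1 *: (p.2 : 'rV[R]_m) : VB R m) @^-1` C) `&`
   ((fun p : T * VB R m => t p.1 ^+ 2 + enorm p.2 ^+ 2 : RR) @^-1` `]-oo, r ^+ 2]))).
  apply: measurableI; first by apply: preimage_measurable mA; exact: measurable_fst.
  apply: measurableI.
    apply: preimage_measurable mC; apply: measurable_funZ_VB; last exact: measurable_snd.
    exact: measurableT_comp (@measurable_inv R) mt1.
  apply: preimage_measurable => //; apply: measurable_funD; first exact: measurable_funX.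
  by apply: measurable_funX; apply: measurable_fun_enorm; exact: measurable_snd.
by apply/seteqP; split => p; rewrite /cone /= in_itv/=; [case|case=> ? []].
Qed.

(* In the slice over y substitute z = t(y) w and use Tonelli. *)
Lemma measure_cone r : 0 < r ->
  ((mu \x leb R m) (cone r) = \int[leb R m]_(w in C)
    (\sum_(i < N) (r * slope w) ^+ (N + m - i) * ((N - i)%:R / (N + m - i)%:R * g i))%:E)%E.
Proof.
move=> r0.
pose E : set (T * VB R m) := [set p | [/\ A p.1, C p.2 & t p.1 <= r * slope p.2]].
have mt1 : measurable_fun setT (fun p : T * VB R m => t p.1).
  exact: measurableT_comp mt measurable_fst.
have mE : measurable E.
  rewrite (_ : E = fst @^-1` A `&` ((snd @^-1` C) `&`
     ((fun p : T * VB R m => r * slope p.2 - t p.1 : RR) @^-1` `[0, +oo[))).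
    apply: measurableI; first by apply: preimage_measurable mA; exact: measurable_fst.
    apply: measurableI; first by apply: preimage_measurable mC; exact: measurable_snd.
    apply: preimage_measurable => //; apply: measurable_funB => //.
    by apply: measurable_funM => //; exact: measurableT_comp measurable_slope measurable_snd.
  by apply/seteqP; split => p; rewrite /E /= in_itv/= andbT subr_ge0; [case|case=> ? []].
pose h (p : T * VB R m) : \bar R := ((t p.1 ^+ m) * \1_E p)%:E.
have mh : measurable_fun setT h.
  apply/measurable_EFinP; apply: measurable_funM; last exact: measurable_indic.
  exact: measurable_funX.
have h0 p : (0 <= h p)%E.
  rewrite lee_fin /h indicE; case: (boolP (p \in E)) => [|_]; last by rewrite mulr0.
  by rewrite inE /E /= => -[/A0 tp _ _]; rewrite mulr1 exprn_ge0// ltW.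
have := fubini_tonelli (m1 := mu) (m2 := leb R m) h mh h0; rewrite /fubini_F /fubini_G /= => e.
rewrite /product_measure1.
transitivity (\int[mu]_y \int[leb R m]_w h (y, w))%E.
  apply: eq_integral => y _ /=.
  have [Ay|nAy] := pselect (A y); last first.
    rewrite (_ : xsection _ _ = set0) ?measure0.
      by rewrite integral0_eq// => w _; rewrite /h indicE memNset ?mulr0// => -[].
    by apply/seteqP; split => // z; rewrite /xsection /= inE => -[].
  have ty0 := A0 Ay.
  rewrite (leb_scale ty0); last by apply: measurable_xsection; exact: measurable_cone.
  have mEy : measurable (xsection E y) by exact: measurable_xsection.
  rewrite (_ : [set x | _] = xsection E y); last first.
    apply/seteqP; split => w; rewrite /xsection /= !inE /cone /E /= scalerA mulVf ?gt_eqF// scale1r.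
      by move=> [_ Cw]; rewrite le_slope.
    by move=> [_ Cw]; rewrite -le_slope.
  rewrite -[leb R m _]mul1e -(integral_cst _ mEy) -ge0_integralZl_EFin//; last first.
    by rewrite exprn_ge0// ltW.
  rewrite integral_mkcond; apply: eq_integral => w _; rewrite patchE /h indicE.
  rewrite (_ : (w \in xsection E y) = ((y, w) \in E)); last first.
    by apply/idP/idP; rewrite !inE /xsection /= inE.
  by case: ifP => _; rewrite ?mule1 ?mulr1 ?mulr0.
rewrite e [RHS]integral_mkcond; apply: eq_integral => w _; rewrite patchE; case: ifPn => [|].
  rewrite inE => Cw.
  rewrite -(integral_moment mt mA A0 m0 _ hG) ?mulr_gt0 ?slope_gt0//.
  rewrite [RHS]integral_mkcond; apply: eq_integral => y _; rewrite patchE /h indicE.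
  case: ifPn; rewrite ?inE ?notin_setE /= => hy.
    by rewrite mem_set ?mulr1//; case: hy => ? ?; split.
  by rewrite memNset ?mulr0// => -[/= Ay _ tw]; apply: hy; split.
rewrite notin_setE => nC; rewrite integral0_eq// => y _.
by rewrite /h indicE memNset ?mulr0// => -[].
Qed.

End cone.

Definition half_line : set (VB R 1) := [set y | 0 < (y : 'rV[R]_1) ord0 ord0].

Lemma measurable_half_line : measurable half_line.
Proof.
rewrite (_ : half_line = (fun y : VB R 1 => (y : 'rV[R]_1) ord0 ord0) @^-1` `]0, +oo[).
  by apply: preimage_measurable => //; exact: measurable_coord.
by apply/seteqP; split => y; rewrite /half_line /= in_itv/= andbT.
Qed.

Lemma leb_half_line s : 0 < s ->
  leb R 1 (half_line `&` [set y | (y : 'rV[R]_1) ord0 ord0 <= s]) = s%:E.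
Proof.
move=> s0; rewrite (_ : _ `&` _ = cube 1 s `\` cube 1 0); last first.
  apply/seteqP; split => y; rewrite /half_line /cube /=.
    move=> [y0 ys]; split => [i|/(_ ord0)]; first by rewrite [i]ord1 (ltW y0).
    by rewrite [X in _ && X]leNgt y0 andbF.
  move=> [h1 h2]; have /andP[y0 ys] := h1 ord0; split => //.
  rewrite lt_def y0 andbT; apply/eqP => e; apply: h2 => i.
  by rewrite (_ : i = ord0) ?e ?lexx//; exact: ord1.
rewrite measureD; [|exact: measurable_cube|exact: measurable_cube|].
  rewrite (_ : _ `&` _ = cube 1 0); last first.
    apply/seteqP; split => y; first by case.
    by move=> h; split => // i; have := h i; rewrite /= => /andP[-> /le_trans ->]//; exact: ltW.
  have e1 := @leb_cube R 1 s (ltW s0); have e2 := @leb_cube R 1 0 (lexx 0).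
  by rewrite [X in (X - _)%E]e1 [X in (_ - X)%E]e2 sube0.
by have e1 := @leb_cube R 1 s (ltW s0); rewrite [X in (X < _)%E]e1 ltry.
Qed.

Definition half_ball : set (VB R 1 * VB R m) :=
  [set p | half_line p.1 /\ enorm p.1 ^+ 2 + enorm p.2 ^+ 2 <= 1].

Lemma measurable_half_ball : measurable half_ball.
Proof.
rewrite (_ : half_ball = fst @^-1` half_line `&`
   ((fun p : VB R 1 * VB R m => enorm p.1 ^+ 2 + enorm p.2 ^+ 2 : RR)
     @^-1` `]-oo, 1])).
  apply: measurableI.
    by apply: preimage_measurable measurable_half_line; exact: measurable_fst.
  apply: preimage_measurable => //; apply: measurable_funD; apply: measurable_funX;
    apply: measurable_fun_enorm; [exact: measurable_fst|exact: measurable_snd].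
by apply/seteqP; split => p; rewrite /half_ball /= in_itv.
Qed.

Definition central_proj (p : VB R 1 * VB R m) : VB R m :=
  ((p.1 : 'rV[R]_1) ord0 ord0)^-1 *: (p.2 : 'rV[R]_m).

Lemma measurable_central_proj : measurable_fun setT central_proj.
Proof.
apply: measurable_funZ_VB; last exact: measurable_snd.
apply: (measurableT_comp (@measurable_inv R)).
by apply: measurable_fun_coord; exact: measurable_fst.
Qed.

(* central projection of the volume of the half ball {x_0 > 0, |x| <= 1} to the
   hyperplane x_0 = 1 *)
Definition gnomonic := image_measure measurable_central_proj
  (mrestr (leb R 1 \x leb R m)%E measurable_half_ball).

HB.instance Definition _ := Measure.on gnomonic.

(** The half ball is itself a [cone], over the half line with Steiner polynomial s, so that
    [measure_cone] with one coefficient gives the density. *)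
Lemma gnomonicE C : (0 < m)%N -> measurable C ->
  (gnomonic C = \int[leb R m]_(w in C) (slope w ^+ m.+1 / m.+1%:R)%:E)%E.
Proof.
move=> m0 mC.
have := @measure_cone _ _ (leb R 1) (fun y : VB R 1 => (y : 'rV[R]_1) ord0 ord0) half_line C 1 (fun=> 1)
  (measurable_coord _) measurable_half_line (fun y hy => hy) m0 mC _ 1 ltr01.
move=> h; transitivity ((leb R 1 \x leb R m)%E (cone (fun y : VB R 1 => (y : 'rV[R]_1) ord0 ord0) half_line C 1)).
  rewrite /gnomonic /image_measure /mrestr; congr (_ _); apply/seteqP; split => p;
    rewrite /cone /half_ball /= enorm_rV1 real_normK ?num_real// expr1n.
    by move=> [? [? ?]]; split.
  by move=> [? ? ?]; split.
rewrite h => [|s s0].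
  apply: eq_integral => w _; rewrite big_ord1 mul1r subn0 add1n mulr1.
  by rewrite mul1r.
by rewrite leb_half_line// big_ord1 mulr1 subn0 expr1.
Qed.

Lemma gnomonic_lty : (gnomonic setT < +oo)%E.
Proof.
have h := @leb_eball_lty R (1 + m) 1.
rewrite (@leb_row_mx R 1 m) in h; last exact: measurable_eball.
apply: le_lt_trans h.
rewrite /gnomonic /image_measure /mrestr preimage_setT setTI.
apply: (@le_measure _ _ _ (leb R 1 \x leb R m)%E); rewrite ?inE.
- exact: measurable_half_ball.
- apply: (preimage_measurable (f := fun p : VB R 1 * VB R m =>
    row_mx (p.1 : 'rV[R]_1) (p.2 : 'rV[R]_m) : VB R (1 + m)) _ (@measurable_eball R (1 + m) 1)).
  by apply: measurable_fun_row_mx; [exact: measurable_fst|exact: measurable_snd].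
- move=> p [_ h]; rewrite /eball /= -(ler_pXn2r (n := 2)) ?nnegrE ?enorm_ge0//.
  by rewrite enorm_row_mx expr1n.
Qed.

(** The exponent m + 1 is the density of the finite measure [gnomonic] up to a constant; higher
    powers are smaller because [slope] is at most 1. *)
Lemma integrable_slope C k : (0 < m)%N -> measurable C -> (m < k)%N ->
  (leb R m).-integrable C (fun w => (slope w ^+ k)%:E).
Proof.
move=> m0 mC mk.
have ms l : measurable_fun setT (fun w : VB R m => (slope w ^+ l)%:E).
  by apply/measurable_EFinP; apply: measurable_funX; exact: measurable_slope.
have p0 l w : 0 <= slope w ^+ l by rewrite exprn_ge0// ltW// slope_gt0.
have I : (leb R m).-integrable setT (fun w : VB R m => (slope w ^+ m.+1 / m.+1%:R)%:E).
  apply/integrableP; split.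
    apply/measurable_EFinP; apply: measurable_funM => //.
    by apply: measurable_funX; exact: measurable_slope.
  have := gnomonic_lty; rewrite gnomonicE//; apply: le_lt_trans.
  rewrite le_eqVlt; apply/orP; left; apply/eqP; apply: eq_integral => w _.
  by rewrite /= ger0_norm// divr_ge0.
have := integrableZl (@measurableT _ (VB R m)) m.+1%:R I; move=> {}I.
apply: (le_integrable mC _ _ (integrableS _ mC _ I)) => //; first exact: measurable_funTS.
move=> w _; rewrite -EFinM lee_fin ger0_norm// mulrCA mulfV ?pnatr_eq0// mulr1 ger0_norm//.
by apply: ler_wiXn2l => //; [exact/ltW/slope_gt0|exact: slope_le1].
Qed.

(** Only the coefficient of index N is made explicit: there the power of [slope] is m + 1 and the
    factor is 1 / (m + 1), which is the density of [gnomonic]. *)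
Lemma measure_cone_polynomial d (T : measurableType d) (mu : {sigma_finite_measure set T -> \bar R})
    (t : T -> R) (A : set T) (C : set (VB R m)) (N : nat) (g : nat -> R) :
  measurable_fun setT t -> measurable A -> (forall y, A y -> 0 < t y) ->
  (0 < m)%N -> measurable C ->
  (forall s, 0 < s -> mu (A `&` [set y | t y <= s]) = (\sum_(i < N.+1) s ^+ (N.+1 - i) * g i)%:E) ->
  exists b : nat -> R, b N = g N * fine (gnomonic C) /\
    forall r, 0 < r -> (mu \x leb R m)%E (cone t A C r) = (\sum_(i < N.+1) r ^+ (N.+1 + m - i) * b i)%:E.
Proof.
move=> mt mA A0 m0 mC hG.
pose th k := fine (\int[leb R m]_(w in C) (slope w ^+ k)%:E)%E.
pose b i := (N.+1 - i)%:R / (N.+1 + m - i)%:R * g i * th (N.+1 + m - i)%N.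
have thE k : (m < k)%N -> (\int[leb R m]_(w in C) (slope w ^+ k)%:E)%E = (th k)%:E.
  by move=> mk; rewrite fineK//; apply: (integrable_fin_num mC); exact: integrable_slope.
exists b; split.
  have -> : fine (gnomonic C) = th m.+1 / m.+1%:R.
    rewrite gnomonicE//; under eq_integral do rewrite mulrC EFinM.
    rewrite integralZl//; last exact: integrable_slope.
    by rewrite thE// -EFinM /= mulrC.
  rewrite /b; have -> : (N.+1 - N = 1)%N by lia.
  have -> : (N.+1 + m - N = m.+1)%N by lia.
  by rewrite mul1r [_^-1 * _]mulrC -mulrA [_^-1 * _]mulrC.
move=> r r0; rewrite (measure_cone mt mA A0 m0 mC hG r0).
pose a i := r ^+ (N.+1 + m - i) * ((N.+1 - i)%:R / (N.+1 + m - i)%:R * g i).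
transitivity (\int[leb R m]_(w in C) \sum_(i < N.+1) ((a i)%:E * (slope w ^+ (N.+1 + m - i))%:E))%E.
  apply: eq_integral => w _; rewrite -sumEFin; apply: eq_bigr => i _.
  by rewrite -EFinM /a exprMn; congr EFin; ring.
have mk (i : 'I_N.+1) : (m < N.+1 + m - i)%N by have := ltn_ord i; lia.
rewrite integral_sum//; last by move=> i; apply: integrableZl => //; exact: integrable_slope.
rewrite -sumEFin; apply: eq_bigr => i _.
rewrite integralZl//; last exact: integrable_slope.
by rewrite thE// -EFinM /a /b; congr EFin; ring.
Qed.

End cones.

(** * Area measures of a projection in the ambient space *)

Lemma measurable_sphere_subsp (R : realType) d (L : 'M[R]_d) : measurable ((@sphere R d `&` subsp L) : set (VB R d)).
Proof.
apply: measurableI.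
  rewrite (_ : (@sphere R d : set (VB R d)) = (fun v : VB R d => enorm v) @^-1` [set 1])//.
  by apply: preimage_measurable => //; exact: measurable_enorm.
rewrite (_ : (subsp L : set (VB R d)) =
  (fun v : VB R d => enorm (v *m L - v)) @^-1` [set 0]).
  apply: preimage_measurable => //; apply: measurable_fun_enorm.
  apply: measurable_funD_VB; first exact: measurable_fun_mulmx.
  exact: measurable_funN_VB.
apply/seteqP; split => v; rewrite /subsp /=; first by move=> ->; rewrite subrr enorm0.
by move=> /eqP; rewrite enorm_eq0 subr_eq0 => /eqP.
Qed.

Section area_measures.
Variables (R : realType) (N m d : nat).
Hypotheses (m0 : (0 < m)%N) (dNm : d = (N.+1 + m)%N).
Variables (U : 'M[R]_(N.+1, d)) (W : 'M[R]_(m, d)).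
Hypotheses (hU : isometric U) (hW : isometric W) (UW : U *m W^T = 0).
Variables (K0 : set 'rV[R]_N.+1) (hK : convex_body K0).

(** The rows of U and W are orthonormal bases of L and its complement. [K0] is the body in
    coordinates with respect to U, where [leb] measures volume, and [K'] is the same body inside
    R^d. *)
Let L := U^T *m U.
Let K' : set 'rV[R]_d := [set y *m U | y in K0].
Let t : VB R N.+1 -> R := dist K0.
Let u (y : 'rV[R]_N.+1) : 'rV[R]_N.+1 := (dist K0 y)^-1 *: (y - nearest hK y).

Let WU : W *m U^T = 0.
Proof. by rewrite -[LHS]trmxK trmx_mul trmxK UW trmx0. Qed.

Lemma orthonormal_decomposition : U^T *m U + W^T *m W = 1%:M.
Proof.
move: U W hU hW UW WU; rewrite dNm => U' W' hU' hW' UW' WU'.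
have := @mulmx1C _ _ (col_mx U' W') (col_mx U' W')^T.
rewrite tr_col_mx mul_col_row hU' hW' UW' WU' -scalar_mx_block => /(_ erefl).
by rewrite mul_row_col.
Qed.

Let orth_sumK (x : 'rV[R]_d) : x *m U^T *m U + x *m W^T *m W = x.
Proof. by rewrite -!mulmxA -mulmxDr orthonormal_decomposition mulmx1. Qed.

Let mulU (y : 'rV[R]_N.+1) (z : 'rV[R]_m) : (y *m U + z *m W) *m U^T = y.
Proof. by rewrite mulmxDl -!mulmxA hU WU mulmx1 mulmx0 addr0. Qed.

Let mulW (y : 'rV[R]_N.+1) (z : 'rV[R]_m) : (y *m U + z *m W) *m W^T = z.
Proof. by rewrite mulmxDl -!mulmxA hW UW mulmx1 mulmx0 add0r. Qed.

Let mulL (y : 'rV[R]_N.+1) (z : 'rV[R]_m) : (y *m U + z *m W) *m L = y *m U.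
Proof. by rewrite /L mulmxA mulU. Qed.

Let enorm_sum (y : 'rV[R]_N.+1) (z : 'rV[R]_m) :
  enorm (y *m U + z *m W) ^+ 2 = enorm y ^+ 2 + enorm z ^+ 2.
Proof. exact: (@enorm_orth_sum R N.+1 m d U W (y, z)). Qed.

Lemma dist_orth_sum y z : dist K' (y *m U + z *m W) ^+ 2 = dist K0 y ^+ 2 + enorm z ^+ 2.
Proof.
have K'0 : K' !=set0 by have [[y0 Ky0] _] := hK; exists (y0 *m U), y0.
have e y' : enorm (y *m U + z *m W - y' *m U) ^+ 2 = enorm (y - y') ^+ 2 + enorm z ^+ 2.
  by rewrite addrAC -mulmxBl enorm_sum.
have dK' : 0 <= dist K' (y *m U + z *m W).
  have [q Kq] := K'0; apply: lb_le_inf; first by exists (enorm (y *m U + z *m W - q)), q.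
  by move=> _ [? _ <-]; exact: enorm_ge0.
apply/eqP; rewrite eq_le; apply/andP; split.
  rewrite -(enorm_nearest hK y) -e ler_pXn2r ?nnegrE ?enorm_ge0//.
  apply: ge_inf; last by exists (nearest hK y *m U) => //; exists (nearest hK y) => //; exact: nearest_in.
  by exists 0 => _ [? _ <-]; exact: enorm_ge0.
rewrite -[leLHS]sqr_sqrtr ?addr_ge0 ?sqr_ge0// ler_pXn2r ?nnegrE ?sqrtr_ge0//.
have [q Kq] := K'0; apply: lb_le_inf; first by exists (enorm (y *m U + z *m W - q)), q.
move=> _ [_ [y' Ky' <-] <-]; rewrite -(ler_pXn2r (n := 2)) ?nnegrE ?enorm_ge0 ?sqrtr_ge0//.
rewrite [leLHS]sqr_sqrtr ?addr_ge0 ?sqr_ge0// e lerD2r ler_pXn2r ?nnegrE ?enorm_ge0 ?dist_ge0//.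
exact: dist_le.
Qed.

Let dist_K'_ge0 x : 0 <= dist K' x.
Proof.
have [[y0 Ky0] _] := hK; apply: lb_le_inf; first by exists (enorm (x - y0 *m U)), (y0 *m U) => //; exists y0.
by move=> _ [? _ <-]; exact: enorm_ge0.
Qed.

Let dist_U y : dist K' (y *m U) = dist K0 y.
Proof.
have := dist_orth_sum y 0; rewrite mul0mx addr0 enorm0 expr0n addr0 => /eqP.
by rewrite eqrXn2 ?dist_K'_ge0 ?dist_ge0// => /eqP.
Qed.

Let nearest_K' y z q : K' q -> enorm (y *m U + z *m W - q) = dist K' (y *m U + z *m W) ->
  q = nearest hK y *m U.
Proof.
move=> [y' Ky' <-] e; congr (_ *m U); apply: nearest_unique => //.
have : enorm (y *m U + z *m W - y' *m U) ^+ 2 = dist K' (y *m U + z *m W) ^+ 2 by rewrite e.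
rewrite dist_orth_sum addrAC -mulmxBl enorm_sum => /addIr /eqP.
by rewrite eqrXn2 ?enorm_ge0 ?dist_ge0// => /eqP.
Qed.

Lemma local_parallel_subsp r B : local_parallel (subsp L) K' r B =
  [set y *m U | y in [set y | 0 < dist K0 y /\ dist K0 y <= r /\ B (u y *m U)]].
Proof.
apply/seteqP; split => x.
  move=> [xL [x0 [xr [q [Kq [qx Bq]]]]]].
  have xE : x = (x *m U^T) *m U by rewrite -mulmxA; exact/esym.
  rewrite xE in x0 xr qx Bq *; set y := x *m U^T in x0 xr qx Bq *.
  rewrite dist_U in x0 xr qx Bq; exists y => //; split => //; split => //.
  have := @nearest_K' y 0 q Kq; rewrite mul0mx addr0 dist_U => /(_ qx) qE.
  by move: Bq; rewrite qE -mulmxBl scalemxAl.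
move=> [y [y0 [yr By]] <-]; split; first by rewrite /subsp /= -mulmxA [U *m _]mulmxA hU mul1mx.
rewrite dist_U; split => //; split => //; exists (nearest hK y *m U); split.
  by exists (nearest hK y) => //; exact: nearest_in.
by rewrite -mulmxBl enorm_isometric// enorm_nearest scalemxAl.
Qed.

(** The squared form of the condition on the distance, with the sign of r recorded separately,
    avoids square roots in the comparison with [cone]. *)
Lemma local_parallel_setT r B (y : 'rV[R]_N.+1) (z : 'rV[R]_m) :
  local_parallel setT K' r B (y *m U + z *m W) <->
  [/\ 0 < dist K0 y ^+ 2 + enorm z ^+ 2, dist K0 y ^+ 2 + enorm z ^+ 2 <= r ^+ 2, 0 <= r &
   B ((Num.sqrt (dist K0 y ^+ 2 + enorm z ^+ 2))^-1 *: ((y - nearest hK y) *m U + z *m W))].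
Proof.
have dE : dist K' (y *m U + z *m W) = Num.sqrt (dist K0 y ^+ 2 + enorm z ^+ 2).
  by rewrite -dist_orth_sum sqrtr_sqr ger0_norm.
have e : y *m U + z *m W - nearest hK y *m U = (y - nearest hK y) *m U + z *m W.
  by rewrite addrAC -mulmxBl.
rewrite /local_parallel /=; split.
  move=> [_ [x0 [xr [q [Kq [qx Bq]]]]]]; rewrite dE in x0 xr Bq.
  have r0 : 0 <= r by exact: le_trans (sqrtr_ge0 _) xr.
  rewrite sqrtr_gt0 in x0; split => //.
    by rewrite -[leLHS]sqr_sqrtr ?(ltW x0)// ler_pXn2r ?nnegrE ?sqrtr_ge0.
  by move: Bq; rewrite (nearest_K' Kq qx) e.
move=> [x0 xr r0 Bx]; split => //; rewrite dE sqrtr_gt0; split => //; split.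
  by rewrite -(ler_pXn2r (n := 2)) ?nnegrE ?sqrtr_ge0// sqr_sqrtr// ltW.
exists (nearest hK y *m U); split; first by exists (nearest hK y) => //; exact: nearest_in.
rewrite e; split => //.
by rewrite -dE -[RHS]ger0_norm// -sqrtr_sqr dist_orth_sum -enorm_nearest -enorm_sum -e sqrtr_sqr ger0_norm ?enorm_ge0.
Qed.

Let measurable_u : measurable_fun setT (u : VB R N.+1 -> VB R N.+1).
Proof.
apply: measurable_funZ_VB.
  exact: (measurableT_comp (@measurable_inv R) (measurable_dist hK)).
apply: measurable_funD_VB => //; apply: measurable_funN_VB; exact: measurable_nearest.
Qed.

Let enorm_u y : 0 < dist K0 y -> enorm (u y) = 1.
Proof. by move=> y0; rewrite enormZ enorm_nearest gtr0_norm ?invr_gt0// mulVf// gt_eqF. Qed.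

Definition normal_set (X : set (VB R d)) : set (VB R N.+1) :=
  [set y | 0 < dist K0 (y : 'rV[R]_N.+1) /\ X (u y *m U)].

Lemma measurable_normal_set X : measurable X -> measurable (normal_set X).
Proof.
move=> mX.
rewrite (_ : normal_set X = t @^-1` `]0, +oo[ `&`
  (fun y : VB R N.+1 => u y *m U : VB R d) @^-1` X); last first.
  by apply/seteqP; split => y; rewrite /normal_set /= in_itv/= andbT.
apply: measurableI; first by apply: preimage_measurable => //; exact: measurable_dist.
by apply: (preimage_measurable _ mX); apply: measurable_fun_mulmx; exact: measurable_u.
Qed.

Let mt : measurable_fun setT t.
Proof. exact: measurable_dist. Qed.

Let measurable_t_le s : measurable [set y | t y <= s].
Proof.
rewrite (_ : [set y | _] = t @^-1` `]-oo, s]); first exact: preimage_measurable.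
by apply/seteqP; split => y /=; rewrite in_itv.
Qed.

Lemma hausdorff_local_parallel_subsp r (X : set (VB R d)) : measurable X ->
  hausdorff N.+1 (local_parallel (subsp L) K' r (X : set 'rV[R]_d)) =
  leb R N.+1 (normal_set X `&` [set y | t y <= r]).
Proof.
move=> mX; rewrite local_parallel_subsp hausdorff_isometric//.
have [s hs] := bounded_dist_le r hK.
rewrite (_ : [set y | 0 < dist K0 y /\ dist K0 y <= r /\ X (u y *m U)] =
    normal_set X `&` [set y | t y <= r]); last first.
  by apply/seteqP; split => y; [move=> [a [b c]]; split => //; split|move=> [[a b] c]].
apply: (@hausdorff_leb R N.+1 s) => //.
  by apply: measurableI; [exact: measurable_normal_set|exact: measurable_t_le].
by move=> y [_ /= /hs].
Qed.

(* outer normals in direction X along L and of slope in C off L *)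
Definition tilted_set (X : set (VB R d)) (C : set (VB R m)) : set (VB R d) :=
  [set v | [/\ enorm v = 1, v *m L != 0,
     X ((enorm (v *m L))^-1 *: (v *m L)) &
     C ((enorm (v *m L))^-1 *: (v *m W^T))]].

Lemma measurable_tilted_set X C : measurable X -> measurable C -> measurable (tilted_set X C).
Proof.
move=> mX mC.
have mL : measurable_fun setT (fun v : VB R d => v *m L : VB R d).
  exact: measurable_fun_mulmx.
have mi : measurable_fun setT (fun v : VB R d => (enorm (v *m L))^-1).
  by apply: (measurableT_comp (@measurable_inv R)); exact: measurable_fun_enorm.
rewrite (_ : tilted_set X C =
  ((fun v : VB R d => enorm v) @^-1` [set 1] `&`
   (fun v : VB R d => enorm (v *m L)) @^-1` `]0, +oo[) `&`
  ((fun v : VB R d => (enorm (v *m L))^-1 *: (v *m L) : VB R d) @^-1` X `&`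
   (fun v : VB R d => (enorm (v *m L))^-1 *: (v *m W^T) : VB R m) @^-1` C)).
  apply: measurableI; apply: measurableI.
  - by apply: preimage_measurable => //; exact: measurable_enorm.
  - by apply: preimage_measurable => //; exact: measurable_fun_enorm.
  - by apply: preimage_measurable mX; exact: measurable_funZ_VB.
  - by apply: preimage_measurable mC; apply: measurable_funZ_VB => //; exact: measurable_fun_mulmx.
apply/seteqP; split => v; rewrite /tilted_set /= in_itv/= andbT enorm_gt0.
  by case.
by move=> [[? ?] [? ?]].
Qed.

(** The outer normal is v = (t u + z) / D with D the distance. Its part in L has norm t / D, and
    dividing by this norm removes D: the normalized parts are u and z / t. *)
Let local_parallel_tilted r (X : set (VB R d)) (C : set (VB R m)) y z : 0 < r ->
  local_parallel setT K' r (tilted_set X C : set 'rV[R]_d) (y *m U + z *m W) <->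
  cone t (normal_set X) C r (y, z).
Proof.
move=> r0; rewrite local_parallel_setT /tilted_set /cone /normal_set /=.
rewrite -scalemxAl mulL -scalemxAl mulW.
set D := Num.sqrt _; rewrite -scalemxAl.
have nU : enorm ((y - nearest hK y) *m U) = dist K0 y by rewrite enorm_isometric// enorm_nearest.
have uE : u y *m U = (dist K0 y)^-1 *: ((y - nearest hK y) *m U) by rewrite -scalemxAl.
split.
  move=> [x0 xr _ [_ h2 h3 h4]].
  have D0 : 0 < D by rewrite sqrtr_gt0.
  have t0 : 0 < dist K0 y.
    rewrite lt_def dist_ge0// andbT -nU enorm_eq0; apply: contra h2 => /eqP ->.
    by rewrite scaler0.
  move: h3 h4; rewrite enormZ nU gtr0_norm ?invr_gt0// !scalerA invfM invrK.
  rewrite mulrAC mulfV ?gt_eqF// mul1r => h3 h4.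
  by split => //; split => //; rewrite uE.
move=> [[t0 Xu] Cz tr].
have x0 : 0 < dist K0 y ^+ 2 + enorm z ^+ 2 by rewrite ltr_pwDl ?exprn_gt0 ?sqr_ge0.
have D0 : 0 < D by rewrite sqrtr_gt0.
split => //; first exact: ltW.
rewrite enormZ nU gtr0_norm ?invr_gt0// !scalerA invfM invrK.
rewrite [D * _ * _]mulrAC mulfV ?gt_eqF// mul1r -uE; split => //.
  rewrite enormZ gtr0_norm ?invr_gt0//.
  rewrite (_ : enorm _ = D) ?mulVf ?gt_eqF//.
  by rewrite -[LHS]ger0_norm ?enorm_ge0// -sqrtr_sqr enorm_sum enorm_nearest.
  by rewrite scaler_eq0 invr_eq0 gt_eqF//= -enorm_eq0 nU gt_eqF.
by rewrite uE.
Qed.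

Lemma hausdorff_local_parallel_tilted r (X : set (VB R d)) (C : set (VB R m)) : 0 < r -> measurable X -> measurable C ->
  hausdorff d (local_parallel setT K' r (tilted_set X C : set 'rV[R]_d)) =
  (leb R N.+1 \x leb R m)%E (cone t (normal_set X) C r).
Proof.
move=> r0 mX mC.
have mS : measurable (cone t (normal_set X) C r).
  by apply: measurable_cone => //; exact: measurable_normal_set.
set S := cone t (normal_set X) C r in mS *.
pose P (x : VB R d) : VB R N.+1 * VB R m := (x *m U^T, x *m W^T).
have mP : measurable_fun setT P by apply: measurable_fun_pair; exact: measurable_fun_mulmx.
have E : (local_parallel setT K' r (tilted_set X C : set 'rV[R]_d) : set (VB R d)) = P @^-1` S.
  apply/seteqP; split => x; rewrite -[in X in X -> _](orth_sumK x) /=.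
    by move/(local_parallel_tilted X C _ _ r0).
  by rewrite orth_sumK => /(local_parallel_tilted X C _ _ r0); rewrite orth_sumK.
have mPS : measurable (P @^-1` S) := preimage_measurable mP mS.
have [s hs] := bounded_dist_le r hK.
rewrite E (@hausdorff_leb R d (s + r + 1))//; last 2 first.
- by rewrite dNm.
- move=> x [/= [ty _] _ h].
  have tr : dist K0 (x *m U^T) <= r.
    rewrite -(ler_pXn2r (n := 2)) ?nnegrE ?(ltW r0) ?dist_ge0// (le_trans _ h)// lerDl sqr_ge0//.
  have zr : enorm (x *m W^T) <= r.
    by rewrite -(ler_pXn2r (n := 2)) ?nnegrE ?(ltW r0) ?enorm_ge0// (le_trans _ h)// lerDr sqr_ge0.
  have ys := hs _ tr.
  rewrite /oball /= -[X in enorm X](orth_sumK (x : 'rV[R]_d)) (le_lt_trans (enormD _ _))//.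
  by rewrite (enorm_isometric _ hU) (enorm_isometric _ hW); lra.
rewrite (leb_orth_sum dNm hU hW UW mPS); congr (_ _).
by apply/seteqP; split => -[y z]; rewrite /P /orth_sum /= mulU mulW.
Qed.

Let normal_set_sphere (X : set (VB R d)) :
  normal_set (X `&` (@sphere R d `&` subsp L)) = normal_set X.
Proof.
apply/seteqP; split => y; rewrite /normal_set /=; first by move=> [? []].
move=> [y0 Xy]; split => //; split => //; split.
  by rewrite /sphere /= enorm_isometric// enorm_u.
by rewrite /subsp /= /L -mulmxA [U *m _]mulmxA hU mul1mx.
Qed.

Let measure_sphere_subsp (mu : {measure set (VB R d) -> \bar R}) (X : set (VB R d)) :
  mu (~` (@sphere R d `&` subsp L) : set (VB R d)) = 0%E -> measurable X ->
  mu X = mu (X `&` (@sphere R d `&` subsp L)).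
Proof.
move=> mu0 mX.
have mS := measurable_sphere_subsp L; have mC := measurableC mS.
apply/eqP; rewrite eq_le; apply/andP; split; last first.
  by apply: le_measure; rewrite ?inE//; exact: measurableI.
apply: (@le_trans _ _ (mu (X `&` (@sphere R d `&` subsp L) `|` ~` (@sphere R d `&` subsp L)))).
  apply: le_measure; rewrite ?inE//; first by apply: measurableU => //; exact: measurableI.
  by move=> v Xv; have [h|h] := pselect ((@sphere R d `&` subsp L) v); [left|right].
apply: (le_trans (measureU2 _ (measurableI _ _ mX mS) mC)).
by rewrite [X in (_ + X)%E]mu0 adde0.
Qed.

(** The volume polynomial has N + 1 coefficients, the Steiner formula in R^d has d; padding by zeros
    makes them comparable. *)
Let extend_sum (b : nat -> R) (r : R) :
  \sum_(i < N.+1) r ^+ (N.+1 + m - i) * b i =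
  \sum_(i < d) r ^+ (d - i) * (if (i < N.+1)%N then b i else 0).
Proof.
have Nd : (N.+1 <= d)%N by rewrite dNm leq_addr.
rewrite (big_ord_widen d (fun i => r ^+ (N.+1 + m - i) * b i) Nd).
rewrite big_mkcond; apply: eq_bigr => i _; rewrite -dNm.
by case: ifP => //; rewrite mulr0.
Qed.

Let Nd : (N < d)%N. Proof. by rewrite dNm; lia. Qed.

Let kappa_neq0 k : kappa R k != 0.
Proof. by rewrite gt_eqF// kappa_gt0. Qed.

(** The coefficient of r^(m+1) is kappa_(m+1) times the area measure in R^d on one side, and kappa_1
    = 2 times the area measure within L times [gnomonic C] on the other. *)
Lemma area_measure_tilted (mu mu' : {measure set (VB R d) -> \bar R})
    (X : set (VB R d)) (C : set (VB R m)) :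
  is_area_measure d setT K' N mu -> is_area_measure N.+1 (subsp L) K' N mu' ->
  measurable X -> measurable C ->
  mu (tilted_set X C) = (mu' X * ((2 / kappa R m.+1)%:E * gnomonic C))%E.
Proof.
move=> [_ [Phi [muE hPhi]]] [mu'0 [Phi' [mu'E hPhi']]] mX mC.
pose X1 := X `&` (@sphere R d `&` subsp L).
have mX1 : measurable X1 by apply: measurableI => //; exact: measurable_sphere_subsp.
have X1S : X1 `<=` @sphere R d `&` subsp L by move=> v [].
pose g i := kappa R (N.+1 - i) * Phi' i X1.
have hG s : 0 < s -> leb R N.+1 (normal_set X `&` [set y | t y <= s]) =
    (\sum_(i < N.+1) s ^+ (N.+1 - i) * g i)%:E.
  move=> s0; rewrite -(normal_set_sphere X) -hausdorff_local_parallel_subsp// hPhi'//.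
  by congr EFin; apply: eq_bigr => i _; rewrite /g mulrA.
have [b [bN hb]] := measure_cone_polynomial mt (measurable_normal_set mX) (fun y h => h.1) m0 mC hG.
have mB := measurable_tilted_set mX mC.
have BS : (tilted_set X C : set 'rV[R]_d) `<=` @sphere R d `&` setT by move=> v [].
have h r : 0 < r -> \sum_(i < d) r ^+ (d - i) * (kappa R (d - i) * Phi i (tilted_set X C)) =
    \sum_(i < d) r ^+ (d - i) * (if (i < N.+1)%N then b i else 0).
  move=> r0; rewrite -extend_sum; apply: EFin_inj; rewrite -hb//.
  rewrite -(hausdorff_local_parallel_tilted r0 mX mC) hPhi//.
  by congr EFin; apply: eq_bigr => i _; rewrite mulrA.
have := @polynomial_coef_unique R d (fun i => kappa R (d - i) * Phi i (tilted_set X C))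
  (fun i => if (i < N.+1)%N then b i else 0) h N Nd; rewrite ltnSn bN /g.
have -> : (d - N = m.+1)%N by rewrite dNm; lia.
have -> : (N.+1 - N = 1)%N by lia.
move=> e; rewrite muE// (measure_sphere_subsp mu'0 mX) mu'E//.
have gfin : gnomonic C \is a fin_num.
  rewrite ge0_fin_numE ?measure_ge0//; apply: le_lt_trans (gnomonic_lty R m).
  by apply: le_measure; rewrite ?inE.
rewrite -[gnomonic C]fineK// -!EFinM; congr EFin.
by apply: (mulfI (kappa_neq0 m.+1)); rewrite e /=; field; exact: kappa_neq0 m.+1.
Qed.

(** A normal orthogonal to L occurs exactly at points lying over the projected body itself. Their
    volume up to distance r is a multiple of r^m, which belongs to the index N + 1, so the
    coefficient of index N is 0. *)
Lemma area_measure_perp (mu : {measure set (VB R d) -> \bar R}) :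
  is_area_measure d setT K' N mu ->
  mu [set v : VB R d | enorm v = 1 /\ v *m L = 0] = 0%E.
Proof.
move=> [_ [Phi [muE hPhi]]]; set B := [set v | _].
have mB : measurable B.
  rewrite (_ : B = (fun v : VB R d => enorm v) @^-1` [set 1] `&`
     (fun v : VB R d => enorm (v *m L)) @^-1` [set 0]).
    apply: measurableI; apply: preimage_measurable => //; apply: measurable_fun_enorm => //.
    exact: measurable_fun_mulmx.
  apply/seteqP; split => v; rewrite /B /=; first by move=> [-> ->]; rewrite enorm0.
  by move=> [? /eqP]; rewrite enorm_eq0 => /eqP.
have BS : (B : set 'rV[R]_d) `<=` @sphere R d `&` setT by move=> v [].
pose Z : set (VB R N.+1) := t @^-1` [set 0].
have mZ : measurable Z by apply: preimage_measurable => //; exact: mt.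
have [s0 hs0] := bounded_dist_le 0 hK.
have [a aE] : exists a, leb R N.+1 Z = a%:E.
  exists (fine (leb R N.+1 Z)); rewrite fineK// ge0_fin_numE ?measure_ge0//.
  apply: le_lt_trans (leb_oball_lty _ s0); apply: le_measure; rewrite ?inE//.
    by apply: open_measurable_VB; exact: open_oball.
  by move=> y; rewrite /Z /t /= => y0; apply: hs0; rewrite y0.
have LPE r : 0 < r -> hausdorff d (local_parallel setT K' r (B : set 'rV[R]_d)) =
    (a * (r ^+ m * vball R m))%:E.
  move=> r0.
  (* The centre of the ball is removed because a local parallel set contains only points at positive
     distance; it is a null set since m is positive. *)
  pose S : set (VB R N.+1 * VB R m) := Z `*` (eball m r `\` eball m 0).
  have mS : measurable S.
    by apply: measurableX => //; apply: measurableD; exact: measurable_eball.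
  pose P (x : VB R d) : VB R N.+1 * VB R m := (x *m U^T, x *m W^T).
  have mP : measurable_fun setT P by apply: measurable_fun_pair; exact: measurable_fun_mulmx.
  have key (y : 'rV[R]_N.+1) (z : 'rV[R]_m) :
      local_parallel setT K' r (B : set 'rV[R]_d) (y *m U + z *m W) <-> S (y, z).
    rewrite local_parallel_setT /S /Z /t /B /eball /= -scalemxAl mulL.
    split.
      move=> [x0 xr _ [h1 h2]].
      have y0 : dist K0 y = 0.
        apply/eqP; rewrite -(enorm_nearest hK y) -(enorm_isometric _ hU) enorm_eq0.
        by move/eqP: h2; rewrite scaler_eq0 invr_eq0 gt_eqF ?sqrtr_gt0.
      rewrite y0 expr0n add0r in x0 xr; split => //; split.
        by rewrite -(ler_pXn2r (n := 2)) ?nnegrE ?enorm_ge0// ltW.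
      by apply/negP; rewrite -ltNge lt_def enorm_ge0 andbT; apply: contraTneq x0 => ->; rewrite expr0n ltxx.
    move=> [y0 [zr /negP]]; rewrite -ltNge => z0.
    have ny : (y - nearest hK y) = 0 by apply/eqP; rewrite -enorm_eq0 enorm_nearest y0.
    rewrite y0 expr0n add0r ny mul0mx scaler0 add0r sqrtr_sqr ger0_norm ?enorm_ge0//; split => //.
    - by rewrite exprn_gt0.
    - by rewrite ler_pXn2r ?nnegrE ?enorm_ge0// ltW.
    - exact: ltW.
    - split => //; rewrite enormZ (enorm_isometric _ hW) ger0_norm ?invr_ge0 ?enorm_ge0//.
      by rewrite mulVf// gt_eqF.
  have E : (local_parallel setT K' r (B : set 'rV[R]_d) : set (VB R d)) = P @^-1` S.
    apply/seteqP; split => x; rewrite -[in X in X -> _](orth_sumK x).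
      by move/key.
    by rewrite orth_sumK => /key; rewrite orth_sumK.
  have mPS : measurable (P @^-1` S) := preimage_measurable mP mS.
  rewrite E (@hausdorff_leb R d (s0 + r + 1))//; last 2 first.
  - by rewrite dNm.
  - move=> x [/= ty [zr _]].
    have ys : enorm (x *m U^T) < s0 by apply: hs0; rewrite [dist _ _]ty.
    rewrite /oball /= -[X in enorm X](orth_sumK (x : 'rV[R]_d)) (le_lt_trans (enormD _ _))//.
    by rewrite (enorm_isometric _ hU) (enorm_isometric _ hW); rewrite /eball /= in zr; lra.
  rewrite (leb_orth_sum dNm hU hW UW mPS).
  rewrite (_ : orth_sum U W @^-1` _ = S); last first.
    by apply/seteqP; split => -[y z]; rewrite /P /orth_sum /= mulU mulW.
  rewrite product_measure1E//; last by apply: measurableD; exact: measurable_eball.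
  rewrite EFinM; congr (_ * _)%E; first exact: aE.
  have e1 := @leb_eball R m r r0; have e2 := @leb_eball_ge0 R m 0 (lexx 0).
  rewrite expr0n gtn_eqF// mul0r in e2.
  rewrite measureD; [|exact: measurable_eball|exact: measurable_eball|by rewrite [X in (X < _)%E]e1 ltry].
  rewrite [X in (X - _)%E]e1 [X in (_ - X)%E](_ : _ = 0%E) ?sube0//.
  apply/eqP; rewrite -measure_le0 -[leRHS]e2; apply: le_measure; rewrite ?inE.
  - by apply: measurableI; exact: measurable_eball.
  - exact: measurable_eball.
  - by move=> z [].
have h r : 0 < r -> \sum_(i < d) r ^+ (d - i) * (kappa R (d - i) * Phi i B) =
    \sum_(i < d) r ^+ (d - i) * (if i == N.+1 :> nat then a * vball R m else 0).
  move=> r0; transitivity (a * (r ^+ m * vball R m)).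
    by apply: EFin_inj; rewrite -LPE// hPhi//; congr EFin; apply: eq_bigr => i _; rewrite mulrA.
  have Nd1 : (N.+1 < d)%N by rewrite dNm; lia.
  rewrite (bigD1 (Ordinal Nd1))//= eqxx big1 ?addr0; last first.
    by move=> i /eqP iN; case: eqP => [e|_]; [case: iN; apply: val_inj|rewrite mulr0].
  have -> : (d - N.+1 = m)%N by rewrite dNm; lia.
  by rewrite mulrCA.
have := @polynomial_coef_unique R d (fun i => kappa R (d - i) * Phi i B)
  (fun i => if i == N.+1 then a * vball R m else 0) h N Nd; rewrite (_ : (N == N.+1) = false); last by apply/eqP; lia.
move=> /eqP; rewrite mulf_eq0 (negbTE (kappa_neq0 _)) /= => /eqP e.
by rewrite muE// e.
Qed.

(** The map y to - y preserves [K0] and Lebesgue measure and reverses outer normals, so X and its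
    reflection have the same Steiner polynomial. *)
Lemma area_measure_even (mu' : {measure set (VB R d) -> \bar R}) (X : set (VB R d)) :
  origin_symmetric K0 -> is_area_measure N.+1 (subsp L) K' N mu' -> measurable X ->
  mu' [set v : VB R d | X (- (v : 'rV[R]_d))] = mu' X.
Proof.
move=> sK [mu'0 [Phi' [mu'E hPhi']]] mX.
have mNX := measurable_opp_VB mX.
set NX := [set v | _] in mNX *.
have KN y : K0 y -> K0 (- y) by move=> Ky; rewrite -sK; exists y.
have uN y : u (- y) = - u y.
  rewrite /u origin_symmetric_dist//.
  have <- : - nearest hK y = nearest hK (- y).
    apply: nearest_unique; first by apply: KN; exact: nearest_in.
    by rewrite -opprD enormN enorm_nearest origin_symmetric_dist.
  by rewrite -opprD scalerN.
have nE (Y : set (VB R d)) : measurable Y -> forall s, leb R N.+1 (normal_set [set v : VB R d | Y (- (v : 'rV[R]_d))]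
      `&` [set y | t y <= s]) =
    leb R N.+1 (normal_set Y `&` [set y | t y <= s]).
  move=> mY s; rewrite -[RHS]lebN.
    congr (leb _ _ _); apply/seteqP; split => y; rewrite /normal_set /t /= origin_symmetric_dist// uN mulNmx//.
  by apply: measurableI; [exact: measurable_normal_set|exact: measurable_t_le].
have mS := measurable_sphere_subsp L.
rewrite (measure_sphere_subsp mu'0 mX) (measure_sphere_subsp mu'0 mNX).
have mX1 := measurableI _ _ mX mS; have mNX1 := measurableI _ _ mNX mS.
have X1S (Y : set (VB R d)) : Y `&` (@sphere R d `&` subsp L) `<=` @sphere R d `&` subsp L by move=> v [].
rewrite !mu'E//; congr EFin.
have h r : 0 < r ->
   \sum_(i < N.+1) r ^+ (N.+1 - i) * (kappa R (N.+1 - i) * Phi' i (NX `&` (@sphere R d `&` subsp L))) =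
   \sum_(i < N.+1) r ^+ (N.+1 - i) * (kappa R (N.+1 - i) * Phi' i (X `&` (@sphere R d `&` subsp L))).
  move=> r0; apply: EFin_inj.
  transitivity (hausdorff N.+1 (local_parallel (subsp L) K' r (NX `&` (@sphere R d `&` subsp L)))).
    by rewrite hPhi'//; congr EFin; apply: eq_bigr => i _; rewrite mulrA.
  transitivity (hausdorff N.+1 (local_parallel (subsp L) K' r (X `&` (@sphere R d `&` subsp L)))).
    by rewrite !hausdorff_local_parallel_subsp// !normal_set_sphere nE.
  by rewrite hPhi'//; congr EFin; apply: eq_bigr => i _; rewrite mulrA.
by have := @polynomial_coef_unique R N.+1
  (fun i => kappa R (N.+1 - i) * Phi' i (NX `&` (@sphere R d `&` subsp L)))
  (fun i => kappa R (N.+1 - i) * Phi' i (X `&` (@sphere R d `&` subsp L)))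
  h N (ltnSn N) => /(mulfI (kappa_neq0 _)).
Qed.

End area_measures.

(** * Uniformly distributed measures *)

Section uniform_distribution.
Variables (R : realType) (n : nat).
Implicit Types (r : R) (S X G : set (VB R n)).

Definition open_ball (x : VB R n) r : set (VB R n) :=
  [set y : VB R n | enorm ((x : 'rV[R]_n) - (y : 'rV[R]_n)) < r].

Lemma open_open_ball x r : open (open_ball x r : set 'rV[R]_n).
Proof.
rewrite (_ : (open_ball x r : set 'rV[R]_n) = ~` [set y | r <= enorm (y - x)]).
  by apply: closed_openC; exact: closed_enorm_ge.
by apply/seteqP; split => y /=; rewrite /open_ball /= enormBC ltNge => /negP.
Qed.

Lemma measurable_open_ball x r : measurable (open_ball x r).
Proof. by apply: open_measurable_VB; exact: open_open_ball. Qed.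

(** The common value may depend on the radius and on the measure; that two normalized measures share
    it is part of the proof of uniqueness. *)
Definition equal_ball_measures S (mu : set (VB R n) -> \bar R) :=
  mu (~` S) = 0%E /\ forall r, 0 < r -> exists a : \bar R, forall x, S x -> mu (open_ball x r) = a.

Lemma measurable_near X r : measurable X ->
  measurable ([set p | X p.1 /\ enorm ((p.1 : 'rV[R]_n) - (p.2 : 'rV[R]_n)) < r]
    : set (VB R n * VB R n)).
Proof.
move=> mX; set E : set (VB R n * VB R n) := [set p | _].
rewrite (_ : E = fst @^-1` X `&` (fun p : VB R n * VB R n =>
   enorm ((p.1 : 'rV[R]_n) - (p.2 : 'rV[R]_n))) @^-1` `]-oo, r[).
  apply: measurableI; first exact: preimage_measurable (measurable_fst) mX.
  apply: preimage_measurable => //; apply: measurable_fun_enorm.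
  by apply: measurable_funD_VB => //; apply: measurable_funN_VB.
by apply/seteqP; split => p; rewrite /E /= in_itv/=.
Qed.

Lemma product_measure_near S X (mu nu : {sigma_finite_measure set (VB R n) -> \bar R}) r a :
  measurable S -> measurable X -> mu (~` S) = 0%E -> (0 <= a)%E ->
  (forall x, S x -> nu (open_ball x r) = a) ->
  (mu \x nu)%E [set p | X p.1 /\ enorm ((p.1 : 'rV[R]_n) - (p.2 : 'rV[R]_n)) < r] = (a * mu X)%E.
Proof.
move=> mS mX mu0 a0 nua.
set E : set (VB R n * VB R n) := [set p | _].
have mE : measurable E := measurable_near r mX.
have mf := measurable_fun_xsection nu mE.
rewrite /product_measure1 -integral_cst// [RHS]integral_mkcond /=.
apply: ge0_ae_eq_integral => //.
- apply/measurable_restrict => //; exact: measurable_cst.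
- by move=> x _; rewrite patchE; case: ifP.
exists (~` S); split => //; first exact: measurableC.
move=> x /= h Sx; apply: h => _; rewrite patchE; case: ifPn => xX.
  rewrite /= -(nua x Sx); congr (nu _); apply/seteqP; split => y; rewrite /xsection /= inE /E /open_ball /=.
    by case.
  by move=> h; split => //; exact: set_mem.
rewrite (_ : xsection E x = set0) ?measure0//; apply/seteqP; split => // y.
rewrite /xsection /= inE => -[/= Xx _]; move/negP: xX; apply; exact: mem_set.
Qed.

(** Otherwise countably many null balls, one for each small dyadic cube that meets S, would cover
    S. *)
Lemma equal_ball_measures_gt0 S (mu : {measure set (VB R n) -> \bar R}) r :
  measurable S -> (0 < mu setT)%E -> mu (~` S) = 0%E -> 0 < r ->
  exists2 x, S x & (0 < mu (open_ball x r))%E.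
Proof.
move=> mS mu0 muS r0; apply: contrapT => h.
have hx x : S x -> mu (open_ball x r) = 0%E.
  by move=> Sx; apply/eqP; rewrite -measure_le0 leNgt; apply/negP => hx; apply: h; exists x.
have [k hk] : exists k : nat, n%:R / 2 ^+ k < r.
  by have [k hk] := exists_small_dyadic n r0; exists k; apply: hk.
pose F (i : nat) : set (VB R n) := if unpickle i is Some z then S `&` dyadic_cube k z else set0.
have nF : mu.-negligible (\bigcup_i F i).
  apply: negligible_bigcup => i; rewrite /F; case: unpickle => [z|]; last exact: negligible_set0.
  have [[x [Sx xz]]|e] := pselect (S `&` dyadic_cube k z !=set0).
    exists (open_ball x r); split; [exact: measurable_open_ball|exact: hx|].
    move=> y [_ yz]; rewrite /open_ball /=; apply: le_lt_trans hk.
    by apply: dyadic_index_close; rewrite xz yz.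
  rewrite (_ : _ `&` _ = set0); first exact: negligible_set0.
  by apply/seteqP; split => // x Sx; apply: e; exists x.
have : mu.-negligible (~` S `|` \bigcup_i F i).
  by apply: negligibleU => //; exists (~` S); split => //; exact: measurableC.
rewrite (_ : _ `|` _ = setT).
  by move/negligibleP => /(_ measurableT) e; rewrite e ltxx in mu0.
apply/seteqP; split => // x _; have [Sx|] := pselect (S x); last by left.
by right; exists (pickle (dyadic_index k (x : 'rV[R]_n))) => //; rewrite /F pickleK.
Qed.

(* Fubini for the set of the (x, y) with |x - y| < r *)
Lemma le_near_measure S X Y (mu nu : {sigma_finite_measure set (VB R n) -> \bar R}) r a b :
  measurable S -> measurable X -> measurable Y -> mu (~` S) = 0%E -> nu (~` S) = 0%E ->
  (0 <= a)%E -> (0 <= b)%E ->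
  (forall x, S x -> mu (open_ball x r) = a) -> (forall x, S x -> nu (open_ball x r) = b) ->
  (forall x, X x -> open_ball x r `<=` Y) -> (b * mu X <= a * nu Y)%E.
Proof.
move=> mS mX mY muS nuS a0 b0 ha hb XY.
rewrite -(product_measure_near mS mX muS b0 hb) -(product_measure_near mS mY nuS a0 ha).
set E : set (VB R n * VB R n) := [set p | _]; set F : set (VB R n * VB R n) := [set p | _].
have mE := measurable_near r mX : measurable E.
have mF := measurable_near r mY : measurable F.
rewrite {1}/product_measure1 product_measure_swap//.
apply: ge0_le_integral => //.
- exact: measurable_fun_ysection.
- exact: measurable_fun_xsection.
move=> y _; apply: le_measure; rewrite ?inE.
- exact: measurable_ysection.
- exact: measurable_xsection.
move=> x; rewrite /ysection /xsection /= !inE /E /F /= => -[Xx xy]; split; last by rewrite enormBC.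
exact: XY Xx _ xy.
Qed.

Section uniqueness.
Variables (S : set (VB R n)) (mS : measurable S).

(** Applied to the whole space in both orders, [le_near_measure] shows that the two ball values a
    and b agree. Applied to the points whose r-ball lies in G, it then gives mu (Gk k) <= nu G after
    cancelling the positive value a; as r tends to 0 these sets exhaust G. *)
Let le_open (mu nu : {sigma_finite_measure set (VB R n) -> \bar R}) (G : set 'rV[R]_n) :
  mu setT = 1%E -> nu setT = 1%E ->
  equal_ball_measures S mu -> equal_ball_measures S nu -> open G -> (mu G <= nu G)%E.
Proof.
move=> muT nuT [muS hmu] [nuS hnu] oG.
have mG : measurable (G : set (VB R n)) by exact: open_measurable_VB.
pose Gk (k : nat) : set (VB R n) := [set x | open_ball x k.+1%:R^-1 `<=` G].
have mGk k : measurable (Gk k).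
  rewrite -(setCK (Gk k)); apply: measurableC; apply: open_measurable_VB.
  rewrite (_ : ~` Gk k = \bigcup_(y in ~` G) open_ball y k.+1%:R^-1).
    by apply: bigcup_open => y _; exact: open_open_ball.
  apply/seteqP; split => x.
    move=> /existsNP[y /not_implyP[xy Gy]]; exists y => //.
    by move: xy; rewrite /open_ball /= enormBC.
  by move=> [y Gy yx] h; apply: Gy; apply: h; move: yx; rewrite /open_ball /= enormBC.
have GE : \bigcup_k Gk k = G.
  apply/seteqP; split => x.
    by move=> [k _ h]; apply: h; rewrite /open_ball /= subrr enorm0 invr_gt0 ltr0n.
  move=> Gx; have /nbhs_ballP[e /= e0 he] := open_nbhs_nbhs (conj oG Gx).
  have [k ke] : exists k : nat, k.+1%:R^-1 < e.
    exists (Num.truncn e^-1); rewrite -[ltRHS]invrK ltf_pV2 ?posrE ?invr_gt0 ?ltr0n//.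
    exact: truncnS_gt.
  exists k => // y xy; apply: he; rewrite -ball_normE /=; apply: le_lt_trans ke.
  by apply: le_trans (mxnorm_le_enorm _) _; exact: ltW.
have le_k k : (mu (Gk k) <= nu G)%E.
  set r : R := k.+1%:R^-1; have r0 : 0 < r by rewrite invr_gt0 ltr0n.
  have [a ha] := hmu r r0; have [b hb] := hnu r r0.
  have muT0 : (0 < mu setT)%E by rewrite muT lte01.
  have [x Sx x0] := equal_ball_measures_gt0 mS muT0 muS r0.
  have a0 : (0 < a)%E by rewrite -(ha x Sx).
  have b0 : (0 <= b)%E by rewrite -(hb x Sx).
  have an : a \is a fin_num.
    rewrite ge0_fin_numE ?(ltW a0)// -(ha x Sx); apply: (@le_lt_trans _ _ (mu setT)).
      by apply: le_measure; rewrite ?inE//; exact: measurable_open_ball.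
    by rewrite muT ltry.
  have h1 := le_near_measure mS (mGk k) mG muS nuS (ltW a0) b0 ha hb (fun x h => h).
  have h2 := le_near_measure mS measurableT measurableT muS nuS (ltW a0) b0 ha hb (fun _ _ _ _ => I).
  have h3 := le_near_measure mS measurableT measurableT nuS muS b0 (ltW a0) hb ha (fun _ _ _ _ => I).
  have ab : a = b.
    by apply/eqP; rewrite eq_le; move: h2 h3; rewrite muT nuT !mule1 => -> ->.
  by move: h1; rewrite -ab lee_pmul2l.
have cv : (mu \o Gk) x @[x --> \oo] --> mu G.
  rewrite -GE; apply: nondecreasing_cvg_mu => //; first by rewrite GE.
  move=> k l kl; apply/subsetPset => x; apply: subset_trans => y; rewrite /open_ball /= => h.
  by apply: lt_le_trans h _; rewrite lef_pV2 ?posrE ?ltr0n// ler_nat ltnS.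
rewrite -(cvg_lim _ cv)//; apply: lime_le; first by apply/cvg_ex; exists (mu G).
by apply: nearW => k; exact: le_k.
Qed.

Lemma equal_ball_measures_unique (mu nu : {sigma_finite_measure set (VB R n) -> \bar R}) A :
  mu setT = 1%E -> nu setT = 1%E ->
  equal_ball_measures S mu -> equal_ball_measures S nu -> measurable A -> mu A = nu A.
Proof.
move=> muT nuT hmu hnu mA.
apply: (@measure_unique _ R (VB R n) (@open 'rV[R]_n) (fun=> setT)) => //.
- by move=> U V; exact: openI.
- by move=> _; exact: openT.
- by apply/seteqP; split => // x _; exists 0%N.
- by move=> U oU; apply/eqP; rewrite eq_le !le_open.
- by move=> _; rewrite [X in (X < _)%E]muT ltry.
Qed.

End uniqueness.
End uniform_distribution.

(** * Orthogonal projections and rotations *)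

Section orthogonal_projections.
Variables (R : realType) (d : nat).
Implicit Types (P : 'M[R]_d) (x y w : 'rV[R]_d).

Lemma rank_isometric k (U : 'M[R]_(k, d)) : isometric U -> \rank (U^T *m U) = k.
Proof.
move=> hU; apply/eqP; rewrite eqn_leq; apply/andP; split.
  by rewrite (leq_trans (mulmx_max_rank _ _)).
rewrite -[leqLHS](mxrank1 R).
rewrite (_ : 1%:M = U *m (U^T *m U) *m U^T); last by rewrite !mulmxA hU mul1mx hU.
by rewrite (leq_trans (mxrankM_maxl _ _))// mxrankM_maxr.
Qed.

(** Induction on the rank: a nonzero row of P is fixed by P, and subtracting the projection onto its
    line leaves an orthogonal projection that kills it, hence of smaller rank. *)
Lemma projection_basis P : P^T = P -> P *m P = P ->
  exists k (U : 'M[R]_(k, d)), isometric U /\ P = U^T *m U.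
Proof.
have [n] := ubnP (\rank P); elim: n P => // n IH P rP sP iP.
have [->|P0] := eqVneq P 0.
  by exists 0%N, 0; split; [apply/matrixP => -[]|rewrite mulmx0].
have [i ri] : exists i, row i P != 0.
  apply: contrapT => /forallNP h; move/eqP: P0; apply; apply/row_matrixP => i.
  by rewrite row0; apply/eqP/negPn/negP; exact: h.
pose u : 'rV[R]_d := (enorm (row i P))^-1 *: row i P.
have u1 : enorm u = 1 by rewrite enormZ gtr0_norm ?invr_gt0 ?enorm_gt0// mulVf// enorm_eq0.
have uP : u *m P = u by rewrite -scalemxAl -row_mul iP.
have Pu : P *m u^T = u^T by rewrite -[P]sP -trmx_mul uP.
have uu : u *m u^T = 1%:M by rewrite [LHS]mx11_scalar -dotE -enorm_sqr u1 expr1n.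
pose P1 := P - u^T *m u.
have sP1 : P1^T = P1 by rewrite /P1 linearB /= sP trmx_mul trmxK.
have uP1 : u *m P1 = 0 by rewrite mulmxBr uP mulmxA uu mul1mx subrr.
have P1P : P1 *m P = P1 by rewrite mulmxBl iP -mulmxA uP.
have iP1 : P1 *m P1 = P1.
  by rewrite {2}/P1 mulmxBr P1P mulmxA -[P1 *m u^T]trmxK trmx_mul trmxK sP1 uP1 trmx0 mul0mx subr0.
have rP1 : (\rank P1 < n)%N.
  rewrite (leq_trans _ (_ : \rank P <= n)%N)// rank_ltmx// ltmxE -{1}P1P submxMl /=.
  apply/negP => h; have /submxP[z zE] : (u <= P1)%MS by rewrite -uP (submx_trans _ h)// submxMl.
  move: u1; rewrite (_ : u = 0) ?enorm0; first by move/esym/eqP; rewrite oner_eq0.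
  by rewrite -uP1 zE -mulmxA iP1.
have [k [U [hU P1E]]] := IH _ rP1 sP1 iP1.
have Uu : U *m u^T = 0.
  by rewrite -[U]mul1mx -hU -mulmxA -mulmxA [U^T *m _]mulmxA -P1E -[P1 *m u^T]trmxK trmx_mul trmxK sP1 uP1 trmx0 mulmx0.
exists (k + 1)%N, (col_mx U u); split.
  rewrite /isometric tr_col_mx mul_col_row hU uu Uu -[u *m U^T]trmxK trmx_mul trmxK Uu trmx0.
  by rewrite -scalar_mx_block.
by rewrite tr_col_mx mul_row_col -P1E subrK.
Qed.

Lemma Grass_basis k P : Grass k P -> exists U : 'M[R]_(k, d), isometric U /\ P = U^T *m U.
Proof.
move=> [sP [iP rP]]; have [l [U [hU PE]]] := projection_basis sP iP.
have kl : l = k by rewrite -rP PE rank_isometric.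
by subst l; exists U.
Qed.

Lemma isometric_Grass k (U : 'M[R]_(k, d)) : isometric U -> Grass k (U^T *m U).
Proof.
move=> hU; split; first by rewrite trmx_mul trmxK.
split; last exact: rank_isometric.
by rewrite mulmxA -[U^T *m U *m U^T]mulmxA hU mulmx1.
Qed.

Lemma Grass_orthonormal_bases k P : Grass k P ->
  exists (U : 'M[R]_(k, d)) (W : 'M[R]_(d - k, d)),
    [/\ isometric U, isometric W, U *m W^T = 0, P = U^T *m U & 1%:M - P = W^T *m W].
Proof.
move=> gP; have [U [hU PE]] := Grass_basis gP; have [sP [iP rP]] := gP.
have [|| l [W [hW QE]]] := @projection_basis (1%:M - P).
- by rewrite linearB /= trmx1 sP.
- by rewrite mulmxBl mul1mx mulmxBr mulmx1 iP subrr subr0.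
have UW : U *m W^T = 0.
  have UP : U *m P = U by rewrite PE mulmxA hU mul1mx.
  have QW : (1%:M - P) *m W^T = W^T by rewrite QE -mulmxA hW mulmx1.
  by rewrite -UP -QW mulmxA -[U *m P *m _]mulmxA mulmxBr mulmx1 iP subrr mulmx0 mul0mx.
have hUW : isometric (col_mx U W).
  rewrite /isometric tr_col_mx mul_col_row hU hW UW -[W *m U^T]trmxK trmx_mul trmxK UW trmx0.
  by rewrite -scalar_mx_block.
have kl : d = (k + l)%N.
  rewrite -(rank_isometric hUW) tr_col_mx mul_row_col -PE -QE addrC subrK.
  by rewrite mxrank1.
have -> : (d - k)%N = l by lia.
by exists U, W; split.
Qed.

Definition reflection w : 'M[R]_d := 1%:M - 2 *: (w^T *m w).

Lemma tr_reflection w : (reflection w)^T = reflection w.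
Proof. by rewrite /reflection linearB linearZ /= trmx1 trmx_mul trmxK. Qed.

Lemma mulmx_reflection x w : x *m reflection w = x - (2 * dot x w) *: w.
Proof.
rewrite /reflection mulmxBr mulmx1 -scalemxAr mulmxA [x *m w^T]mx11_scalar -dotE.
by rewrite mul_scalar_mx scalerA.
Qed.

Lemma mul_col_row_dot w : enorm w = 1 -> w *m w^T = 1%:M.
Proof. by move=> w1; rewrite [LHS]mx11_scalar -dotE -enorm_sqr w1 expr1n. Qed.

Lemma reflectionK w : enorm w = 1 -> reflection w *m reflection w = 1%:M.
Proof.
move=> w1; rewrite {2}/reflection mulmxBr mulmx1 -scalemxAr mulmxA.
rewrite (_ : reflection w *m w^T = - w^T); last first.
  rewrite -[reflection w]tr_reflection -trmx_mul mulmx_reflection -enorm_sqr w1 expr1n mulr1.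
  by rewrite (_ : w - 2 *: w = - w) ?linearN// scaler_nat mulr2n opprD addrA subrr sub0r.
by rewrite mulNmx scalerN opprK /reflection subrK.
Qed.

(** The matrix determinant lemma: M N and N M are block triangular, one with diagonal block 1 + x^T
    y and the other with diagonal block 1 + y x^T. *)
Lemma det_rank_one_update x y : \det (1%:M + x^T *m y) = 1 + dot y x.
Proof.
pose M := block_mx (1%:M : 'M[R]_1) y (- x^T) 1%:M.
pose N := block_mx (1%:M : 'M[R]_1) (- y) 0 (1%:M : 'M[R]_d).
have dN : \det N = 1 by rewrite det_ublock !det1 mulr1.
have MN : M *m N = block_mx 1%:M 0 (- x^T) (1%:M + x^T *m y).
  rewrite mulmx_block !mulmx1 !mul1mx !mulmx0 !addr0 addrC subrr; congr block_mx.
  by rewrite mulNmx mulmxN opprK addrC.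
have NM : N *m M = block_mx (1%:M + y *m x^T) 0 (- x^T) 1%:M.
  by rewrite mulmx_block !mulmx1 !mul1mx !mul0mx !add0r mulNmx mulmxN opprK subrr.
transitivity (\det (M *m N)); first by rewrite MN det_lblock det1 mul1r.
rewrite det_mulmx mulrC -det_mulmx NM det_lblock det1 mulr1.
by rewrite det_mx11 !mxE eqxx dotE mxE.
Qed.

Lemma det_reflection w : enorm w = 1 -> \det (reflection w) = -1.
Proof.
move=> w1; have := det_rank_one_update (- 2 *: w) w.
rewrite linearZ /= -scalemxAl scaleNr => ->.
by rewrite dotZr -enorm_sqr w1 expr1n mulr1 -[2]/(1 + 1) opprD addNKr.
Qed.

Lemma enorm_normalize x : x != 0 -> enorm ((enorm x)^-1 *: x) = 1.
Proof.
by rewrite -enorm_gt0 => x0; rewrite enormZ gtr0_norm ?invr_gt0// mulVf// gt_eqF.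
Qed.

Lemma reflection_swap x y : enorm x = 1 -> enorm y = 1 -> x != y ->
  x *m reflection ((enorm (x - y))^-1 *: (x - y)) = y.
Proof.
move=> x1 y1 xy; have n0 : 0 < enorm (x - y) by rewrite enorm_gt0 subr_eq0.
rewrite mulmx_reflection dotZr scalerA.
have -> : 2 * ((enorm (x - y))^-1 * dot x (x - y)) * (enorm (x - y))^-1 = 1.
  have -> : dot x (x - y) = enorm (x - y) ^+ 2 / 2.
    by rewrite enorm_sqr dotBl !dotBr -!enorm_sqr x1 y1 [dot y x]dotC !expr1n; field.
  by field; rewrite gt_eqF.
by rewrite scale1r opprB addrC subrK.
Qed.

Lemma isometric_transitive x y : enorm x = 1 -> enorm y = 1 ->
  exists Q : 'M[R]_d, isometric Q /\ x *m Q = y.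
Proof.
move=> x1 y1; have [->|xy] := eqVneq x y.
  by exists 1%:M; split; [rewrite /isometric trmx1 mulmx1|rewrite mulmx1].
have w1 := enorm_normalize (_ : x - y != 0).
exists (reflection ((enorm (x - y))^-1 *: (x - y))); split; last exact: reflection_swap.
by rewrite /isometric tr_reflection reflectionK// w1// subr_eq0.
Qed.

(** The reflection exchanging x and y has determinant -1. Composing it with the reflection in e,
    which fixes the subspace of P pointwise, gives a rotation with the same effect there. *)
Lemma rotation_transitive P x y e : P^T = P -> P *m P = P ->
  enorm e = 1 -> e *m P = 0 -> enorm x = 1 -> enorm y = 1 -> subsp P x -> subsp P y ->
  exists Q, [/\ rotation Q, rot_sub Q P = P & x *m Q = y].
Proof.
move=> sP iP e1 eP x1 y1 xP yP.
have [->|xy] := eqVneq x y.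
  exists 1%:M; split; [split; first by rewrite trmx1 mulmx1|..]; rewrite ?det1 ?mulmx1//.
  by rewrite /rot_sub trmx1 mul1mx mulmx1.
pose w := (enorm (x - y))^-1 *: (x - y).
have w1 : enorm w = 1 by rewrite enorm_normalize// subr_eq0.
have wP : w *m P = w by rewrite -scalemxAl mulmxBl xP yP.
have rP v : v *m P = 0 \/ v *m P = v -> reflection v *m P = P *m reflection v.
  move=> vP; rewrite mulmxBl mulmxBr mul1mx mulmx1 -scalemxAl -scalemxAr; congr (_ - _ *: _).
  rewrite -mulmxA [RHS]mulmxA -[P *m v^T]trmxK trmx_mul trmxK sP.
  by case: vP => ->; rewrite ?trmx0 ?mulmx0 ?mul0mx.
have Qw := reflectionK w1; have Qe := reflectionK e1.
exists (reflection w *m reflection e); split.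
- split; last by rewrite det_mulmx !det_reflection// mulrNN mulr1.
  by rewrite trmx_mul !tr_reflection mulmxA -[_ *m _ *m reflection w]mulmxA Qw mulmx1 Qe.
- rewrite /rot_sub trmx_mul !tr_reflection -!mulmxA [P *m _]mulmxA -rP; last by right.
  rewrite -[reflection w *m P *m _]mulmxA [reflection w *m (reflection w *m _)]mulmxA Qw mul1mx.
  by rewrite -rP ?mulmxA ?Qe ?mul1mx//; left.
- have xw : x *m reflection w = y by exact: reflection_swap.
  rewrite mulmxA xw mulmx_reflection -{2}yP dotE -mulmxA -[P *m e^T]trmxK trmx_mul trmxK sP eP trmx0 mulmx0 mxE.
  by rewrite mulr0 scale0r subr0.
Qed.

End orthogonal_projections.

(** * The rotation invariant probability of a subsphere *)

Lemma finite_sigma_finite d (T : measurableType d) (R : realType) (mu : {measure set T -> \bar R}) :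
  (mu setT < +oo)%E -> sigma_finite setT mu.
Proof.
move=> h; exists (fun=> setT); last by move=> _; split.
by apply/seteqP; split => // x _; exists 0%N.
Qed.

Section spherical.
Variables (R : realType) (k d : nat) (V : 'M[R]_(k, d)).
Hypotheses (k0 : (0 < k)%N) (hO : isometric V).
Let P := V^T *m V.

(** Without the origin, which [radial_proj] does not send to the sphere. *)
Definition punctured_ball : set (VB R k) :=
  [set x | 0 < enorm x /\ enorm x <= 1].

Lemma measurable_punctured_ball : measurable punctured_ball.
Proof.
rewrite (_ : punctured_ball = (fun x : VB R k => enorm x) @^-1` `]0, 1]).
  by apply: preimage_measurable => //; exact: measurable_enorm.
by apply/seteqP; split => x; rewrite /punctured_ball /= in_itv/=; [move=> [-> ->]|move/andP].
Qed.

Lemma leb_punctured_ball : leb R k punctured_ball = (kappa R k)%:E.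
Proof.
rewrite kappaE -leb_eball1; apply/eqP; rewrite eq_le; apply/andP; split.
  apply: (@le_measure _ _ _ (leb R k)); rewrite ?inE.
  - exact: measurable_punctured_ball.
  - exact: measurable_eball.
  - by move=> x [].
have e0 : leb R k (eball k 0) = 0%E.
  by rewrite leb_eball_ge0// expr0n gtn_eqF// mul0r.
apply: (@le_trans _ _ (leb R k (punctured_ball `|` eball k 0))).
  apply: (@le_measure _ _ _ (leb R k)); rewrite ?inE.
  - exact: measurable_eball.
  - by apply: measurableU; [exact: measurable_punctured_ball|exact: measurable_eball].
  - move=> x h; have := enorm_ge0 (x : 'rV[R]_k); rewrite le_eqVlt => /predU1P[e|x0].
      by right; rewrite /eball /= -e.
    by left.
apply: (le_trans (measureU2 _ measurable_punctured_ball (@measurable_eball R k 0))).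
by rewrite [X in (_ + X)%E]e0 adde0.
Qed.

Definition radial_proj (x : VB R k) : VB R d :=
  (enorm x)^-1 *: (x *m V).

Lemma measurable_radial_proj : measurable_fun setT radial_proj.
Proof.
apply: measurable_funZ_VB; last exact: measurable_fun_mulmx.
apply: (measurableT_comp (@measurable_inv R)); exact: measurable_enorm.
Qed.

Let kappa_inv_ge0 : 0 <= (kappa R k)^-1.
Proof. by rewrite invr_ge0 ltW// kappa_gt0. Qed.

(** The uniform distribution on the unit sphere of the row space of V, as the radial image of
    normalized volume on the ball. *)
Definition spherical : set (VB R d) -> \bar R := mscale (NngNum kappa_inv_ge0)
  (image_measure measurable_radial_proj (mrestr (leb R k) measurable_punctured_ball)).

HB.instance Definition _ := Measure.on spherical.

Lemma sphericalE A :
  spherical A = (((kappa R k)^-1)%:E * leb R k (radial_proj @^-1` A `&` punctured_ball))%E.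
Proof. by []. Qed.

Lemma spherical_setT : spherical setT = 1%E.
Proof.
rewrite sphericalE preimage_setT setTI leb_punctured_ball -EFinM mulVf//.
by rewrite gt_eqF// kappa_gt0.
Qed.

Let radial_sphere x : punctured_ball x -> (@sphere R d `&` subsp P) (radial_proj x).
Proof.
move=> [x0 _]; rewrite /radial_proj; split.
  rewrite /sphere /= enormZ enorm_isometric// gtr0_norm ?invr_gt0// mulVf// gt_eqF//.
by rewrite /subsp /= -scalemxAl -mulmxA [V *m _]mulmxA hO mul1mx.
Qed.

Lemma spherical_off_sphere : spherical (~` (@sphere R d `&` subsp P)) = 0%E.
Proof.
rewrite sphericalE (_ : _ `&` _ = set0) ?measure0 ?mule0//.
by apply/seteqP; split => // x [h /radial_sphere].
Qed.

(** Orthogonal invariance of volume is inherited from Hausdorff measure; the ball of radius 2 is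
    only there to make A bounded. *)
Let leb_isometric (H : 'M[R]_k) (A : set (VB R k)) : isometric H -> measurable A ->
  A `<=` @oball R k 2 -> leb R k [set x : VB R k | A (x *m H)] = leb R k A.
Proof.
move=> hH mA A2; have hH' : H^T *m H = 1%:M := mulmx1C hH.
rewrite -(@hausdorff_leb R k 2 A)// -(@hausdorff_leb R k 2)//; last 2 first.
- by apply: preimage_measurable mA; exact: measurable_fun_mulmx.
- by move=> x /A2; rewrite /oball /= enorm_isometric.
rewrite -(@hausdorff_isometric R k k k H)//; congr (hausdorff _ _); apply/seteqP; split => y.
  by move=> [x Ax <-].
by move=> Ay; exists (y *m H^T) => /=; rewrite -mulmxA hH' mulmx1.
Qed.

Lemma spherical_equal_balls : equal_ball_measures (@sphere R d `&` subsp P) spherical.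
Proof.
split; first exact: spherical_off_sphere.
move=> r r0; pose cap (a : 'rV[R]_k) : set (VB R k) :=
  [set x | enorm (a - (enorm x)^-1 *: (x : 'rV[R]_k)) < r] `&` punctured_ball.
have mcap (a : 'rV[R]_k) : measurable (cap a).
  apply: measurableI; last exact: measurable_punctured_ball.
  rewrite (_ : [set x | _] = (fun x : VB R k =>
    enorm (a - (enorm x)^-1 *: (x : 'rV[R]_k))) @^-1` `]-oo, r[).
    apply: preimage_measurable => //; apply: measurable_fun_enorm.
    apply: measurable_funD_VB => //; apply: measurable_funN_VB; apply: measurable_funZ_VB => //.
    apply: (measurableT_comp (@measurable_inv R)); exact: measurable_enorm.
  by apply/seteqP; split => x /=; rewrite in_itv.
have ballE a : spherical (open_ball (a *m V : 'rV[R]_d) r) = (((kappa R k)^-1)%:E * leb R k (cap a))%E.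
  rewrite sphericalE; congr (_ * leb _ _ _)%E; apply/seteqP; split => x [];
    by rewrite /open_ball /radial_proj /= scalemxAl -mulmxBl enorm_isometric// => ? ?; split.
have capE a b : enorm a = 1 -> enorm b = 1 -> leb R k (cap a) = leb R k (cap b).
  move=> a1 b1; have [H [hH aH]] := isometric_transitive a1 b1.
  rewrite -(leb_isometric hH (mcap b)); last first.
    by move=> x [_ [_ x1]]; rewrite /oball /=; apply: le_lt_trans x1 _; rewrite ltr1n.
  congr (leb _ _ _); apply/seteqP; split => x; rewrite /cap /punctured_ball /= enorm_isometric//.
    by rewrite -aH scalemxAl -mulmxBl enorm_isometric.
  by rewrite -aH scalemxAl -mulmxBl enorm_isometric.
have coord x : (@sphere R d `&` subsp P) x -> exists a : 'rV[R]_k, enorm a = 1 /\ x = a *m V.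
  move=> [x1 xP]; have xE : x = x *m V^T *m V by rewrite -mulmxA; exact/esym.
  by exists (x *m V^T); split => //; rewrite -(enorm_isometric _ hO) -xE.
have [[x0 Sx0]|h] := pselect ((@sphere R d `&` subsp P) !=set0); last first.
  by exists 0%E => x Sx; exfalso; apply: h; exists x.
exists (spherical (open_ball x0 r)) => x Sx.
have [a [a1 ->]] := coord _ Sx; have [b [b1 ->]] := coord _ Sx0.
by rewrite !ballE (capE a b).
Qed.

(** Since k < d, some row of 1 - P is nonzero; normalized, it is the vector e by which
    [rotation_transitive] adjusts the determinant. *)
Lemma sphere_prob_equal_balls (sigma : {measure set (VB R d) -> \bar R}) : (k < d)%N ->
  sphere_prob P sigma -> equal_ball_measures (@sphere R d `&` subsp P) sigma.
Proof.
move=> kd [_ [s0 sQ]]; split => // r r0.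
have [sP [iP rP]] := isometric_Grass hO; rewrite -/P in sP iP rP.
have [i ri] : exists i, row i (1%:M - P) != 0.
  apply: contrapT => /forallNP h.
  have e : 1%:M - P = 0.
    by apply/row_matrixP => i; rewrite row0; apply/eqP/negPn/negP; exact: h.
  have P1 : P = 1%:M by rewrite -[LHS]add0r -e subrK.
  by move: kd; rewrite -rP P1 mxrank1 ltnn.
have e1 := enorm_normalize ri; set e := _ *: _ in e1.
have eP : e *m P = 0 by rewrite -scalemxAl -row_mul mulmxBl mul1mx iP subrr row0 scaler0.
have [[x0 [x01 x0P]]|h] := pselect ((@sphere R d `&` subsp P) !=set0); last first.
  by exists 0%E => x Sx; exfalso; apply: h; exists x.
exists (sigma (open_ball x0 r)) => x [x1 xP].
have [Q [rQ QP xQ]] := rotation_transitive sP iP e1 eP x1 x01 xP x0P.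
rewrite -(sQ Q rQ QP (open_ball x0 r)); last exact: measurable_open_ball.
congr (sigma _); apply/seteqP; split => y; rewrite /open_ball /= -xQ -mulmxBl enorm_isometric//;
  by apply: mulmx1C; have [] := rQ.
Qed.

Lemma sphere_prob_unique (sigma : {measure set (VB R d) -> \bar R}) A : (k < d)%N ->
  sphere_prob P sigma -> measurable A -> sigma A = spherical A.
Proof.
move=> kd hs mA; have [sT _] := hs.
have h1 : sigma_finite setT sigma by apply: finite_sigma_finite; rewrite sT ltry.
have h2 : sigma_finite setT spherical.
  by apply: (@finite_sigma_finite _ _ _ spherical); rewrite [X in (X < _)%E]spherical_setT ltry.
apply: (@equal_ball_measures_unique R d _ (measurable_sphere_subsp P)
  (with_sigma_finite h1) (with_sigma_finite h2)) => //.
- exact: spherical_setT.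
- exact: sphere_prob_equal_balls.
- exact: spherical_equal_balls.
Qed.

End spherical.

HB.instance Definition _ (R : realType) m :=
  Measure_isSigmaFinite.Build _ _ _ (@gnomonic R m) (finite_sigma_finite (gnomonic_lty R m)).

(** * The uniform distribution on a sphere as a sum over two half spheres *)

Section tilt.
Variables (R : realType) (m d : nat) (W : 'M[R]_(m, d)).
Hypothesis hW : isometric W.

Definition tilt (p : VB R d * VB R m) : VB R d :=
  slope (p.2 : 'rV[R]_m) *: ((p.1 : 'rV[R]_d) + p.2 *m W).

Lemma measurable_tilt : measurable_fun setT tilt.
Proof.
apply: measurable_funZ_VB.
  by apply: (measurableT_comp (measurable_slope (m := m))); exact: measurable_snd.
apply: measurable_funD_VB; first exact: measurable_fst.
by apply: measurable_fun_mulmx; exact: measurable_snd.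
Qed.

Section spherical_halves.
Variable u : 'rV[R]_d.
Hypotheses (u1 : enorm u = 1) (uW : u *m W^T = 0).

Lemma isometric_col_mx : isometric (col_mx u W).
Proof.
rewrite /isometric tr_col_mx mul_col_row hW uW (mul_col_row_dot u1).
by rewrite -[W *m u^T]trmxK trmx_mul trmxK uW trmx0 -scalar_mx_block.
Qed.

Lemma leb_product_reflect (E : set (VB R 1 * VB R m)) : measurable E ->
  (leb R 1 \x leb R m)%E [set p : VB R 1 * VB R m | E (- (p.1 : 'rV[R]_1) : VB R 1, p.2)] =
  (leb R 1 \x leb R m)%E E.
Proof.
move=> mE; set F := [set p | _].
have mF : measurable F.
  apply: (preimage_measurable (f := fun p : VB R 1 * VB R m => (- (p.1 : 'rV[R]_1) : VB R 1, p.2))) mE.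
  apply: measurable_fun_pair; last exact: measurable_snd.
  by apply: measurable_funN_VB; exact: measurable_fst.
rewrite {1}/product_measure1 (product_measure_swap (leb R 1) (leb R m) mF).
rewrite /product_measure1 (product_measure_swap (leb R 1) (leb R m) mE).
apply: eq_integral => z _.
rewrite -[RHS]lebN; last exact: measurable_ysection.
by congr (leb _ _ _); apply/seteqP; split => x; rewrite /ysection /= !inE.
Qed.

Lemma leb_product_hyperplane :
  (leb R 1 \x leb R m)%E [set p : VB R 1 * VB R m | (p.1 : 'rV[R]_1) ord0 ord0 = 0] = 0%E.
Proof.
have e0 : leb R 1 (eball 1 0) = 0%E by rewrite leb_eball_ge0// expr1 mul0r.
rewrite (_ : [set p | _] = eball 1 0 `*` setT).
  by rewrite product_measure1E//; [rewrite [X in (X * _)%E]e0 mul0e|exact: measurable_eball].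
apply/seteqP; split => p; rewrite /eball /= enorm_rV1; first by move=> ->; rewrite normr0.
by move=> [+ _]; rewrite normr_le0 => /eqP.
Qed.

(** The hyperplane orthogonal to u is null and cuts the ball into two half balls. On each of them
    the radial projection depends only on the central projection to the tangent hyperplane at u or -
    u. *)
Lemma spherical_gnomonic A : measurable A ->
  spherical (col_mx u W : 'M[R]_(1 + m, d)) A = (((kappa R m.+1)^-1)%:E *
    (gnomonic [set w : VB R m | A (tilt (u : VB R d, w))] +
     gnomonic [set w : VB R m | A (tilt ((- u)%R : VB R d, w))]))%E.
Proof.
move=> mA; rewrite sphericalE; congr (_ * _)%E.
have mX := measurableI _ _ (preimage_measurable (measurable_radial_proj (col_mx u W)) mA)
  (@measurable_punctured_ball R (1 + m)).
rewrite (@leb_row_mx R 1 m)//.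
set X := [set p | _].
have mXp : measurable X.
  apply: (preimage_measurable (f := fun p : VB R 1 * VB R m =>
    row_mx (p.1 : 'rV[R]_1) (p.2 : 'rV[R]_m) : VB R (1 + m)) _ mX).
  by apply: measurable_fun_row_mx; [exact: measurable_fst|exact: measurable_snd].
have mc : measurable_fun setT (fun p : VB R 1 * VB R m => (p.1 : 'rV[R]_1) ord0 ord0).
  by apply: measurable_fun_coord; exact: measurable_fst.
pose Y (s : R) : set (VB R 1 * VB R m) := @half_ball R m `&`
  [set p | A (tilt (s *: u : VB R d, central_proj p))].
have mY s : measurable (Y s).
  apply: measurableI; first exact: measurable_half_ball.
  apply: (preimage_measurable (f := fun p : VB R 1 * VB R m => tilt (s *: u : VB R d, central_proj p))) mA.
  apply: (measurableT_comp measurable_tilt); apply: measurable_fun_pair => //.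
  exact: measurable_central_proj.
(* Where the first coordinate has sign s, reflecting it to the positive side turns the radial
   projection into [tilt] at s u and the central projection. *)
have XY (s : R) (p : VB R 1 * VB R m) : s ^+ 2 = 1 -> 0 < s * (p.1 : 'rV[R]_1) ord0 ord0 ->
    X p <-> Y s (s *: (p.1 : 'rV[R]_1) : VB R 1, p.2).
  move=> s1 sp; set t := (p.1 : 'rV[R]_1) ord0 ord0 in sp.
  have ns : `|s| = 1 by apply/eqP; rewrite -(eqrXn2 (n := 2))// expr1n real_normK ?num_real// s1.
  have n1 : enorm p.1 ^+ 2 = t ^+ 2 by rewrite enorm_rV1 real_normK ?num_real.
  have t2 : 0 < t ^+ 2 by rewrite -(mul1r (t ^+ 2)) -s1 -exprMn exprn_gt0.
  set D := t ^+ 2 + enorm p.2 ^+ 2.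
  have D0 : 0 < D by rewrite ltr_pwDl// sqr_ge0.
  have nE : enorm (row_mx (p.1 : 'rV[R]_1) (p.2 : 'rV[R]_m)) = Num.sqrt D.
    by rewrite -[LHS]ger0_norm ?enorm_ge0// -sqrtr_sqr enorm_row_mx n1.
  have tE : tilt (s *: u : VB R d, central_proj (s *: (p.1 : 'rV[R]_1) : VB R 1, p.2)) =
      radial_proj (col_mx u W) (row_mx (p.1 : 'rV[R]_1) (p.2 : 'rV[R]_m)).
    rewrite /tilt /central_proj /radial_proj /= nE mul_row_col mxE -/t -scalemxAl.
    have -> : s *: u + (s * t)^-1 *: (p.2 *m W) =
        (s * t)^-1 *: (p.1 *m u + p.2 *m W).
      rewrite scalerDr; congr (_ + _).
      rewrite [X in _ *: (X *m u)]mx11_scalar mul_scalar_mx scalerA -/t; congr (_ *: _).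
      apply: (mulfI (lt0r_neq0 sp)); rewrite mulrA mulfV ?lt0r_neq0// mul1r.
      by rewrite mulrAC -expr2 s1 mul1r.
    rewrite scalerA; congr (_ *: _).
    rewrite /slope enormZ exprMn real_normK ?num_real// exprVn exprMn s1 mul1r.
    rewrite -invfM; congr (_^-1).
    rewrite -[s * t]ger0_norm ?(ltW sp)// -sqrtr_sqr -sqrtrM; last first.
      by rewrite addr_ge0// mulr_ge0 ?sqr_ge0// invr_ge0 sqr_ge0.
    congr Num.sqrt; rewrite exprMn s1 mul1r /D.
    have t0 : t != 0 by rewrite -sqrf_eq0 gt_eqF.
    by field.
  have sq : (Num.sqrt D <= 1) = (D <= 1) by rewrite -[X in _ <= X]sqrtr1 ler_sqrt.
  rewrite /X /Y /= tE; split.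
    move=> [Ax [_ x1]]; split => //; split; first by rewrite /half_line /= mxE.
    by rewrite enormZ ns mul1r n1 -/D -sq -nE.
  move=> [[_ h] Ax]; split => //; split; first by rewrite nE sqrtr_gt0.
  by move: h; rewrite enormZ ns mul1r n1 -/D -sq -nE.
have gE (s : R) : gnomonic [set w : VB R m | A (tilt (s *: u : VB R d, w))] =
    (leb R 1 \x leb R m)%E (Y s).
  by rewrite /gnomonic /image_measure /mrestr; congr (_ _); rewrite setIC.
have := gE 1; rewrite scale1r => ->; have := gE (-1); rewrite scaleN1r => ->.
rewrite -(leb_product_reflect (mY (-1))).
set Z := [set p | _].
have mZ : measurable Z.
  apply: (preimage_measurable (f := fun p : VB R 1 * VB R m => (- (p.1 : 'rV[R]_1) : VB R 1, p.2)) _ (mY (-1))).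
  apply: measurable_fun_pair; last exact: measurable_snd.
  by apply: measurable_funN_VB; exact: measurable_fst.
pose H : set (VB R 1 * VB R m) := [set p | (p.1 : 'rV[R]_1) ord0 ord0 = 0].
have mH : measurable H by exact: preimage_measurable mc (measurable_set1 (0 : R)).
have H0 := leb_product_hyperplane : (leb R 1 \x leb R m)%E H = 0%E.
have YZ : Y 1 `&` Z = set0.
  apply/seteqP; split => // p [[[/= h1 _] _] [[/= h2 _] _]].
  by move: h1 h2; rewrite /half_line /= mxE => h1; rewrite oppr_gt0 ltNge (ltW h1).
rewrite -(measureU _ (mY 1) mZ YZ).
have inX p : Y 1 p \/ Z p -> X p.
  move=> [h|h].
    have p0 := h.1.1; rewrite /half_line /= in p0.
    apply/(XY 1 p); rewrite ?expr1n ?mul1r//.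
    by rewrite scale1r -surjective_pairing.
  have p0 := h.1.1; rewrite /half_line /= mxE in p0.
  apply/(XY (-1) p); rewrite ?sqrrN ?expr1n ?mulN1r//.
  by rewrite scaleN1r.
apply/eqP; rewrite eq_le; apply/andP; split; last first.
  by apply: (@le_measure _ _ _ (leb R 1 \x leb R m)%E); rewrite ?inE//; exact: measurableU.
apply: (@le_trans _ _ ((leb R 1 \x leb R m)%E ((Y 1 `|` Z) `|` H))).
  apply: (@le_measure _ _ _ (leb R 1 \x leb R m)%E); rewrite ?inE//.
    by apply: measurableU => //; exact: measurableU.
  move=> p Xp; have [p0|p0|p0] := ltgtP ((p.1 : 'rV[R]_1) ord0 ord0) 0.
  - left; right; have := (XY (-1) p _ _).1 Xp; rewrite ?sqrrN ?expr1n ?mulN1r ?oppr_gt0// => /(_ erefl p0).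
    by rewrite scaleN1r.
  - left; left; have := (XY 1 p _ _).1 Xp; rewrite ?expr1n ?mul1r// => /(_ erefl p0).
    by rewrite scale1r -surjective_pairing.
  - by right.
apply: (le_trans (measureU2 _ (measurableU _ _ (mY 1) mZ) mH)).
by rewrite [X in (_ + X)%E]H0 adde0.
Qed.

End spherical_halves.

End tilt.

(** * Disintegration of the area measure *)

Lemma area_measure_lty (R : realType) n d j (P : 'M[R]_d) (K : set 'rV[R]_d)
    (mu : {measure set (VB R d) -> \bar R}) :
  is_area_measure n (subsp P) K j mu -> (mu setT < +oo)%E.
Proof.
move=> [mu0 [Phi [muE _]]]; have mS := measurable_sphere_subsp P.
rewrite -(setvU (@sphere R d `&` subsp P : set (VB R d))).
apply: (le_lt_trans (measureU2 _ (measurableC mS) mS)).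
by rewrite [X in (X + _)%E]mu0 add0e [X in (X < _)%E](muE _ mS (fun _ h => h)) ltry.
Qed.

Section disintegration.
Variables (R : realType) (N m d : nat).
Hypotheses (m0 : (0 < m)%N) (dNm : d = (N.+1 + m)%N).
Variables (U : 'M[R]_(N.+1, d)) (W : 'M[R]_(m, d)).
Hypotheses (hU : isometric U) (hW : isometric W) (UW : U *m W^T = 0).
Variables (K0 : set 'rV[R]_N.+1) (hK : convex_body K0) (sK : origin_symmetric K0).

Let L := U^T *m U.
Let K' : set 'rV[R]_d := [set y *m U | y in K0].

Variables (mu mu' : {measure set (VB R d) -> \bar R}).
Hypotheses (hmu : is_area_measure d setT K' N mu)
  (hmu' : is_area_measure N.+1 (subsp L) K' N mu').

Definition untilt (v : VB R d) : VB R d * VB R m :=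
  ((enorm (v *m L))^-1 *: (v *m L),
   (enorm (v *m L))^-1 *: (v *m W^T)).

Lemma measurable_untilt : measurable_fun setT untilt.
Proof.
have mi : measurable_fun setT (fun v : VB R d => (enorm (v *m L))^-1).
  apply: (measurableT_comp (@measurable_inv R)); apply: measurable_fun_enorm.
  exact: measurable_fun_mulmx.
by apply: measurable_fun_pair; apply: measurable_funZ_VB => //; exact: measurable_fun_mulmx.
Qed.

Lemma untiltK (v : VB R d) : enorm v = 1 -> v *m L != 0 ->
  tilt W (untilt v) = v.
Proof.
move=> v1 vL; have vL0 : 0 < enorm (v *m L) by rewrite enorm_gt0.
rewrite /tilt /untilt /= -scalemxAl -scalerDr -mulmxA -mulmxDr orthonormal_decomposition// mulmx1 scalerA.
rewrite -[RHS]scale1r; congr (_ *: _).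
rewrite /slope -invfM enormZ gtr0_norm ?invr_gt0//.
have e : enorm (v *m L) ^+ 2 + enorm (v *m W^T) ^+ 2 = 1.
  rewrite /L mulmxA (enorm_isometric _ hU) -(@enorm_orth_sum R N.+1 m d U W (v *m U^T, v *m W^T))//=.
  by rewrite /orth_sum /= -!mulmxA -mulmxDr orthonormal_decomposition// mulmx1 v1 expr1n.
rewrite -[X in _ * X]ger0_norm ?(ltW vL0)// -sqrtr_sqr -sqrtrM; last by rewrite addr_ge0// sqr_ge0.
rewrite mulrDl mul1r exprMn mulrAC exprVn mulVf ?mul1r ?e ?sqrtr1 ?invr1//.
by rewrite sqrf_eq0 gt_eqF.
Qed.

Lemma sigma_finite_area_measure : sigma_finite setT mu'.
Proof. exact: finite_sigma_finite (area_measure_lty hmu'). Qed.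

Let nu' := with_sigma_finite sigma_finite_area_measure.

(** The scaled image [rho] of mu under [untilt] agrees with the product measure on rectangles by
    [area_measure_tilted], hence everywhere. Mapping back by [tilt] recovers mu up to the vectors
    with v L = 0, null by [area_measure_perp]. *)
Lemma area_measure_tilt A : measurable A ->
  mu A = ((2 / kappa R m.+1)%:E * (nu' \x @gnomonic R m)%E (tilt W @^-1` A))%E.
Proof.
move=> mA; pose B0 := tilted_set U W setT setT.
have mB0 : measurable B0 by exact: measurable_tilted_set.
have k0 : 0 < kappa R m.+1 by exact: kappa_gt0.
have c0 : 0 <= kappa R m.+1 / 2 by rewrite divr_ge0// ltW.
pose rho := mscale (NngNum c0) (image_measure measurable_untilt (mrestr mu mB0)).
have rhoE X : rho X = ((kappa R m.+1 / 2)%:E * mu (untilt @^-1` X `&` B0))%E by [].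
rewrite (@product_measure_unique _ _ _ _ _ nu' (@gnomonic R m) rho); last 2 first.
- move=> X C mX mC.
  transitivity ((kappa R m.+1 / 2)%:E * mu (untilt @^-1` (X `*` C) `&` B0))%E; first by [].
  rewrite (_ : _ `&` _ = tilted_set U W X C); last first.
    apply/seteqP; split => v; rewrite /B0 /tilted_set /untilt /=.
      by move=> [[? ?] [? ? _ _]]; split.
    by move=> [? ? ? ?]; split.
  rewrite (area_measure_tilted m0 dNm hU hW UW hK hmu hmu' mX mC) muleCA; congr (_ * _)%E.
  rewrite muleA -EFinM (_ : _ * _ = 1) ?mul1e//; field.
  by rewrite gt_eqF.
- exact: preimage_measurable (measurable_tilt W) mA.
rewrite [X in (_ * X)%E](_ : _ = (kappa R m.+1 / 2)%:E * mu (untilt @^-1` (tilt W @^-1` A) `&` B0))%E//.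
rewrite muleA -EFinM (_ : _ * _ = 1) ?mul1e; last by field; rewrite gt_eqF.
rewrite (_ : _ `&` _ = A `&` B0); last first.
  apply/seteqP; split => v [+ [v1 vL _ _]]; rewrite /= untiltK//; by split.
have mAB : measurable (A `&` B0) by exact: measurableI.
apply/eqP; rewrite eq_le; apply/andP; split; last by apply: le_measure; rewrite ?inE.
have p0 := area_measure_perp m0 dNm hU hW UW hK hmu; set Q := [set v | _] in p0.
have [mu0 _] := hmu; rewrite setIT in mu0.
have mS : measurable (~` @sphere R d : set (VB R d)).
  apply: measurableC.
  rewrite (_ : (@sphere R d : set (VB R d)) = (fun v : VB R d => enorm v) @^-1` [set 1])//.
  by apply: preimage_measurable => //; exact: measurable_enorm.
have mQ : measurable Q.
  rewrite (_ : Q = (~` (~` @sphere R d : set (VB R d))) `&` (fun v : VB R d => enorm (v *m L)) @^-1` [set 0]).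
    apply: measurableI; first exact: measurableC.
    apply: preimage_measurable => //; apply: measurable_fun_enorm; exact: measurable_fun_mulmx.
  apply/seteqP; split => v; rewrite setCK /Q /sphere /=; first by move=> [-> ->]; rewrite enorm0.
  by move=> [? /eqP]; rewrite enorm_eq0 => /eqP.
apply: (@le_trans _ _ (mu (A `&` B0 `|` (~` @sphere R d `|` Q)))).
  apply: le_measure; rewrite ?inE//; first by apply: measurableU => //; exact: measurableU.
  move=> v Av; have [v1|v1] := pselect (@sphere R d v); last by right; left.
  have [vL|vL] := eqVneq (v *m L) 0; first by right; right.
  by left; split => //; split.
apply: (le_trans (measureU2 _ mAB (measurableU _ _ mS mQ))).
rewrite -[leRHS]adde0; apply: leeD => //.
apply: (le_trans (measureU2 _ mS mQ)).
by rewrite [X in (X + _)%E]mu0 [X in (_ + X)%E]p0 adde0.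
Qed.

Section nonnegative.
Variable g : VB R d -> \bar R.
Hypotheses (mg : measurable_fun setT g) (g0 : forall x, (0 <= g x)%E).

Definition tilt_average (u : VB R d) : \bar R :=
  (\int[@gnomonic R m]_w g (tilt W (u, w)))%E.

Let mgt : measurable_fun setT (g \o tilt W).
Proof. exact: measurableT_comp mg (measurable_tilt W). Qed.

Lemma measurable_tilt_average : measurable_fun setT tilt_average.
Proof.
apply: (@measurable_fun_fubini_tonelli_F _ _ _ _ _ (@gnomonic R m) (g \o tilt W)) => //.
by move=> p; exact: g0.
Qed.

Lemma tilt_average_ge0 u : (0 <= tilt_average u)%E.
Proof. exact: integral_ge0. Qed.

Lemma integral_area_measure :
  (\int[mu]_x g x = (2 / kappa R m.+1)%:E * \int[mu']_u tilt_average u)%E.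
Proof.
have c0 : 0 <= 2 / kappa R m.+1 by rewrite divr_ge0// ltW// kappa_gt0.
rewrite (eq_measure_integral (mscale (NngNum c0)
  (image_measure (measurable_tilt W) (nu' \x @gnomonic R m)%E))); last first.
  by move=> A mA _; rewrite area_measure_tilt.
rewrite ge0_integral_mscale//= ge0_integral_image_measure//; congr (_ * _)%E.
apply: (@fubini_tonelli1 _ _ _ _ _ nu' (@gnomonic R m) (g \o tilt W)) => //.
by move=> p; exact: g0.
Qed.

Let mN : measurable_fun setT (fun u : VB R d => - (u : 'rV[R]_d) : VB R d).
Proof. exact: measurable_funN_VB. Qed.

Lemma integral_tilt_averageN :
  (\int[mu']_u tilt_average (- (u : 'rV[R]_d))%R = \int[mu']_u tilt_average u)%E.
Proof.
rewrite -[LHS](@ge0_integral_image_measure _ _ _ _ _ _ mN mu' tilt_average setT)//.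
- apply: eq_measure_integral => A mA _.
  exact: (area_measure_even hU hW UW hK sK hmu' mA).
- exact: measurable_tilt_average.
- exact: tilt_average_ge0.
Qed.

Lemma integral_spherical (u : 'rV[R]_d) :
  (\int[spherical (col_mx u W : 'M[R]_(1 + m, d))]_x g x =
   ((kappa R m.+1)^-1)%:E * (tilt_average u + tilt_average (- u)%R))%E.
Proof.
have c0 : 0 <= (kappa R m.+1)^-1 by rewrite invr_ge0 ltW// kappa_gt0.
have mt (v : VB R d) : measurable_fun setT (fun w : VB R m => tilt W (v, w)).
  by apply: (measurableT_comp (measurable_tilt W)); apply: measurable_fun_pair.
rewrite (eq_measure_integral (mscale (NngNum c0) (measure_add
  (image_measure (mt u) (@gnomonic R m)) (image_measure (mt (- u)) (@gnomonic R m))))); last first.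
  move=> A mA _; apply: (etrans (spherical_gnomonic W u mA)).
  apply: (congr1 (fun x => ((kappa R m.+1)^-1)%:E * x)%E).
  by apply/esym; exact: (measure_addE (image_measure (mt u) (@gnomonic R m)) (image_measure (mt (- u)) (@gnomonic R m)) A).
rewrite ge0_integral_mscale//= ge0_integral_measure_add//; congr (_ * (_ + _))%E;
  by rewrite ge0_integral_image_measure.
Qed.

Let mS := measurable_sphere_subsp L.

Let measurable_sum :
  measurable_fun setT (fun u : VB R d => tilt_average u + tilt_average (- (u : 'rV[R]_d))%R)%E.
Proof.
apply: emeasurable_funD; first exact: measurable_tilt_average.
exact: measurableT_comp measurable_tilt_average mN.
Qed.

Lemma measurable_integral_spherical : measurable_fun (@sphere R d `&` subsp L : set (VB R d))
  (fun u : VB R d => (\int[spherical (col_mx (u : 'rV[R]_d) W : 'M[R]_(1 + m, d))]_x g x)%E).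
Proof.
apply: eq_measurable_fun; last first.
  apply: (@measurable_funTS _ _ _ _ _ (fun u : VB R d => ((kappa R m.+1)^-1)%:E *
     (tilt_average u + tilt_average (- (u : 'rV[R]_d))%R))%E).
  exact: measurable_funeM measurable_sum.
by move=> u _; rewrite integral_spherical.
Qed.

(** Evenness turns twice the integral of [tilt_average] into the integral of its values at u and -
    u, which [integral_spherical] combines into one sphere. *)
Lemma integral_area_measure_spherical :
  (\int[mu]_x g x = \int[mu']_(u in (@sphere R d `&` subsp L : set (VB R d)))
     \int[spherical (col_mx (u : 'rV[R]_d) W : 'M[R]_(1 + m, d))]_x g x)%E.
Proof.
have c0 : 0 <= (kappa R m.+1)^-1 by rewrite invr_ge0 ltW// kappa_gt0.
have s0 u : (0 <= tilt_average u + tilt_average (- (u : 'rV[R]_d))%R)%E.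
  by rewrite adde_ge0// tilt_average_ge0.
transitivity (\int[mu']_(u in (@sphere R d `&` subsp L : set (VB R d)))
    (((kappa R m.+1)^-1)%:E * (tilt_average u + tilt_average (- (u : 'rV[R]_d))%R)))%E; last first.
  by apply: eq_integral => u _; rewrite integral_spherical.
have [mu'0 _] := hmu'.
have -> : (@sphere R d `&` subsp L : set (VB R d)) = setT `\` ~` (@sphere R d `&` subsp L : set (VB R d)).
  by rewrite setTD setCK.
rewrite -(ge0_negligible_integral _ _ _ _ mu'0)//; last 3 first.
- exact: measurableC.
- exact: measurable_funeM measurable_sum.
- by move=> u _; rewrite mule_ge0// s0.
rewrite ge0_integralZl_EFin// ge0_integralD//; last 4 first.
- by move=> u _; exact: tilt_average_ge0.
- exact: measurable_tilt_average.
- by move=> u _; exact: tilt_average_ge0.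
- exact: measurableT_comp measurable_tilt_average mN.
rewrite integral_tilt_averageN integral_area_measure -mule2n -mule_natl muleA -EFinM; congr (_%:E * _)%E.
by rewrite mulrC.
Qed.

End nonnegative.

(** The nonnegative case for the positive and negative parts; by that same case both inner integrals
    are integrable in u, so they may be subtracted. *)
Lemma integral_area_measure_integrable (f : VB R d -> \bar R) : mu.-integrable setT f ->
  (\int[mu]_x f x = \int[mu']_(u in (@sphere R d `&` subsp L : set (VB R d)))
     \int[spherical (col_mx (u : 'rV[R]_d) W : 'M[R]_(1 + m, d))]_x f x)%E.
Proof.
move=> fi; have mf := measurable_int _ fi.
have mp : measurable_fun setT (f^\+)%E by exact: measurable_realfun.measurable_funepos.
have mn : measurable_fun setT (f^\-)%E by exact: measurable_realfun.measurable_funeneg.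
have p0 x : (0 <= f^\+ x)%E by [].
have n0 x : (0 <= f^\- x)%E by [].
have mS := measurable_sphere_subsp L.
pose A (g : VB R d -> \bar R) (u : VB R d) :=
  (\int[spherical (col_mx (u : 'rV[R]_d) W : 'M[R]_(1 + m, d))]_x g x)%E.
have A_int g : measurable_fun setT g -> (forall x, (0 <= g x)%E) ->
    (\int[mu]_x g x < +oo)%E -> mu'.-integrable (@sphere R d `&` subsp L : set (VB R d)) (A g).
  move=> mg g0 goo; have A0 u : (0 <= A g u)%E by exact: integral_ge0.
  apply/integrableP; split; first exact: measurable_integral_spherical.
  rewrite (_ : (\int[mu']_(x in _) _)%E = (\int[mu]_x g x)%E)//.
  rewrite integral_area_measure_spherical//; apply: eq_integral => u _.
  by rewrite gee0_abs.
rewrite [LHS]integralE (integral_area_measure_spherical mp p0) (integral_area_measure_spherical mn n0).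
rewrite -integralB//; first by apply: eq_integral => u _; rewrite [RHS]integralE.
- by apply: A_int => //; rewrite -ge0_fin_numE ?integral_ge0//; exact: integrable_pos_fin_num.
- by apply: A_int => //; rewrite -ge0_fin_numE ?integral_ge0//; exact: integrable_neg_fin_num.
Qed.

End disintegration.

(** * Continuous functions on the sphere and the identity for a fixed subspace *)

Lemma within_continuous_measurable (R : realType) d (S : set 'rV[R]_d) (f : 'rV[R]_d -> R) :
  closed S -> {within S, continuous f} -> measurable_fun (S : set (VB R d)) (f : VB R d -> R).
Proof.
move=> cS cf; apply: (measurability _ (RGenOpens.measurableE R)).
move=> _ [_ [a [b ->] <-]].
have /open_subspaceP[V oV VS] : open (f @^-1` `]a, b[ : set (subspace S)).
  by move/continuousP: cf; apply; exact: interval_open.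
rewrite setIC -VS; apply: measurableI; first exact: open_measurable_VB.
exact: closed_measurable_VB.
Qed.

Lemma closed_sphere (R : realType) d : closed (@sphere R d).
Proof.
rewrite (_ : @sphere R d = (fun x : 'rV[R]_d => enorm x) @^-1` [set t | t = 1])//.
apply: closed_comp; last exact: closed_eq.
by move=> x _; exact: enorm_continuous.
Qed.

Lemma compact_sphere (R : realType) d : compact (@sphere R d).
Proof.
apply: bounded_closed_compact; last exact: closed_sphere.
exists 1; split; first exact: num_real.
move=> M M1 x x1; apply: le_trans (mxnorm_le_enorm x) _.
by rewrite [enorm x]x1 ltW.
Qed.

Theorem theorem6p1 (R : realType) (d j : nat)
  (hd : (3 <= d)%N) (hj1 : (1 <= j)%N) (hj2 : (j <= d - 2)%N)
  (K : set 'rV[R]_d) (hK : convex_body K) (hsym : origin_symmetric K)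
  (nu : {measure set (MB R d) -> \bar R}) (hnu : grass_prob (j.+1) nu)
  (sigma : 'M[R]_d -> {measure set (VB R d) -> \bar R})
  (hsigma : forall P, Grass (d - j) P -> sphere_prob P (sigma P))
  (Psi : 'M[R]_d -> {measure set (VB R d) -> \bar R})
  (hPsi : forall L, Grass j.+1 L ->
            is_area_measure d setT (proj_body K L) j (Psi L))
  (Psi' : 'M[R]_d -> {measure set (VB R d) -> \bar R})
  (hPsi' : forall E, Grass j.+1 E ->
            is_area_measure j.+1 (subsp E) (proj_body K E) j (Psi' E))
  (f : 'rV[R]_d -> R) (hf : {within @sphere R d, continuous f}) :
  (\int[nu]_(L in Grass j.+1)
      \int[Psi L]_(x in (@sphere R d : set (VB R d))) (f x)%:E)%E =
  (\int[nu]_(E in Grass j.+1)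
      \int[Psi' E]_(u in (@sphere R d `&` subsp E : set (VB R d)))
        \int[sigma (perp_flag E u)]_(x in (@sphere R d `&` subsp (perp_flag E u)
                                             : set (VB R d)))
          (f x)%:E)%E.
Proof.
apply: eq_integral => L /set_mem gL.
have [U [W [hU hW UW LE QE]]] := Grass_orthonormal_bases gL.
set m := (d - j.+1)%N in W hW UW QE.
(* The complement of L has positive dimension because j <= d - 2. *)
have m0 : (0 < m)%N by rewrite /m; lia.
have dNm : d = (j.+1 + m)%N by rewrite /m; lia.
pose K0 := [set x *m U^T | x in K].
have KE : proj_body K L = [set y *m U | y in K0].
  rewrite /proj_body LE; apply/seteqP; split => x.
    by move=> [y Ky <-]; exists (y *m U^T); [exists y|rewrite mulmxA].
  by move=> [_ [y Ky <-] <-]; exists y => //; rewrite mulmxA.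
have hK0 : convex_body K0 by exact: convex_body_trmx.
have sK0 : origin_symmetric K0.
  rewrite /origin_symmetric /K0; apply/seteqP; split => x.
    by move=> [_ [y Ky <-] <-]; exists (- y); [rewrite -hsym; exists y|rewrite mulNmx].
  move=> [y Ky <-]; exists ((- y) *m U^T); first by exists (- y) => //; rewrite -hsym; exists y.
  by rewrite mulNmx opprK.
have hm := hPsi L gL; have hm' := hPsi' L gL.
rewrite KE in hm hm'; rewrite {1}LE in hm'.
have mS : measurable (@sphere R d : set (VB R d)).
  by apply: closed_measurable_VB; exact: closed_sphere.
have mf : measurable_fun (@sphere R d : set (VB R d)) (EFin \o f : VB R d -> \bar R).
  by apply/measurable_EFinP; apply: within_continuous_measurable => //; exact: closed_sphere.
(* Continuity is assumed on the sphere only; extension by zero gives a function measurable on the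
   whole space, to which the disintegration applies. *)
pose f1 : VB R d -> \bar R := (EFin \o f) \_ (@sphere R d).
have mf1 : measurable_fun setT f1.
  by apply/measurable_restrict => //; rewrite setTI.
have fin : (Psi L).-integrable (@sphere R d : set (VB R d)) (EFin \o f).
  apply: measurable_bounded_integrable => //.
  - have [h0 [Phi [muE _]]] := hm; rewrite setIT in muE.
    by rewrite muE ?ltry.
  - by apply: within_continuous_measurable => //; exact: closed_sphere.
  - have /(@compact_bounded R R^o)[M [Mr hM]] := continuous_compact hf (@compact_sphere R d).
    by exists M; split => // r /hM h x Sx; apply: h; exists x.
have fin1 : (Psi L).-integrable setT f1 by apply/(integrable_mkcond _ mS).1.
transitivity (\int[Psi L]_x f1 x)%E; first by rewrite integral_mkcond.
rewrite (integral_area_measure_integrable m0 dNm hU hW UW hK0 sK0 hm hm' fin1) -LE.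
apply: eq_integral => u /set_mem[u1 uL].
have uW : u *m W^T = 0 by rewrite -uL LE -!mulmxA UW !mulmx0.
(* The rows of V form an orthonormal basis of R u + L^perp, the subspace of [perp_flag L u]. *)
have hV := isometric_col_mx hW u1 uW; set V := col_mx _ _ in hV.
have PE : perp_flag L u = V^T *m V.
  by rewrite tr_col_mx mul_row_col /perp_flag QE addrC.
have gP : Grass (d - j) (perp_flag L u).
  by rewrite PE (_ : (d - j)%N = (1 + m)%N); [exact: isometric_Grass|rewrite /m; lia].
have sP := hsigma _ gP.
set P := perp_flag L u in PE gP sP *.
have mP := measurable_sphere_subsp P.
pose f2 : VB R d -> \bar R := (EFin \o f) \_ (@sphere R d `&` subsp P).
have mf2 : measurable_fun setT f2.
  apply/measurable_restrict => //; rewrite setTI.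
  by apply: (measurable_funS _ _ mf) => // x [].
transitivity (\int[spherical V]_(x in (@sphere R d `&` subsp P : set (VB R d))) (f x)%:E)%E; last first.
  apply: esym; apply: eq_measure_integral => A mA _.
  (* The subspace has dimension 1 + m = d - j, which is less than d since j >= 1. *)
  by apply: sphere_prob_unique; rewrite -?PE//; lia.
rewrite [RHS]integral_mkcond; apply: ae_eq_integral => //.
(* The two extensions by zero can differ only off the unit sphere of the subspace, where
   [spherical V] has no mass. *)
exists (~` (@sphere R d `&` subsp P)); split; first exact: measurableC.
- by rewrite PE; exact: spherical_off_sphere.
move=> x /= h [x1 xP]; apply: h => _; rewrite /f1 /f2 !patchE !mem_set//.
Qed.
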